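(* Let $\alpha_- <0< \alpha_+$ be the constants defined in the context ($\alpha_+ \simeq 33.2054$, $\alpha_- \simeq -9.3885$). For a rectangle $\mathcal{R} \subset \mathbb{R}^2$ write $A$ for its area and $L$ for its perimeter. If $\alpha \in [\alpha_-,\alpha_+]$ then $\lambda_2(\mathcal{R};\alpha/L)\,A$ is maximal for the square and only the square, among rectangles $\mathcal{R}$. If $\alpha \notin [\alpha_-,\alpha_+]$ then the degenerate rectangle is asymptotically maximal among all rectangles, meaning that $\lambda_2(\mathcal{R};\alpha/L)\,A < \alpha$ for every rectangle $\mathcal{R}$, with equality in the limit as $\mathcal{R}$ degenerates to an interval (that is, $\lambda_2(\mathcal{R};\alpha/L)\,A \to \alpha$ as the aspect ratio of $\mathcal{R}$ tends to infinity).
   Context: Rectangles are (up to rotation) products of two bounded nonempty open intervals. For a bounded Lipschitz domain $\Omega \subset \mathbb{R}^2$ and $\beta \in \mathbb{R}$, the Robin eigenvalues $\lambda_1(\Omega;\beta) < \lambda_2(\Omega;\beta) \leq \dots$ are the eigenvalues, counted with multiplicity, of $-\Delta u = \lambda u$ in $\Omega$ with $\partial u/\partial \nu + \beta u = 0$ on $\partial \Omega$ ($\nu$ the outward unit normal). Equivalently $$\lambda_k(\Omega;\beta) = \min_{U_k} \max_{u \in U_k \setminus \{0\}} \frac{\int_\Omega |\nabla u|^2\,dx + \beta \int_{\partial\Omega} u^2\,dS}{\int_\Omega u^2\,dx},$$ where $U_k$ ranges over $k$-dimensional subspaces of $H^1(\Omega)$. The quantity $\lambda_2(\mathcal{R};\alpha/L)A$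 is invariant under rescaling of $\mathcal{R}$. Definition of $\alpha_\pm$. Consider the strictly increasing bijections $g_1(x)=x\tan x$, $g_1:(0,\pi/2)\to(0,\infty)$; $g_2(x)=-x\cot x$, $g_2:(0,\pi)\to(-1,\infty)$ (with $g_2(\pi/2)=0$); $h_1(x)=x\tanh x$, $h_1:(0,\infty)\to(0,\infty)$; $h_2(x)=x\coth x$, $h_2:(0,\infty)\to(1,\infty)$. Then $\alpha_+$ is the unique $\alpha>0$ satisfying $g_1^{-1}(\alpha/8)^2+g_2^{-1}(\alpha/8)^2=\alpha/4$, and $\alpha_-$ is the unique $\alpha<-8$ satisfying $h_1^{-1}(|\alpha|/8)^2+h_2^{-1}(|\alpha|/8)^2=|\alpha|/4$. *)

(* Defs.v *)
From HB Require Import structures.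
From mathcomp Require Import all_boot all_order all_algebra.
From mathcomp Require Import all_classical all_reals all_analysis.

Set Implicit Arguments.
Unset Strict Implicit.
Unset Printing Implicit Defensive.

Import Order.TTheory GRing.Theory Num.Theory.
Import numFieldNormedType.Exports.

Local Open Scope classical_set_scope.
Local Open Scope ring_scope.

Record rectangle (R : realType) := Rectangle {
  corner : R * R;
  angle : R;
  width : R;
  height : R;
  width_gt0 : 0 < width;
  height_gt0 : 0 < height }.

Section Rectangles.
Variables (R : realType) (Q : rectangle R).

(* The isometry of the plane that carries ]0, width[ x ]0, height[ onto the
   rectangle. *)
Definition frame (s t : R) : R * R :=
  ((corner Q).1 + s * cos (angle Q) - t * sin (angle Q),
   (corner Q).2 + s * sin (angle Q) + t * cos (angle Q)).

Definition domain : set (R * R) :=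
  [set frame st.1 st.2 | st in `]0, width Q[ `*` `]0, height Q[].

(* The side [(false, e)] is the image of ]0, width[ x {0} or of
   ]0, width[ x {height}, and the side [(true, e)] that of {0} x ]0, height[ or
   of {width} x ]0, height[; [side_param] is an arc length parametrization. *)
Definition side_length (i : bool * bool) : R :=
  if i.1 then height Q else width Q.

Definition side_param (i : bool * bool) (s : R) : R * R :=
  if i.1 then frame (if i.2 then width Q else 0) s
  else frame s (if i.2 then height Q else 0).

Definition area : R := width Q * height Q.
Definition perimeter : R := 2 * (width Q + height Q).
Definition aspect_ratio : R :=
  Num.max (width Q) (height Q) / Num.min (width Q) (height Q).
Definition is_square : Prop := width Q = height Q.

End Rectangles.

Section Sobolev.
Variable R : realType.
Implicit Types (Q : rectangle R) (u v w g t phi : R * R -> R).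

Local Notation leb := (@lebesgue_measure R).

Local Notation leb2 := (leb \x leb)%E.

Definition partial1 v (x : R * R) : R := 'D_((1, 0) : R * R) v x.
Definition partial2 v (x : R * R) : R := 'D_((0, 1) : R * R) v x.

Definition is_C1 v : Prop :=
  [/\ (forall x : R * R, differentiable v x),
      continuous (partial1 v) & continuous (partial2 v)].

Definition test_function Q phi : Prop :=
  is_C1 phi /\
  exists K : set (R * R),
    [/\ compact K, K `<=` domain Q & forall x, ~ K x -> phi x = 0].

Definition in_L2 Q u : Prop :=
  measurable_fun (domain Q) u /\
  leb2.-integrable (domain Q) (fun x => (u x ^+ 2)%:E).

Definition in_L2_boundary Q t : Prop :=
  forall i, measurable_fun `[0, side_length Q i] (t \o side_param Q i) /\
    leb.-integrable `[0, side_length Q i]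
      (fun s => (t (side_param Q i s) ^+ 2)%:E).

Definition boundary_integral Q t : R :=
  \sum_(i : bool * bool)
    \int[leb]_(s in `[0, side_length Q i]) t (side_param Q i s).

Definition L2_dist2 Q u v : \bar R :=
  (\int[leb2]_(x in domain Q) ((u x - v x) ^+ 2)%:E)%E.

Definition L2_boundary_dist2 Q t w : \bar R :=
  (\sum_(i : bool * bool) \int[leb]_(s in `[0%R, side_length Q i])
     ((t (side_param Q i s) - w (side_param Q i s)) ^+ 2)%:E)%E.

Definition weak_partial (partial : (R * R -> R) -> R * R -> R) Q u g : Prop :=
  forall phi, test_function Q phi ->
    \int[leb2]_(x in domain Q) (u x * partial phi x) =
    - \int[leb2]_(x in domain Q) (g x * phi x).

(* A function together with representatives of its weak gradient and of its
   boundary trace.  Only the values of [fct], [dx1], [dx2] on the rectangle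
   and those of [tr] on its boundary matter. *)
Record h1fun := H1fun {
  fct : R * R -> R;
  dx1 : R * R -> R;
  dx2 : R * R -> R;
  tr : R * R -> R }.

Implicit Type f : h1fun.

(* The trace operator is the continuous extension to H^1 of the restriction to
   the boundary of functions that are C^1 up to the boundary, which are dense
   in H^1 since a rectangle is a Lipschitz domain. *)
Definition is_trace Q f : Prop :=
  exists v : nat -> R * R -> R,
    [/\ (forall n, is_C1 (v n)),
        L2_dist2 Q (v n) (fct f) @[n --> \oo] --> 0%E,
        L2_dist2 Q (partial1 (v n)) (dx1 f) @[n --> \oo] --> 0%E,
        L2_dist2 Q (partial2 (v n)) (dx2 f) @[n --> \oo] --> 0%E &
        L2_boundary_dist2 Q (v n) (tr f) @[n --> \oo] --> 0%E].

(* By the trace theorem every u in H^1 is [fct f] for some [f] satisfying this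
   predicate, and [f] is unique up to almost everywhere equality. *)
Definition in_H1 Q f : Prop :=
  [/\ [/\ in_L2 Q (fct f), in_L2 Q (dx1 f) & in_L2 Q (dx2 f)],
      weak_partial partial1 Q (fct f) (dx1 f),
      weak_partial partial2 Q (fct f) (dx2 f),
      in_L2_boundary Q (tr f) & is_trace Q f].

Definition lincomb k (c : 'rV[R]_k) (b : 'I_k -> h1fun) : h1fun :=
  {| fct := fun x => \sum_i c 0 i * fct (b i) x;
     dx1 := fun x => \sum_i c 0 i * dx1 (b i) x;
     dx2 := fun x => \sum_i c 0 i * dx2 (b i) x;
     tr := fun x => \sum_i c 0 i * tr (b i) x |}.

(* [b] is a basis of a k-dimensional subspace of H^1, whose elements are taken
   modulo almost everywhere equality. *)
Definition H1_basis Q k (b : 'I_k -> h1fun) : Prop :=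
  (forall i, in_H1 Q (b i)) /\
  forall c : 'rV[R]_k,
    {ae leb2, forall x, domain Q x -> fct (lincomb c b) x = 0} -> c = 0.

Definition rayleigh Q (beta : R) f : R :=
  (\int[leb2]_(x in domain Q) (dx1 f x ^+ 2 + dx2 f x ^+ 2)
   + beta * boundary_integral Q (fun x => tr f x ^+ 2))
  / \int[leb2]_(x in domain Q) (fct f x ^+ 2).

Definition is_max (A : set R) (m : R) : Prop := A m /\ ubound A m.
Definition is_min (A : set R) (m : R) : Prop := A m /\ lbound A m.

Definition is_max_rayleigh Q beta k (b : 'I_k -> h1fun) (m : R) : Prop :=
  is_max [set rayleigh Q beta (lincomb c b) | c in [set c | c != 0]] m.

Definition is_robin_eigenvalue k Q beta (l : R) : Prop :=
  is_min [set m | exists b : 'I_k -> h1fun,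
                    H1_basis Q b /\ is_max_rayleigh Q beta b m] l.

(* The min-max value; the default value 0 is never used when 0 < k. *)
Definition robin_eigenvalue k Q beta : R :=
  xget 0 (is_robin_eigenvalue k Q beta).

End Sobolev.

Section Constants.
Variable R : realType.
Implicit Types x y a : R.

Definition cosh x : R := (expR x + expR (- x)) / 2.
Definition sinh x : R := (expR x - expR (- x)) / 2.

Definition g1 x : R := x * tan x.
Definition g2 x : R := - (x * (cos x / sin x)).
Definition h1 x : R := x * (sinh x / cosh x).
Definition h2 x : R := x * (cosh x / sinh x).

(* ['pinv_(fun=> 0) D f] is the inverse of [f] restricted to [D]. *)
Definition g1_inv := 'pinv_(fun=> 0) `]0, pi / 2[ g1.
Definition g2_inv := 'pinv_(fun=> 0) `]0, pi[ g2.
Definition h1_inv := 'pinv_(fun=> 0) `]0, +oo[ h1.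
Definition h2_inv := 'pinv_(fun=> 0) `]0, +oo[ h2.

Definition alpha_plus : R :=
  xget 0 [set a | 0 < a /\ g1_inv (a / 8) ^+ 2 + g2_inv (a / 8) ^+ 2 = a / 4].

Definition alpha_minus : R :=
  xget 0 [set a | a < -8 /\
                  h1_inv (`|a| / 8) ^+ 2 + h2_inv (`|a| / 8) ^+ 2 = `|a| / 4].

End Constants.

(* Main.v *)
Require Import Defs.
From mathcomp Require Import all_boot all_order all_algebra ring lra.
From mathcomp Require Import all_classical all_reals all_analysis.
Import Order.TTheory GRing.Theory Num.Theory.
Import numFieldNormedType.Exports.
Local Open Scope classical_set_scope.
Local Open Scope ring_scope.

(** The second eigenvalue of a rectangle comes from separation of variables.
    On an interval of half-length l the lowest two Robin eigenfunctions are the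
    first even and the first odd one about the midpoint; with b = beta l their
    eigenvalues are [mu_even b / l^2] and [mu_odd b / l^2], where [mu_even] and
    [mu_odd] are the squares of the inverses of g1 and g2, or minus the squares
    of the inverses of h1 and h2.  The second eigenvalue of the rectangle is
    the smaller of the two sums of an odd level of one side and the even level
    of the other ([robin_eigenvalue2]).

    The upper bound in the min-max formula is attained by product functions
    ([second_level_attained]).  For the lower bound, a two-dimensional space
    contains a nonzero function that is orthogonal to the first eigenfunction,
    and on such functions the quadratic form dominates the second level. By the
    definition of the trace it is enough to know this for C1 functions, in the
    quantitative form [C1_gap], which survives H1 limits ([H1_gap]). That form
    tensorizes a gap inequality on an interval ([interval_gap]): if P and Q are
    the projections onto the ground states of the two sides, the gap d enters
    through d (1 - P) + d (1 - Q), which is at least d (1 - PQ) because (1 -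
    P)(1 - Q) >= 0 ([bessel_product]). The interval inequality follows from
    Picone's identity on the two halves of the interval, applied after
    subtraction of the multiple of the ground state that makes the function
    vanish at the midpoint ([picone], [midpoint_zero_inequality]). Rotated
    rectangles are reduced to boxes by the invariance of the Lebesgue measure
    under rotations, which are products of shears ([preserving_rotation]).

    It remains to maximize over the shape.  With c = alpha / 4 and p the share
    of the width in the half-perimeter, the scaled eigenvalue is
    4 min (G p, G (1 - p)) where G p = [long_level c p].  For c = 0 this is
    mu_odd 0 p / (1 - p), which increases with p; for other c,
      G p - c = c^2 p (1 - p) (K1 (c p) + K2 (c (1 - p)))
    for K1 b = (mu_even b - b) / b^2 and K2 b = (mu_odd b - b) / b^2
    ([long_level_subE]).  For p < 1/2 the sum of K1 and K2 is either negative
    or smaller than at p = 1/2 ([curv_sum_lt]).  Hence G p is smaller than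
    G (1/2) when G (1/2) >= c, so that the square wins, and smaller than c
    when G (1/2) < c.  Finally G (1/2) - c is [excess (alpha / 8)], a concave
    function of alpha that is positive at 0 and vanishes exactly at the two
    critical values of alpha ([alpha_rangeP]).  The proof of [curv_sum_lt]
    uses the concavity of [mu_odd] (again by Picone, with eigenfunctions as
    test functions), the monotonicity of K1 on the positive axis, which is
    Wilker's inequality, and a Lipschitz bound for K1 on the negative axis. *)

(** * Differentiation of real functions *)

Section Calculus.
Context {R : realType}.
Implicit Types (f g : R -> R) (x : R).

Lemma is_derive_ext {x f g a b} : f =1 g -> a = b -> is_derive x 1 f a ->
  is_derive x 1 g b.
Proof. by move=> /funext -> ->. Qed.

Lemma is_derive_add {x f g a b} : is_derive x 1 f a -> is_derive x 1 g b ->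
  is_derive x 1 (fun y => f y + g y) (a + b).
Proof. by move=> df dg; apply: (is_deriveD df dg). Qed.

Lemma is_derive_const (c x : R) : is_derive x 1 (fun _ : R => c) 0.
Proof. exact: is_derive_cst. Qed.

Lemma is_derive_opp {x f a} : is_derive x 1 f a ->
  is_derive x 1 (fun y => - f y) (- a).
Proof. by move=> df; apply: (is_deriveN df). Qed.

Lemma is_derive_sub {x f g a b} : is_derive x 1 f a -> is_derive x 1 g b ->
  is_derive x 1 (fun y => f y - g y) (a - b).
Proof. by move=> df dg; apply: (is_deriveB df dg). Qed.

Lemma is_derive_mul {x f g a b} : is_derive x 1 f a -> is_derive x 1 g b ->
  is_derive x 1 (fun y => f y * g y) (a * g x + f x * b).
Proof.
move=> df dg; have := is_deriveM df dg.
by rewrite /GRing.scale /= addrC (mulrC _ a).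
Qed.

Lemma is_derive_scale {x} c {f a} : is_derive x 1 f a ->
  is_derive x 1 (fun y => c * f y) (c * a).
Proof. by move=> df; apply: (is_deriveZ c df). Qed.

Lemma is_derive_sqr {x f a} : is_derive x 1 f a ->
  is_derive x 1 (fun y => f y ^+ 2) (2 * f x * a).
Proof.
move=> df; apply: is_derive_ext (is_derive_mul df df) => [y|].
  by rewrite expr2.
ring.
Qed.

Lemma is_derive_inv {x f a} : f x != 0 -> is_derive x 1 f a ->
  is_derive x 1 (fun y => (f y)^-1) (- a / f x ^+ 2).
Proof.
move=> fx0 df; apply: is_derive_ext (is_deriveV fx0 df) => //.
by rewrite /GRing.scale /= mulNr mulrC mulNr.
Qed.

Lemma is_derive_affine {x f} c d {a} : is_derive (c * x + d) 1 f a ->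
  is_derive x 1 (fun y => f (c * y + d)) (c * a).
Proof.
move=> df.
have dg : is_derive x 1 (fun y : R => c * y + d) c.
  apply: is_derive_ext (is_derive_add
    (is_derive_scale c (is_derive_id x 1)) (is_derive_cst d x 1)) => //.
  by rewrite mulr1 addr0.
by rewrite mulrC; exact: (@is_derive1_comp _ f (fun y => c * y + d) x a c df
    dg).
Qed.

Lemma is_derive_continuous {x f a} : is_derive x 1 f a -> {for x, continuous f}.
Proof. by case=> df _; apply/differentiable_continuous/derivable1_diffP. Qed.

Lemma derive_everywhere_continuous {f} {f' : R -> R} :
  (forall x, is_derive x 1 f (f' x)) -> continuous f.
Proof. by move=> df x; exact: is_derive_continuous (df x). Qed.

Lemma nondecreasing_from_derive (f f' : R -> R) a b : a <= b ->
  {within `[a, b], continuous f} ->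
  (forall x, a < x < b -> is_derive x 1 f (f' x) /\ 0 <= f' x) -> f a <= f b.
Proof.
rewrite le_eqVlt => /predU1P[->//|ab] cf df.
have [c] := @MVT _ f f' a b ab (fun x xab => proj1 (df x xab)) cf.
rewrite in_itv /= => cab h.
rewrite -subr_ge0 h mulr_ge0 ?subr_ge0 ?(ltW ab)//.
by have [] := df c cab.
Qed.

Lemma increasing_from_derive (f f' : R -> R) a b : a < b ->
  {within `[a, b], continuous f} ->
  (forall x, a < x < b -> is_derive x 1 f (f' x) /\ 0 < f' x) -> f a < f b.
Proof.
move=> ab cf df.
have [c] := @MVT _ f f' a b ab (fun x xab => proj1 (df x xab)) cf.
rewrite in_itv /= => cab h.
rewrite -subr_gt0 h mulr_gt0 ?subr_gt0//.
by have [] := df c cab.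
Qed.

Lemma increasing_from_derive_cont (f f' : R -> R) a b : a < b ->
  (forall x, is_derive x 1 f (f' x)) ->
  (forall x, a < x < b -> 0 < f' x) -> f a < f b.
Proof.
move=> ab df f'0; apply: (increasing_from_derive f f' _ _ ab).
  apply/continuous_subspaceT => x; exact: is_derive_continuous (df x).
by move=> x xab; split => //; exact: f'0.
Qed.

Lemma nondecreasing_from_derive_cont (f f' : R -> R) a b : a <= b ->
  (forall x, is_derive x 1 f (f' x)) ->
  (forall x, a < x < b -> 0 <= f' x) -> f a <= f b.
Proof.
move=> ab df f'0; apply: (nondecreasing_from_derive f f' _ _ ab).
  apply/continuous_subspaceT => x; exact: is_derive_continuous (df x).
by move=> x xab; split => //; exact: f'0.
Qed.

Lemma derive_within_continuous {f} {f' : R -> R} {a b} :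
  (forall x, a <= x <= b -> is_derive x 1 f (f' x)) ->
      {within `[a, b], continuous f}.
Proof.
move=> df; apply: continuous_in_subspaceT => x; rewrite inE /= in_itv /= => xab.
exact: is_derive_continuous (df x xab).
Qed.

Lemma nondecreasing_from_derive_on {f f' : R -> R} {a b} : a <= b ->
  (forall x, a <= x <= b -> is_derive x 1 f (f' x)) ->
  (forall x, a < x < b -> 0 <= f' x) -> f a <= f b.
Proof.
move=> ab df f'0; apply: (nondecreasing_from_derive f f' _ _ ab).
  exact: derive_within_continuous df.
move=> x /[dup] /f'0 ? /andP[ax xb]; split => //.
by apply: df; rewrite !ltW.
Qed.

Lemma increasing_from_derive_on {f f' : R -> R} {a b} : a < b ->
  (forall x, a <= x <= b -> is_derive x 1 f (f' x)) ->
  (forall x, a < x < b -> 0 < f' x) -> f a < f b.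
Proof.
move=> ab df f'0; apply: (increasing_from_derive f f' _ _ ab).
  exact: derive_within_continuous df.
move=> x /[dup] /f'0 ? /andP[ax xb]; split => //.
by apply: df; rewrite !ltW.
Qed.

Lemma IVT_derive (f f' : R -> R) a b : a < b ->
    (forall x, is_derive x 1 f (f' x)) ->
  f a < 0 -> 0 < f b -> exists x, a < x < b /\ f x = 0.
Proof.
move=> ab df fa fb.
have [||c] := @IVT _ f a b 0 (ltW ab).
- by apply/continuous_subspaceT => x; exact: is_derive_continuous (df x).
- by rewrite ge_min le_max (ltW fa) (ltW fb) orbT.
rewrite in_itv /= => /andP[ac cb] fc; exists c; split => //.
rewrite !lt_neqAle ac cb !andbT; apply/andP; split; apply/eqP => h.
  by move: fa; rewrite h fc ltxx.
by move: fb; rewrite -h fc ltxx.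
Qed.

(** * Hyperbolic functions *)

Lemma is_derive_cosh x : is_derive x 1 (@cosh R) (sinh x).
Proof.
have dN : is_derive x 1 (fun y => expR (- y)) (- expR (- x)).
  apply: is_derive_ext (is_derive_affine (-1) 0 (is_derive_expR _)) => [y|].
    by rewrite addr0 mulN1r.
  by rewrite addr0 !mulN1r.
apply: is_derive_ext (is_derive_scale 2^-1
  (is_derive_add (is_derive_expR x) dN)) => [y|].
  by rewrite /cosh mulrC.
by rewrite /sinh mulrC.
Qed.

Lemma is_derive_sinh x : is_derive x 1 (@sinh R) (cosh x).
Proof.
have dN : is_derive x 1 (fun y => expR (- y)) (- expR (- x)).
  apply: is_derive_ext (is_derive_affine (-1) 0 (is_derive_expR _)) => [y|].
    by rewrite addr0 mulN1r.
  by rewrite addr0 !mulN1r.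
apply: is_derive_ext (is_derive_scale 2^-1
  (is_derive_sub (is_derive_expR x) dN)) => [y|].
  by rewrite /sinh mulrC.
by rewrite /cosh opprK mulrC.
Qed.

Lemma cosh_gt0 x : 0 < cosh x.
Proof. by rewrite /cosh divr_gt0// addr_gt0// expR_gt0. Qed.

Lemma cosh0 : cosh 0 = 1 :> R.
Proof. by rewrite /cosh oppr0 expR0; field. Qed.

Lemma sinh0 : sinh 0 = 0 :> R.
Proof. by rewrite /sinh oppr0 expR0 subrr mul0r. Qed.

Lemma coshN x : cosh (- x) = cosh x.
Proof. by rewrite /cosh opprK addrC. Qed.

Lemma sinhN x : sinh (- x) = - sinh x.
Proof. by rewrite /sinh opprK -mulNr opprB. Qed.

Lemma cosh2_sinh2 x : cosh x ^+ 2 - sinh x ^+ 2 = 1.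
Proof.
have h : expR x * expR (- x) = 1 by rewrite expRN mulfV// gt_eqF// expR_gt0.
by rewrite -[RHS]h /cosh /sinh; field.
Qed.

Lemma sinh_lt_cosh x : sinh x < cosh x.
Proof.
rewrite /cosh /sinh ltr_pM2r ?invr_gt0// -subr_gt0 opprB addrA addrAC.
by have := expR_gt0 (- x); lra.
Qed.

Lemma sinh_gt0 x : 0 < x -> 0 < sinh x.
Proof.
move=> x0; rewrite -sinh0.
apply: (increasing_from_derive_cont _ _ _ _ x0 is_derive_sinh) => y _.
exact: cosh_gt0.
Qed.

Lemma cosh_ge1 x : 1 <= cosh x.
Proof.
have := cosh2_sinh2 x; have := cosh_gt0 x; have := sqr_ge0 (sinh x) => h1 h2 h3.
nra.
Qed.

Lemma sinh_ge x : 0 <= x -> x <= sinh x.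
Proof.
move=> x0.
have := nondecreasing_from_derive_cont (fun y => sinh y - y)
    (fun y => cosh y - 1) 0 x x0.
rewrite sinh0 subr0 subr_ge0; apply => [y|y _].
  exact: is_derive_sub (is_derive_sinh y) (is_derive_id y 1).
by rewrite subr_ge0 cosh_ge1.
Qed.

Lemma sinh_cosh_gt x : 0 < x -> x < sinh x * cosh x.
Proof.
move=> x0.
have := increasing_from_derive_cont (fun y => sinh y * cosh y - y)
  (fun y => cosh y * cosh y + sinh y * sinh y - 1) 0 x x0.
rewrite sinh0 mul0r subr0 subr_gt0; apply => [y|y /andP[y0 _]].
  exact: is_derive_sub (is_derive_mul (is_derive_sinh y) (is_derive_cosh y))
    (is_derive_id y 1).
have := sinh_gt0 _ y0; have := cosh2_sinh2 y; nra.
Qed.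

End Calculus.

(** * The one-dimensional Robin problem on [-1, 1] *)

Section Modes.
Context {R : realType}.
Implicit Types (b x y : R) (f g : R -> R).

Lemma pinv_spec (f : R -> R) (D : set R) y : (f @` D) y ->
  D ('pinv_(fun=> 0) D f y) /\ f ('pinv_(fun=> 0) D f y) = y.
Proof.
move=> fDy; split; last by rewrite pinvK// inE.
have h : set_surj D (f @` D) f by move=> z.
by apply: (surjpinv_image_sub h); exists y.
Qed.

Lemma sin_lt x : 0 < x -> sin x < x.
Proof.
move=> x0; have h (z : R) : 0 < z -> z < pi -> sin z < z.
  move=> z0 zpi.
  have := increasing_from_derive_cont _ _ _ _ z0
    (fun y => is_derive_sub (is_derive_id y 1) (is_derive_sin y)).
  rewrite sin0 subr0 subr_gt0; apply => y /andP[y0 y1].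
  rewrite subr_gt0 lt_neqAle cos_le1 andbT; apply/eqP => c1.
  have : sin y ^+ 2 = 0 by rewrite sin2cos2 c1 expr1n subrr.
  move/eqP; rewrite sqrf_eq0 => /eqP s0.
  by have := sin_gt0_pi (ltac:(rewrite y0/=; exact: lt_trans y1 zpi) :
      0 < y < pi); rewrite s0 ltxx.
have [xpi|pix] := ltP x pi; first exact: h.
have := nondecreasing_from_derive_cont _ _ _ _ pix
    (fun y => is_derive_sub (is_derive_id y 1) (is_derive_sin y)).
rewrite sinpi subr0 => hh; rewrite -subr_gt0; apply: lt_le_trans (pi_gt0 R) _;
    apply: hh => y _.
by rewrite subr_ge0 cos_le1.
Qed.

(** The inequality cos x >= 1 - x^2/2 puts the first zero of the cosine beyond
    7/5, which is enough for [curv_sum_lt]. *)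
Lemma pi_gt : 14 / 5 < pi :> R.
Proof.
rewrite ltNge; apply/negP => pile; have p0 := pi_gt0 R.
have pi2 : 0 < pi / 2 :> R by rewrite divr_gt0.
have := nondecreasing_from_derive_cont _ _ _ _ (ltW pi2)
  (fun y => is_derive_sub (is_derive_cos y) (is_derive_sub (is_derive_const 1 y)
    (is_derive_scale 2^-1 (is_derive_sqr (is_derive_id y 1))))).
rewrite /= cos0 cos_pihalf => h.
have : 1 - (1 - 2^-1 * 0 ^+ 2) <= 0 - (1 - 2^-1 * (pi / 2) ^+ 2) :> R.
  by apply: h => y /andP[y0 _]; have := sin_lt _ y0; lra.
nra.
Qed.

Lemma g1_inv_spec b : 0 < b ->
  0 < g1_inv b < pi / 2 /\ g1_inv b * sin (g1_inv b) = b * cos (g1_inv b).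
Proof.
move=> b0; have pi2 : 0 < pi / 2 :> R by rewrite divr_gt0 ?pi_gt0.
have [x [x0 fx]] := IVT_derive (fun x => x * sin x - b * cos x) _ 0 (pi / 2) pi2
  (fun x => is_derive_sub (is_derive_mul (is_derive_id x 1) (is_derive_sin x))
     (is_derive_scale b (is_derive_cos x)))
  ltac:(rewrite /= cos0 mul0r mulr1 sub0r oppr_lt0; exact: b0)
  ltac:(rewrite /= cos_pihalf sin_pihalf mulr0 mulr1 subr0; exact: pi2).
have cx y : 0 < y < pi / 2 -> 0 < cos y.
  by move=> /andP[y0 y1]; apply: cos_gt0_pihalf; rewrite y1 andbT; apply:
      lt_trans y0; rewrite oppr_lt0.
have [] := pinv_spec (@g1 R) `]0, pi / 2[ b.
  exists x; first by rewrite /= in_itv.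
  rewrite /g1 /tan mulrA; apply: (canLR (mulfK _));
      first by rewrite gt_eqF// cx.
  lra.
rewrite -/(g1_inv b); move: (g1_inv b) => t /=; rewrite in_itv /= => h gb;
    split => //; rewrite -[in RHS]gb /g1 /tan.
by rewrite -mulrA divfK// gt_eqF// cx.
Qed.

Lemma g2_inv_spec b : - 1 < b ->
  0 < g2_inv b < pi /\ - (g2_inv b * cos (g2_inv b)) = b * sin (g2_inv b).
Proof.
move=> b1; have [x [xpi fx]] : exists x,
    0 < x < pi /\ x * cos x + b * sin x = 0.
  have [b0|b0|->] := ltgtP b 0; last first.
  - by exists (pi / 2); rewrite cos_pihalf mul0r mulr0 addr0; split => //;
      have := pi_gt0 R; lra.
  - have [||x [xp fx]] := IVT_derive (fun x => - (x * cos x + b * sin x)) _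
      (pi / 2) pi ltac:(have := pi_gt0 R; lra)
      (fun x => is_derive_opp (is_derive_add
          (is_derive_mul (is_derive_id x 1) (is_derive_cos x))
        (is_derive_scale b (is_derive_sin x)))).
    + by rewrite cos_pihalf sin_pihalf mulr0 mulr1 add0r oppr_lt0.
    + by rewrite cospi sinpi mulr0 addr0 mulrN1 opprK pi_gt0.
    by exists x; split; [have := pi_gt0 R; lra|lra].
  (* At acos (- b) the function equals - b (x - sin x). *)
  - have h1 : -1 <= - b <= 1 by lra.
    have a0 : 0 < acos (- b) by apply: acos_gt0; lra.
    have api : acos (- b) < pi by apply: acos_ltpi; lra.
    have [||x [xp fx]] := IVT_derive (fun x => - (x * cos x + b * sin x)) _
        (acos (- b)) pi api
      (fun x => is_derive_opp (is_derive_add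
          (is_derive_mul (is_derive_id x 1) (is_derive_cos x))
        (is_derive_scale b (is_derive_sin x)))).
    + rewrite acosK//; have := sin_lt _ a0.
      nra.
    + by rewrite cospi sinpi mulr0 addr0 mulrN1 opprK pi_gt0.
    by exists x; split; [lra|lra].
have [] := pinv_spec (@g2 R) `]0, pi[ b.
  exists x; first by rewrite /= in_itv.
  rewrite /g2 mulrA -mulNr; apply: (canLR (mulfK _));
      first by rewrite gt_eqF// sin_gt0_pi.
  lra.
rewrite -/(g2_inv b); move: (g2_inv b) => t /=; rewrite in_itv /= => h gb;
    split => //; rewrite -[in RHS]gb /g2.
by rewrite mulNr -mulrA divfK// gt_eqF// sin_gt0_pi.
Qed.

Lemma h1_inv_spec b : 0 < b ->
  0 < h1_inv b /\ h1_inv b * sinh (h1_inv b) = b * cosh (h1_inv b).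
Proof.
move=> b0.
have [||x [xp fx]] := IVT_derive (fun x => x * sinh x - b * cosh x) _ 0 (b + 1)
    ltac:(lra)
  (fun x => is_derive_sub (is_derive_mul (is_derive_id x 1) (is_derive_sinh x))
     (is_derive_scale b (is_derive_cosh x))).
- by rewrite cosh0 mul0r mulr1 sub0r oppr_lt0.
(* At b + 1 the sign is that of exp (2 (b + 1)) - (2 b + 1). *)
- have : 1 + (b + 1) <= expR (b + 1) by exact: expR_ge1Dx.
  have : expR (b + 1) * expR (- (b + 1)) = 1 by rewrite expRN mulfV// gt_eqF//
      expR_gt0.
  have := expR_gt0 (b + 1); have := expR_gt0 (- (b + 1)).
  rewrite /sinh /cosh; set E' := expR _; set E := expR _ => E'0 E0 EE h.
  have : 0 < E - (2 * b + 1) * E'; last by lra.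
  rewrite -(pmulr_rgt0 _ E0); have -> :
      E * (E - (2 * b + 1) * E') = E ^+ 2 - (2 * b + 1) * (E * E') by ring.
  rewrite EE; nra.
have [] := pinv_spec (@h1 R) `]0, +oo[ b.
  exists x; first by rewrite /= in_itv /= andbT; case/andP: xp.
  rewrite /h1 mulrA; apply: (canLR (mulfK _));
      first by rewrite gt_eqF// cosh_gt0.
  lra.
rewrite -/(h1_inv b); move: (h1_inv b) => t /=; rewrite in_itv /= andbT => h gb;
    split => //; rewrite -[in RHS]gb /h1.
by rewrite -mulrA divfK// gt_eqF// cosh_gt0.
Qed.

Lemma h2_inv_spec b : 1 < b ->
  0 < h2_inv b /\ h2_inv b * cosh (h2_inv b) = b * sinh (h2_inv b).
Proof.
move=> b1; have b0 : 0 < b by lra.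
(* The zero lies between ln b, where cosh (ln b) < b, and b. *)
have lnb : 0 < ln b by rewrite ln_gt0.
have lnb' : ln b < b.
  by have := @ln_sublinear R b b0.
have [||x [xp fx]] := IVT_derive (fun x => x * cosh x - b * sinh x) _ (ln b) b
    lnb'
  (fun x => is_derive_sub (is_derive_mul (is_derive_id x 1) (is_derive_cosh x))
     (is_derive_scale b (is_derive_sinh x))).
- have s := sinh_ge _ (ltW lnb).
  have c : cosh (ln b) < b.
    have : b^-1 < 1 by rewrite invf_lt1.
    rewrite /cosh expRN lnK ?posrE//; lra.
  nra.
- rewrite -mulrBr mulr_gt0// subr_gt0; exact: sinh_lt_cosh.
have xs : 0 < x by lra.
have [] := pinv_spec (@h2 R) `]0, +oo[ b.
  exists x; first by rewrite /= in_itv /= andbT.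
  rewrite /h2 mulrA; apply: (canLR (mulfK _));
      first by rewrite gt_eqF// sinh_gt0.
  lra.
rewrite -/(h2_inv b); move: (h2_inv b) => t /=; rewrite in_itv /= andbT => h gb;
    split => //; rewrite -[in RHS]gb /h2.
by rewrite -mulrA divfK// gt_eqF// sinh_gt0.
Qed.

End Modes.

Section Modes.
Context {R : realType}.
Implicit Types (b m x y : R) (f w : R -> R).

(** The lowest eigenvalue m of - f'' = m f on [-1, 1] with the Robin condition
    f'(1) = - b f(1) among even functions f; [mu_odd] is its analogue for odd
    functions. *)
Definition mu_even b : R :=
  if 0 < b then g1_inv b ^+ 2 else if b < 0 then - h1_inv (- b) ^+ 2 else 0.

Definition mu_odd b : R :=
  if -1 < b then g2_inv b ^+ 2 else if b < -1 then - h2_inv (- b) ^+ 2 else 0.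

Lemma mu_even_pos b : 0 < b -> exists x,
  [/\ 0 < x < pi / 2, x * sin x = b * cos x & mu_even b = x ^+ 2].
Proof.
move=> b0; have [h e] := g1_inv_spec b b0.
by exists (g1_inv b); split => //; rewrite /mu_even b0.
Qed.

Lemma mu_even_neg b : b < 0 -> exists x,
  [/\ 0 < x, x * sinh x = - b * cosh x & mu_even b = - x ^+ 2].
Proof.
move=> b0; have [|h e] := h1_inv_spec (- b); first by rewrite oppr_gt0.
by exists (h1_inv (- b)); split => //; rewrite /mu_even b0 ltNge (ltW b0).
Qed.

Lemma mu_even0 : mu_even 0 = 0.
Proof. by rewrite /mu_even ltxx. Qed.

Lemma mu_odd_gtN1 b : -1 < b -> exists x,
  [/\ 0 < x < pi, - (x * cos x) = b * sin x & mu_odd b = x ^+ 2].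
Proof.
move=> b0; have [h e] := g2_inv_spec b b0.
by exists (g2_inv b); split => //; rewrite /mu_odd b0.
Qed.

Lemma mu_odd_ltN1 b : b < -1 -> exists x,
  [/\ 0 < x, x * cosh x = - b * sinh x & mu_odd b = - x ^+ 2].
Proof.
move=> b0; have [|h e] := h2_inv_spec (- b); first by lra.
by exists (h2_inv (- b)); split => //; rewrite /mu_odd b0 ltNge (ltW b0).
Qed.

Lemma mu_oddN1 : mu_odd (-1) = 0.
Proof. by rewrite /mu_odd ltxx. Qed.

(** Parity makes the boundary condition at 1 imply the one at -1, so that only
    the former is recorded. *)
Record mode m b f f' : Prop := Mode {
  mode_derive : forall x, is_derive x 1 f (f' x);
  mode_ode : forall x, is_derive x 1 f' (- m * f x);
  mode_robin : f' 1 = - b * f 1 }.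

Lemma is_derive_dilate {f} k {x a} : is_derive (k * x) 1 f a ->
  is_derive x 1 (fun y => f (k * y)) (k * a).
Proof.
move=> df; have h : is_derive (k * x + 0) 1 f a by rewrite addr0.
by apply: is_derive_ext (is_derive_affine k 0 h) => // y; rewrite addr0.
Qed.

Lemma even_mode b : exists f f', [/\ mode (mu_even b) b f f', f' 0 = 0,
  (forall x, f (- x) = f x), (forall x, f' (- x) = - f' x) &
  forall x, 0 <= x <= 1 -> 0 < f x].
Proof.
have [b0|b0|->] := ltgtP b 0.
- have [k [k0 kb ->]] := mu_even_neg b b0.
  exists (fun x => cosh (k * x)), (fun x => k * sinh (k * x)); split.
  + split => [x|x|].
    * exact: is_derive_dilate (is_derive_cosh _).
    * apply: is_derive_ext (is_derive_scale k
        (is_derive_dilate k (is_derive_sinh (k * x)))) => //; ring.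
    * by rewrite mulr1.
  + by rewrite mulr0 sinh0 mulr0.
  + by move=> x; rewrite mulrN coshN.
  + by move=> x; rewrite mulrN sinhN mulrN.
  + by move=> x _; exact: cosh_gt0.
- have [k [/andP[k0 kpi] kb ->]] := mu_even_pos b b0.
  exists (fun x => cos (k * x)), (fun x => - (k * sin (k * x))); split.
  + split => [x|x|].
    * apply: is_derive_ext (is_derive_dilate k (is_derive_cos (k * x))) => //;
        ring.
    * apply: is_derive_ext (is_derive_opp
        (is_derive_scale k (is_derive_dilate k (is_derive_sin (k * x))))) => //;
        ring.
    * by rewrite mulr1 kb mulNr.
  + by rewrite mulr0 sin0 mulr0 oppr0.
  + by move=> x; rewrite mulrN cosN.
  + by move=> x; rewrite mulrN sinN mulrN.
  + move=> x /andP[x0 x1]; apply: cos_gt0_pihalf; have := pi_gt0 R; nra.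
- exists (fun=> 1), (fun=> 0); split => //.
  + split => [x|x|]; [exact: is_derive_const| |by rewrite oppr0 mul0r].
    by rewrite mu_even0 oppr0 mul0r; exact: is_derive_const.
  + by move=> x; rewrite oppr0.
Qed.

Lemma odd_mode b : exists f f', [/\ mode (mu_odd b) b f f', f 0 = 0 /\ 0 < f' 0,
  (forall x, f (- x) = - f x), (forall x, f' (- x) = f' x) &
  forall x, 0 < x <= 1 -> 0 < f x].
Proof.
have [b0|b0|->] := ltgtP b (-1).
- have [k [k0 kb ->]] := mu_odd_ltN1 b b0.
  exists (fun x => sinh (k * x)), (fun x => k * cosh (k * x)); split.
  + split => [x|x|].
    * exact: is_derive_dilate (is_derive_sinh _).
    * apply: is_derive_ext (is_derive_scale k
        (is_derive_dilate k (is_derive_cosh (k * x)))) => //; ring.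
    * by rewrite mulr1.
  + by rewrite mulr0 sinh0 cosh0 mulr1.
  + by move=> x; rewrite mulrN sinhN.
  + by move=> x; rewrite mulrN coshN.
  + by move=> x /andP[x0 _]; apply: sinh_gt0; rewrite mulr_gt0.
- have [k [/andP[k0 kpi] kb ->]] := mu_odd_gtN1 b b0.
  exists (fun x => sin (k * x)), (fun x => k * cos (k * x)); split.
  + split => [x|x|].
    * exact: is_derive_dilate (is_derive_sin (k * x)).
    * apply: is_derive_ext (is_derive_scale k
        (is_derive_dilate k (is_derive_cos (k * x)))) => //; ring.
    * by rewrite mulr1 mulNr -kb opprK.
  + by rewrite mulr0 sin0 cos0 mulr1.
  + by move=> x; rewrite mulrN sinN.
  + by move=> x; rewrite mulrN cosN.
  + move=> x /andP[x0 x1]; apply: sin_gt0_pi; nra.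
- exists (fun x => x), (fun=> 1); split => //.
  + split => [x|x|]; [exact: is_derive_id| |by rewrite mulr1 opprK].
    by rewrite mu_oddN1 oppr0 mul0r; exact: is_derive_const.
  + by move=> x /andP[].
Qed.

(** Since f and w both vanish at 0, the function is f' w (w / x) / (f / x) for
    nonzero x; the last two factors converge and w tends to 0. *)
Lemma continuous_at0_ratio (f f' w w' : R -> R) :
  (forall x, is_derive x 1 f (f' x)) -> {for 0, continuous f'} ->
  (forall x, is_derive x 1 w (w' x)) ->
  f 0 = 0 -> f' 0 != 0 -> w 0 = 0 ->
  {for 0, continuous (fun x => f' x * w x ^+ 2 / f x)}.
Proof.
move=> df cf' dw f0 f'0 w0.
have quot (g g' : R -> R) : (forall x, is_derive x 1 g (g' x)) -> g 0 = 0 ->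
    (h^-1 * g h) @[h --> (0:R)^'] --> g' 0.
  move=> dg g0; have [h dE] := dg 0.
  have : (h^-1 *: (g (h *: 1 + 0) - g 0)) @[h --> (0:R)^'] -->
      'D_1 g 0 by exact: h.
  rewrite dE; apply: cvg_trans; apply: near_eq_cvg; near=> t.
  by rewrite g0 subr0 /GRing.scale /= mulr1 addr0.
apply/continuous_withinNx.
rewrite w0 expr0n /= mulr0 mul0r.
have dfw : (f' x * w x * (x^-1 * w x) / (x^-1 * f x)) @[x --> (0:R)^'] -->
    f' 0 * w 0 * w' 0 / f' 0.
  apply: cvgM; last by apply: cvgV => //; exact: quot.
  apply: cvgM; last exact: quot.
  apply: cvgM; first exact: cvg_within_filter cf'.
  apply: cvg_within_filter; exact: is_derive_continuous (dw 0).
rewrite w0 mulr0 !mul0r in dfw.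
apply: cvg_trans dfw; apply: near_eq_cvg; near=> t.
have t0 : t != 0 by near: t; exact: nbhs_dnbhs_neq.
have [->|ft0] := eqVneq (f t) 0; first by rewrite mulr0 invr0 !mulr0.
by field; rewrite t0 ft0.
Unshelve. all: by end_near. Qed.

End Modes.

(** * Picone's inequality and integrals over intervals *)

Section Picone.
Context {R : realType}.
Implicit Types (b m x y l : R) (f w g : R -> R).

(** The function F = (f' / f) w^2 satisfies
    w'^2 - m w^2 - F' = (w' - (f' / f) w)^2 >= 0, and F vanishes at 0: either
    f' does, or w vanishes to first order there like f. *)
Lemma picone l m f f' w w' (I : R -> R) : 0 < l ->
  (forall x, is_derive x 1 f (f' x)) ->
  (forall x, is_derive x 1 f' (- m * f x)) ->
  (forall x, is_derive x 1 w (w' x)) ->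
  (forall x, 0 < x <= l -> 0 < f x) ->
  f' 0 = 0 /\ 0 < f 0 \/ [/\ f 0 = 0, 0 < f' 0 & w 0 = 0] ->
  (forall x, 0 <= x <= l -> is_derive x 1 I (w' x ^+ 2 - m * w x ^+ 2)) ->
  f' l / f l * w l ^+ 2 <= I l - I 0.
Proof.
move=> l0 df df' dw fgt0 bc dI.
pose F x := f' x * w x ^+ 2 / f x.
pose F' x := (- m * f x * w x ^+ 2 + f' x * (2 * w x * w' x)) * (f x)^-1
  + f' x * w x ^+ 2 * (- f' x / f x ^+ 2).
have dF x : f x != 0 -> is_derive x 1 F (F' x).
  move=> fx; exact: is_derive_mul (is_derive_mul (df' x) (is_derive_sqr (dw x)))
      (is_derive_inv fx (df x)).
have F0 : F 0 = 0.
  by rewrite /F; case: bc => [[-> _]|[-> _ ->]];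
      rewrite ?expr0n/= ?mulr0 ?mul0r.
have cF x : 0 <= x <= l -> {for x, continuous F}.
  rewrite le_eqVlt andb_orl => /orP[/andP[/eqP<- _]|xl]; last first.
    by apply: is_derive_continuous (dF x _); rewrite gt_eqF// fgt0.
  case: bc => [[_ f0]|[f0 f'0 w0]].
    by apply: is_derive_continuous (dF 0 _); rewrite gt_eqF.
  apply: (continuous_at0_ratio f f' w w') => //; last by rewrite gt_eqF.
  exact: is_derive_continuous (df' 0).
suff : I 0 - F 0 <= I l - F l by rewrite F0 /F; lra.
apply: (nondecreasing_from_derive (fun x => I x - F x)
  (fun x => w' x ^+ 2 - m * w x ^+ 2 - F' x)) => [|x|x /andP[x0 xl]];
      first exact: ltW.
  apply: (continuous_in_subspaceT (f := fun x => I x - F x)) => z;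
      rewrite inE /= in_itv /= => zl.
  by apply: continuousB; [exact: is_derive_continuous (dI z zl)|exact: cF].
have fx : f x != 0 by rewrite gt_eqF// fgt0// x0 ltW.
split; first by apply: is_derive_sub; [apply: dI; rewrite !ltW|exact: dF].
have -> : w' x ^+ 2 - m * w x ^+ 2 - F' x = (w' x - f' x * w x / f x) ^+ 2.
  by rewrite /F'; field.
exact: sqr_ge0.
Qed.

Local Notation leb := (@lebesgue_measure R).

Lemma continuous_integrable_itv {g} a b : continuous g ->
    leb.-integrable `[a, b] (EFin \o g).
Proof.
move=> cg; apply: continuous_compact_integrable; first exact: segment_compact.
exact: continuous_subspaceT.
Qed.

Lemma primitive g lo hi : continuous g ->
  exists G, forall x, lo < x < hi -> is_derive x 1 G (g x).
Proof.
move=> cg; exists (fun x => \int[leb]_(t in `[lo, x]) g t) => x /andP[lx xh].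
have [d dE] := continuous_FTC1_closed xh (continuous_integrable_itv lo hi cg) lx
    (cg x).
by apply: (DeriveDef d); rewrite -derive1E; exact: dE.
Qed.

Lemma FTC g G a : 0 < a -> continuous g ->
  (forall x, 0 <= x <= a -> is_derive x 1 G (g x)) ->
  \int[leb]_(x in `[0, a]) g x = G a - G 0.
Proof.
move=> a0 cg dG; rewrite /Rintegral (continuous_FTC2 (F := G) a0) //.
- exact: continuous_subspaceT.
- split.
  + move=> x; rewrite in_itv /= => /andP[x0 xa]; have [] := dG x; last by [].
    by rewrite !ltW.
  + apply: cvg_at_right_filter; apply: is_derive_continuous (dG 0 _);
      by rewrite lexx ltW.
  + apply: cvg_at_left_filter; apply: is_derive_continuous (dG a _);
      by rewrite lexx ltW.
- move=> x; rewrite in_itv /= => /andP[x0 xa]; rewrite derive1E.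
  by have h : 0 <= x <= a; [rewrite !ltW|have [] := dG x h].
Qed.

End Picone.

(** * Dependence of the one-dimensional eigenvalues on the Robin parameter *)

Section Levels.
Context {R : realType}.
Implicit Types (b m x y l : R) (f w g : R -> R).

Lemma primitive_sqr f f' : (forall x, is_derive x 1 f (f' x)) ->
  (forall x, 0 < x <= 1 -> 0 < f x) ->
  exists S : R -> R, (forall x, -1 < x < 2 -> is_derive x 1 S (f x ^+ 2)) /\
    0 < S 1 - S 0.
Proof.
move=> df f0.
have [|S dS] := primitive (fun x => f x ^+ 2) (-1) 2.
  exact: (derive_everywhere_continuous (fun x => is_derive_sqr (df x))).
exists S; split => //; rewrite subr_gt0.
apply: (increasing_from_derive S (fun x => f x ^+ 2)) => [||x /andP[x0 x1]];
    first exact: ltr01.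
  by apply: (derive_within_continuous (f' := fun x => f x ^+ 2)) => x x01;
      apply: dS; lra.
by split; [apply: dS; lra|rewrite exprn_gt0// f0// x0 ltW].
Qed.

(** The mode f of the parameter b is a test function in the Picone inequality of
    the mode g of the parameter b'; its own equation gives the primitive
    f f' + (m - m') S of f'^2 - m' f^2. *)
Lemma mode_compare {m b f f' m' b' g g'} {S : R -> R} :
  mode m b f f' -> mode m' b' g g' ->
  (forall x, 0 < x <= 1 -> 0 < g x) -> f 0 * f' 0 = 0 ->
  g' 0 = 0 /\ 0 < g 0 \/ [/\ g 0 = 0, 0 < g' 0 & f 0 = 0] ->
  (forall x, -1 < x < 2 -> is_derive x 1 S (f x ^+ 2)) ->
  m' * (S 1 - S 0) <= m * (S 1 - S 0) + (b' - b) * f 1 ^+ 2.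
Proof.
move=> [df df' rf] [dg dg' rg] g0 ff0 bc dS.
have := picone 1 m' g g' f f' (fun x => f x * f' x + (m - m') * S x) ltr01 dg
    dg' df g0 bc.
rewrite /= ff0 rg rf mulfK ?gt_eqF ?g0 ?ltr01 ?lexx//.
have h x : 0 <= x <= 1 -> is_derive x 1 (fun x => f x * f' x + (m - m') * S x)
    (f' x ^+ 2 - m' * f x ^+ 2).
  move=> x01; have xx : -1 < x < 2 by lra.
  apply: is_derive_ext (is_derive_add (is_derive_mul (df x) (df' x))
    (is_derive_scale (m - m') (dS x xx))) => //; ring.
move=> /(_ h); nra.
Qed.

(** Affine functions of nonnegative slope that lie above F and touch it at b: F
    is concave and nondecreasing. *)
Definition has_supergradients (F : R -> R) :=
  forall b, exists2 s, 0 <= s & forall b', F b' <= F b + s * (b' - b).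

(** An eigenvalue is an infimum of Rayleigh quotients that are affine in the
    Robin parameter. *)
Lemma mu_even_supergradients : has_supergradients mu_even.
Proof.
move=> b; have [f [f' [mf f'0 _ _ fpos]]] := even_mode b.
have fpos' x : 0 < x <= 1 -> 0 < f x by move=> /andP[x0 x1]; apply: fpos;
    rewrite ltW.
have [S [dS S0]] := primitive_sqr f f' (mode_derive _ _ _ _ mf) fpos'.
exists (f 1 ^+ 2 / (S 1 - S 0)) => [|b'];
    first by rewrite divr_ge0 ?sqr_ge0 ?ltW.
have [g [g' [mg g'0 _ _ gpos]]] := even_mode b'.
have := mode_compare mf mg _ _ _ dS; rewrite f'0 mulr0 => h.
have {}h : mu_even b' * (S 1 - S 0) <= mu_even b * (S 1 - S 0) + (b' - b) * f 1
    ^+ 2.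
  apply: h => //; last by left; split => //; apply: gpos; rewrite lexx ler01.
  by move=> x /andP[x0 x1]; apply: gpos; rewrite ltW.
have sN : f 1 ^+ 2 / (S 1 - S 0) * (S 1 - S 0) = f 1 ^+ 2 by rewrite divfK
    ?gt_eqF.
rewrite -(ler_pM2r S0); apply: (le_trans h); move: sN; set s := _ / _ => sN.
have -> : (mu_even b + s * (b' - b)) * (S 1 - S 0) =
    mu_even b * (S 1 - S 0) + (b' - b) * (s * (S 1 - S 0)) by ring.
by rewrite sN.
Qed.

Lemma mu_odd_supergradients : has_supergradients mu_odd.
Proof.
move=> b; have [f [f' [mf [f0 f'0] _ _ fpos]]] := odd_mode b.
have [S [dS S0]] := primitive_sqr f f' (mode_derive _ _ _ _ mf) fpos.
exists (f 1 ^+ 2 / (S 1 - S 0)) => [|b'];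
    first by rewrite divr_ge0 ?sqr_ge0 ?ltW.
have [g [g' [mg [g0 g'0] _ _ gpos]]] := odd_mode b'.
have := mode_compare mf mg gpos _ _ dS; rewrite f0 mul0r => h.
have {}h : mu_odd b' * (S 1 - S 0) <= mu_odd b * (S 1 - S 0) + (b' - b) * f 1 ^+
    2.
  by apply: h => //; right.
have sN : f 1 ^+ 2 / (S 1 - S 0) * (S 1 - S 0) = f 1 ^+ 2 by rewrite divfK
    ?gt_eqF.
rewrite -(ler_pM2r S0); apply: (le_trans h); move: sN; set s := _ / _ => sN.
have -> : (mu_odd b + s * (b' - b)) * (S 1 - S 0) =
    mu_odd b * (S 1 - S 0) + (b' - b) * (s * (S 1 - S 0)) by ring.
by rewrite sN.
Qed.

(** The test function x, which is the odd mode for b = -1. *)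
Lemma mu_odd_le b : mu_odd b <= 3 * (1 + b).
Proof.
have m0 : mode 0 (-1) (fun x : R => x) (fun=> 1).
  split => [x|x|]; [exact: is_derive_id| |by rewrite mulr1 opprK].
  by rewrite oppr0 mul0r; exact: is_derive_const.
have [g [g' [mg [g0 g'0] _ _ gpos]]] := odd_mode b.
have dS x : -1 < x < 2 -> is_derive x 1 (fun y : R => 3^-1 * (y ^+ 2 * y))
    (x ^+ 2).
  move=> _; apply: is_derive_ext (is_derive_scale 3^-1 (is_derive_mul
    (is_derive_sqr (is_derive_id x 1)) (is_derive_id x 1))) => //=; by field.
have := mode_compare m0 mg gpos _ _ dS; rewrite mul0r => h.
have : mu_odd b * (3^-1 * (1 ^+ 2 * 1) - 3^-1 * (0 ^+ 2 * 0)) <=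
  0 * (3^-1 * (1 ^+ 2 * 1) - 3^-1 * (0 ^+ 2 * 0)) + (b - -1) * 1 ^+ 2.
  by apply: h => //; right.
lra.
Qed.

(** The test function 1, which is the even mode for b = 0. *)
Lemma mu_even_le b : mu_even b <= b.
Proof.
have m0 : mode 0 0 (fun _ : R => 1) (fun=> 0).
  split => [x|x|]; [exact: is_derive_const| |by rewrite oppr0 mul0r].
  by rewrite oppr0 mul0r; exact: is_derive_const.
have [g [g' [mg g'0 _ _ gpos]]] := even_mode b.
have dS x : -1 < x < 2 -> is_derive x 1 (fun y : R => y) (1 ^+ 2).
  by move=> _; rewrite expr1n; exact: is_derive_id.
have := mode_compare m0 mg _ _ _ dS; rewrite mulr0 => h.
have : mu_even b * (1 - 0) <= 0 * (1 - 0) + (b - 0) * 1 ^+ 2.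
  apply: h => //; last by left; split => //; apply: gpos; rewrite lexx ler01.
  by move=> x /andP[x0 x1]; apply: gpos; rewrite ltW.
lra.
Qed.

Lemma supergradients_concave F x y z : has_supergradients F -> x < y < z ->
  F x * (z - y) + F z * (y - x) <= F y * (z - x).
Proof.
move=> sF /andP[xy yz]; have [s _ h] := sF y; have := h x; have := h z; nra.
Qed.

Lemma supergradients_nondecreasing F x y : has_supergradients F -> x <= y ->
  F x <= F y.
Proof. by move=> sF xy; have [s s0 h] := sF y; have := h x; nra. Qed.

(** Slopes decrease along a concave function, so those at points above b - 1
    are bounded by the slope at b - 1. *)
Lemma supergradients_continuous F : has_supergradients F -> continuous F.
Proof.
move=> sF b; have [s s0 h] := sF b; have [s1 s10 h1] := sF (b - 1).
have lip b' : b - 1 < b' -> `|F b - F b'| <= (s + s1) * `|b - b'|.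
  move=> bb'; have [s2 s20 h2] := sF b'.
  have := h b'; have := h2 b; have := h1 b'; have := h2 (b - 1) => i1 i2 i3 i4.
  have s21 : s2 <= s1 by nra.
  case: (lerP b b') => bb.
    by rewrite ler_norml; apply/andP; split; nra.
  by rewrite ler_norml; apply/andP; split; nra.
have s' : 0 < s + s1 + 1 by lra.
apply/cvgrPdist_le => e e0; near=> b'.
have b1 : b - 1 < b' by near: b'; apply: lt_nbhsr; lra.
apply: (le_trans (lip b' b1)).
have : `|b - b'| <= e / (s + s1 + 1).
  near: b'; have /cvgrPdist_le : id @ b --> b by exact: cvg_id.
  by move=> hb; apply: hb; rewrite divr_gt0.
rewrite ler_pdivlMr//; have := normr_ge0 (b - b'); nra.
Unshelve. all: by end_near. Qed.

Lemma mu_even_lt_odd b : mu_even b < mu_odd b.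
Proof.
have [b1|b1|->] := ltgtP b (-1).
- have [|x [x0 ex ->]] := mu_even_neg b; first lra.
  have [y [y0 ey ->]] := mu_odd_ltN1 b b1.
  rewrite ltrN2 ltr_pXn2r ?nnegrE ?ltW// ltNge; apply/negP => xy.
  have : x * sinh x * sinh y = y * cosh y * cosh x by rewrite ex ey; ring.
  have := sinh_gt0 _ x0; have := sinh_gt0 _ y0; have := sinh_lt_cosh x; have :=
      sinh_lt_cosh y.
  set a := sinh x; set a' := cosh x; set c := sinh y; set c' := cosh y =>
      h1 h2 h3 h4.
  have : x * (a * c) < y * (c' * a').
    have ac : a * c < a' * c' by apply: ltr_pM; rewrite ?ltW.
    have ac0 : 0 < a * c by rewrite mulr_gt0.
    nra.
  nra.
- have [y [/andP[y0 ypi] ey ->]] := mu_odd_gtN1 b b1.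
  have [b0|b0|->] := ltgtP b 0.
  + have [x [x0 ex ->]] := mu_even_neg b b0.
    have := exprn_gt0 2 x0; have := exprn_gt0 2 y0; lra.
  + have [x [/andP[x0 xpi] ex ->]] := mu_even_pos b b0.
    rewrite ltr_pXn2r ?nnegrE ?ltW//; apply: lt_le_trans xpi _; rewrite leNgt;
        apply/negP => ypi2.
    have : 0 < cos y by apply: cos_gt0_pihalf; have := pi_gt0 R; lra.
    have := sin_gt0_pi (ltac:(by rewrite y0) : 0 < y < pi); nra.
  + by rewrite mu_even0 exprn_gt0.
- have [|x [x0 ex ->]] := mu_even_neg (-1 : R); first lra.
  by rewrite mu_oddN1 oppr_lt0 exprn_gt0.
Qed.

Lemma sin_gt_xcos x : 0 < x < pi -> x * cos x < sin x.
Proof.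
move=> /andP[x0 xpi].
have := increasing_from_derive_cont _ _ _ _ x0
    (fun y => is_derive_sub (is_derive_sin y)
  (is_derive_mul (is_derive_id y 1) (is_derive_cos y))).
rewrite /= sin0 mul0r subr0 subr_gt0; apply => y /andP[y0 yx].
have : 0 < sin y by apply: sin_gt0_pi; rewrite y0 (lt_trans yx).
nra.
Qed.

Lemma sinh_lt_xcosh x : 0 < x -> sinh x < x * cosh x.
Proof.
move=> x0.
have := increasing_from_derive_cont _ _ _ _ x0 (fun y => is_derive_sub
  (is_derive_mul (is_derive_id y 1) (is_derive_cosh y)) (is_derive_sinh y)).
rewrite /= sinh0 mul0r subr0 subr_gt0; apply => y /andP[y0 yx].
have := sinh_gt0 _ y0; nra.
Qed.

Lemma mu_even_lt b : b != 0 -> mu_even b < b.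
Proof.
move=> bn0; have [b0|b0|bE] := ltgtP b 0; last by rewrite bE eqxx in bn0.
- have [x [x0 ex ->]] := mu_even_neg b b0.
  have := sinh_lt_xcosh _ x0; have := cosh_gt0 x => c0 h.
  rewrite -(ltr_pM2r c0); nra.
- have [x [/andP[x0 xpi] ex ->]] := mu_even_pos b b0.
  have c0 : 0 < cos x by apply: cos_gt0_pihalf; lra.
  have := sin_gt_xcos x (ltac:(have := pi_gt0 R; lra)) => h.
  rewrite -(ltr_pM2r c0); nra.
Qed.

Lemma mu_even_ge b : b - b ^+ 2 <= mu_even b /\
    (b < 0 -> b - b ^+ 2 < mu_even b).
Proof.
have [b0|b0|->] := ltgtP b 0; last by rewrite mu_even0; split; lra.
- have [x [x0 ex ->]] := mu_even_neg b b0.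
  suff : b - b ^+ 2 < - x ^+ 2 by move=> h; split => //; exact: ltW.
  have c0 := cosh_gt0 x; have s0 := sinh_gt0 _ x0; have h := sinh_cosh_gt _ x0;
      have h1 := cosh2_sinh2 x.
  have bE : b = - (x * sinh x / cosh x) by rewrite ex mulrK ?opprK// unitfE
      gt_eqF.
  rewrite bE -subr_gt0.
  have -> : - x ^+ 2 - (- (x * sinh x / cosh x) - (- (x * sinh x / cosh x)) ^+
      2)
    = (x * sinh x * cosh x - x ^+ 2 * (cosh x ^+ 2 - sinh x ^+ 2)) / cosh x ^+
        2.
    by field; rewrite gt_eqF.
  by rewrite h1 divr_gt0 ?exprn_gt0//; nra.
- have [x [/andP[x0 xpi] ex ->]] := mu_even_pos b b0; split; last by lra.
  have c0 : 0 < cos x by apply: cos_gt0_pihalf; lra.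
  have s0 := sin_lt _ x0; have c1 := cos_le1 x; have h1 := cos2Dsin2 x.
  have sx : 0 < sin x by apply: sin_gt0_pi; have := pi_gt0 R; lra.
  have -> : b = x * sin x / cos x by rewrite ex mulfK// gt_eqF.
  rewrite -subr_ge0.
  have -> : x ^+ 2 - (x * sin x / cos x - (x * sin x / cos x) ^+ 2)
    = (x ^+ 2 * (cos x ^+ 2 + sin x ^+ 2) - x * sin x * cos x) / cos x ^+ 2.
    by field; rewrite gt_eqF.
  have sc : sin x * cos x <= x by nra.
  rewrite h1 divr_ge0 ?exprn_ge0 ?ltW//; nra.
Qed.

Lemma mu_odd0_ge : 98 / 50 <= mu_odd (0 : R).
Proof.
have [|x [/andP[x0 xpi] ex ->]] := mu_odd_gtN1 (0 : R); first lra.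
suff : pi / 2 <= x by have := @pi_gt R; nra.
rewrite leNgt; apply/negP => xpi2.
have : 0 < cos x by apply: cos_gt0_pihalf; lra.
nra.
Qed.

Lemma mu_pos_le b : 0 < b -> mu_even b <= (pi / 2) ^+ 2 /\ mu_odd b <= pi ^+ 2.
Proof.
move=> b0; have [|y [/andP[y0 ypi] _ ->]] := mu_odd_gtN1 b; first lra.
have [x [/andP[x0 xpi] _ ->]] := mu_even_pos b b0.
by split; rewrite lerXn2r ?nnegrE ?divr_ge0 ?ltW// ?pi_gt0//.
Qed.

End Levels.

(** * Second-order behaviour of the eigenvalue curves *)

Section Curvature.
Context {R : realType}.
Implicit Types (b x y : R).

(** The line m = b is the tangent of [mu_even] at 0.  Subtracting this same line
    from both curves is what makes [long_level_subE] additive. *)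
Definition curv_even b : R := (mu_even b - b) / b ^+ 2.
Definition curv_odd b : R := (mu_odd b - b) / b ^+ 2.

Let th y : R := sinh y / cosh y.
Let tg y : R := sin y / cos y.

Let is_derive_th y : is_derive y 1 th (1 - th y ^+ 2).
Proof.
have c0 : cosh y != 0 by rewrite gt_eqF ?cosh_gt0.
apply: is_derive_ext (is_derive_mul (is_derive_sinh y)
    (is_derive_inv c0 (is_derive_cosh y))) => //.
by rewrite /th; field.
Qed.

Let th_gt0 y : 0 < y -> 0 < th y.
Proof. by move=> y0; rewrite divr_gt0 ?sinh_gt0 ?cosh_gt0. Qed.

Let th_lt1 y : th y < 1.
Proof. by rewrite ltr_pdivrMr ?cosh_gt0// mul1r sinh_lt_cosh. Qed.

Let th_sqr_gt y : 0 < y -> y * (1 - th y ^+ 2) < th y.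
Proof.
move=> y0; have c0 := cosh_gt0 y; have h := sinh_cosh_gt _ y0; have h1 :=
    cosh2_sinh2 y.
rewrite -subr_gt0.
have -> : th y - y * (1 - th y ^+ 2) =
    (sinh y * cosh y - y * (cosh y ^+ 2 - sinh y ^+ 2)) / cosh y ^+ 2.
  by rewrite /th; field; rewrite gt_eqF.
by rewrite h1 mulr1 divr_gt0 ?subr_gt0 ?exprn_gt0.
Qed.

Let th_third y : 0 < y -> y * th y ^+ 2 <= 3 * (y - th y).
Proof.
move=> y0; have := nondecreasing_from_derive_cont _ _ _ _ (ltW y0) (fun z =>
  is_derive_sub (is_derive_scale 3
      (is_derive_sub (is_derive_id z 1) (is_derive_th z)))
  (is_derive_mul (is_derive_id z 1) (is_derive_sqr (is_derive_th z)))).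
move=> h; have th0 : th 0 = 0 by rewrite /th sinh0 mul0r.
rewrite -subr_ge0; apply: le_trans (h _); first by rewrite th0; lra.
move=> z /andP[z0 _]; have := th_sqr_gt z z0; have := th_gt0 z z0; nra.
Qed.

Let xth_lt x y : 0 < x -> x < y -> x * th x < y * th y.
Proof.
move=> x0 xy; apply: (increasing_from_derive_cont _ _ _ _ xy (fun z =>
  is_derive_mul (is_derive_id z 1) (is_derive_th z))) => z /andP[xz _].
have z0 := lt_trans x0 xz; have t0 := th_gt0 z z0; have t1 := th_lt1 z.
have t2 : 0 < 1 - th z ^+ 2 by nra.
have := mulr_gt0 z0 t2; lra.
Qed.

Let mu_even_neg_th b : b < 0 -> exists x,
  [/\ 0 < x, b = - (x * th x) & curv_even b = (x * th x)^-1 - (th x ^+ 2)^-1].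
Proof.
move=> b0; have [x [x0 ex mE]] := mu_even_neg b b0; exists x.
have bE : b = - (x * th x).
  by rewrite /th mulrA ex mulfK ?opprK// gt_eqF ?cosh_gt0.
split => //; rewrite /curv_even mE bE; field.
by rewrite !gt_eqF ?th_gt0.
Qed.

(** Put b = - B with B = x tanh x.  Then [curv_even b] = - r for
    r = 1 / (tanh x)^2 - 1 / B, and
    dr/dB = (1 - 3 r + 2 r (1 - r) B) / (B (2 - (1 - r) B)).  As
    1/3 <= r <= 1, for B <= 3/2 this is at most 2 r (1 - r) <= 1/2. *)
Lemma curv_even_lipschitz b1 b2 : - (3 / 2) <= b1 -> b1 <= b2 -> b2 < 0 ->
  curv_even b2 - curv_even b1 <= (b2 - b1) / 2.
Proof.
move=> b132 b12 b20.
have [x1 [x10 b1E ->]] := mu_even_neg_th b1 (le_lt_trans b12 b20).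
have [x2 [x20 b2E ->]] := mu_even_neg_th b2 b20.
have x21 : x2 <= x1 by rewrite leNgt; apply/negP => /(xth_lt _ _ x10); lra.
have dk (z : R) : 0 < z -> is_derive z 1
    (fun z : R => 2^-1 * (z * th z) - ((th z ^+ 2)^-1 - (z * th z)^-1))
   (2^-1 * (1 * th z + z * (1 - th z ^+ 2)) -
       (- (2 * th z * (1 - th z ^+ 2)) / (th z ^+ 2) ^+ 2 -
     (- (1 * th z + z * (1 - th z ^+ 2)) / (z * th z) ^+ 2))).
  move=> z0; have t0 : th z != 0 by rewrite gt_eqF ?th_gt0.
  have dB := is_derive_mul (is_derive_id z 1) (is_derive_th z).
  apply: is_derive_sub (is_derive_scale _ dB)
      (is_derive_sub (is_derive_inv _ (is_derive_sqr (is_derive_th z)))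
      (is_derive_inv _ dB)).
    by rewrite expf_neq0.
  by rewrite mulf_neq0// gt_eqF.
have xz (z : R) : x2 <= z <= x1 -> 0 < z by move=> /andP[/(lt_le_trans x20)].
have := nondecreasing_from_derive_on x21 (fun z h => dk z (xz z h)).
suff pos (z : R) : x2 < z < x1 ->
    0 <= 2^-1 * (1 * th z + z * (1 - th z ^+ 2)) -
    (- (2 * th z * (1 - th z ^+ 2)) / (th z ^+ 2) ^+ 2 -
     (- (1 * th z + z * (1 - th z ^+ 2)) / (z * th z) ^+ 2)).
  move=> h; have : 2^-1 * (x2 * th x2) - ((th x2 ^+ 2)^-1 - (x2 * th x2)^-1) <=
     2^-1 * (x1 * th x1) - ((th x1 ^+ 2)^-1 - (x1 * th x1)^-1).
    exact: h pos.
  by rewrite b1E b2E; lra.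
move=> /andP[x2z zx1]; have z0 := lt_trans x20 x2z; have t0 := th_gt0 z z0.
have t1 := th_lt1 z; have := th_third z z0; have := th_sqr_gt z z0.
have := xth_lt z x1 z0 zx1; set t := th z in t0 t1 * => Bx1 r1 r3.
have B32 : z * t < 3 / 2 by lra.
have tn0 : t != 0 by rewrite gt_eqF.
have zn0 : z != 0 by rewrite gt_eqF.
(* In terms of B = z t and r = 1/t^2 - 1/(z t), z times the derivative is a
   polynomial in B and r. *)
pose r := (t ^+ 2)^-1 - (z * t)^-1.
have -> : 2^-1 * (1 * t + z * (1 - t ^+ 2)) -
    (- (2 * t * (1 - t ^+ 2)) / (t ^+ 2) ^+ 2 -
     (- (1 * t + z * (1 - t ^+ 2)) / (z * t) ^+ 2)) =
   (2^-1 * (2 * (z * t) - (1 - r) * (z * t) ^+ 2) -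
       (1 - 3 * r + 2 * r * (1 - r) * (z * t))) / z.
  by rewrite /r; field; rewrite tn0 zn0.
have rE : r * (z * t ^+ 2) = z - t by rewrite /r; field; rewrite tn0 zn0.
have zt0 : 0 < z * t ^+ 2 by rewrite mulr_gt0 ?exprn_gt0.
have r_le1 : r <= 1 by rewrite -(ler_pM2r zt0) rE; lra.
have r_ge3 : 1 / 3 <= r by rewrite -(ler_pM2r zt0) rE; lra.
have B0 : 0 < z * t by rewrite mulr_gt0.
rewrite divr_ge0 ?ltW//; move: B0 B32; set B := z * t => B0 B32.
have h1 : (1 - r) * B <= 1 by nra.
have h2 : 2 * r * (1 - r) <= 1 / 2 by have := sqr_ge0 (r - 1 / 2); nra.
nra.
Qed.

(** The derivative of 2 sin + tan - 3 x is (1 - cos)^2 (1 + 2 cos) / cos^2. *)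
Let huygens y : 0 < y < pi / 2 -> 3 * y <= 2 * sin y + tg y.
Proof.
move=> /andP[y0 ypi].
have c0 (z : R) : 0 <= z <= y -> 0 < cos z by move=> /andP[z0 zy]; apply:
    cos_gt0_pihalf; have := pi_gt0 R; lra.
have d (z : R) (h : 0 <= z <= y) :
    is_derive z 1 (fun z : R => 2 * sin z + sin z * (cos z)^-1 - 3 * z)
    (2 * cos z + (cos z * (cos z)^-1 + sin z * (- - sin z / cos z ^+ 2)) - 3 *
        1).
  have cn0 : cos z != 0 by rewrite gt_eqF ?c0.
  exact: is_derive_sub (is_derive_add (is_derive_scale 2 (is_derive_sin z))
      (is_derive_mul (is_derive_sin z)
    (is_derive_inv cn0 (is_derive_cos z))))
        (is_derive_scale 3 (is_derive_id z 1)).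
have h := nondecreasing_from_derive_on (ltW y0) d.
have : 2 * sin 0 + sin 0 * (cos 0)^-1 - 3 * 0 <= 2 * sin y + sin y * (cos y)^-1
    - 3 * y.
  apply: h => z /andP[z0 zy]; have zz : 0 <= z <= y by rewrite !ltW.
  have cz := c0 z zz; have cn0 : cos z != 0 by rewrite gt_eqF.
  have -> : 2 * cos z + (cos z * (cos z)^-1 + sin z * (- - sin z / cos z ^+ 2))
      - 3 * 1 =
     (2 * cos z ^+ 3 + (cos z ^+ 2 + sin z ^+ 2) - 3 * cos z ^+ 2) / cos z ^+ 2
         by field.
  rewrite cos2Dsin2 divr_ge0 ?sqr_ge0//.
  have -> : 2 * cos z ^+ 3 + 1 - 3 * cos z ^+ 2 = (1 - cos z) ^+ 2 *
      (1 + 2 * cos z) by ring.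
  by rewrite mulr_ge0 ?sqr_ge0//; lra.
rewrite sin0 mul0r /tg; lra.
Qed.

(** From Huygens' inequality and Cauchy-Schwarz, tan^2 + 2 sin^2 >= 3 x^2, the
    derivative form of tan sin^2 >= x^3; the arithmetic-geometric mean
    inequality then gives the sum. *)
Let wilker y : 0 < y < pi / 2 -> 2 * y ^+ 2 <= y * tg y + sin y ^+ 2.
Proof.
move=> /andP[y0 ypi].
have c0 (z : R) : 0 <= z <= y -> 0 < cos z by move=> /andP[z0 zy]; apply:
    cos_gt0_pihalf; have := pi_gt0 R; lra.
have s0 (z : R) : 0 < z <= y -> 0 < sin z by move=> /andP[z0 zy]; apply:
    sin_gt0_pi; have := pi_gt0 R; lra.
have d (z : R) (h : 0 <= z <= y) :
    is_derive z 1 (fun z : R => sin z * sin z ^+ 2 * (cos z)^-1 - z * z ^+ 2)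
    ((cos z * sin z ^+ 2 + sin z * (2 * sin z * cos z)) * (cos z)^-1
      + sin z * sin z ^+ 2 * (- - sin z / cos z ^+ 2) -
          (1 * z ^+ 2 + z * (2 * z * 1))).
  have cn0 : cos z != 0 by rewrite gt_eqF ?c0.
  exact: is_derive_sub (is_derive_mul
      (is_derive_mul (is_derive_sin z) (is_derive_sqr (is_derive_sin z)))
    (is_derive_inv cn0 (is_derive_cos z)))
        (is_derive_mul (is_derive_id z 1) (is_derive_sqr (is_derive_id z 1))).
have h := nondecreasing_from_derive_on (ltW y0) d.
have : sin 0 * sin 0 ^+ 2 * (cos 0)^-1 - 0 * 0 ^+ 2 <= sin y * sin y ^+ 2 *
    (cos y)^-1 - y * y ^+ 2.
  apply: h => z /andP[z0 zy]; have zz : 0 <= z <= y by rewrite !ltW.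
  have cz := c0 z zz; have cn0 : cos z != 0 by rewrite gt_eqF.
  have hz := huygens z ltac:(by rewrite z0 (lt_trans zy)).
  have -> : (cos z * sin z ^+ 2 + sin z * (2 * sin z * cos z)) * (cos z)^-1
      + sin z * sin z ^+ 2 * (- - sin z / cos z ^+ 2) -
          (1 * z ^+ 2 + z * (2 * z * 1)) =
     tg z ^+ 2 + 2 * sin z ^+ 2 - 3 * z ^+ 2 + (cos z ^+ 2 + sin z ^+ 2 - 1) *
         tg z ^+ 2.
    by rewrite /tg; field.
  rewrite cos2Dsin2 subrr mul0r addr0; have := sqr_ge0 (tg z - sin z); nra.
rewrite sin0 !mul0r subr0 subr_ge0 => {}h.
have sy := s0 y ltac:(by rewrite y0 lexx); have cy :=
    c0 y ltac:(by rewrite ltW//=).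
have t0 : 0 < tg y by rewrite divr_gt0.
have {}h : y ^+ 3 <= tg y * sin y ^+ 2.
  have -> : tg y * sin y ^+ 2 = sin y * sin y ^+ 2 / cos y by rewrite /tg;
      field; rewrite gt_eqF.
  by apply: le_trans h; rewrite exprS.
have A0 : 0 <= y * tg y + sin y ^+ 2 by rewrite addr_ge0 ?sqr_ge0// mulr_ge0
    ?ltW.
have h4 : y * y ^+ 3 <= y * (tg y * sin y ^+ 2) by rewrite ler_pM2l.
have h5 : (2 * y ^+ 2) ^+ 2 <= (y * tg y + sin y ^+ 2) ^+ 2.
  have := sqr_ge0 (y * tg y - sin y ^+ 2); nra.
by move: h5; rewrite ler_pXn2r// nnegrE mulr_ge0 ?sqr_ge0.
Qed.

(** With b = x tan x the derivative in x has the sign of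
    x tan x + (sin x)^2 - 2 x^2, which is nonnegative by Wilker's inequality. *)
Lemma curv_even_nondecreasing b1 b2 : 0 < b1 -> b1 <= b2 ->
    curv_even b1 <= curv_even b2.
Proof.
move=> b10 b12.
have cE (b : R) : 0 < b -> exists x, [/\ 0 < x < pi / 2, b = x * tg x &
    curv_even b = (tg x ^+ 2)^-1 - (x * tg x)^-1].
  move=> b0; have [x [/andP[x0 xpi] ex mE]] := mu_even_pos b b0; exists x.
  have c0 : 0 < cos x by apply: cos_gt0_pihalf; lra.
  have s0 : 0 < sin x by apply: sin_gt0_pi; have := pi_gt0 R; lra.
  have bE : b = x * tg x by rewrite /tg mulrA ex mulfK// gt_eqF.
  split => //; first by rewrite x0.
  by rewrite /curv_even mE bE /tg; field; rewrite !gt_eqF.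
have [x1 [/andP[x10 x1pi] b1E ->]] := cE b1 b10.
have [x2 [/andP[x20 x2pi] b2E ->]] := cE b2 (lt_le_trans b10 b12).
have c0 (z : R) : 0 < z < pi / 2 -> 0 < cos z by move=> /andP[z0 zy]; apply:
    cos_gt0_pihalf; lra.
have s0 (z : R) : 0 < z < pi / 2 -> 0 < sin z by move=> /andP[z0 zy]; apply:
    sin_gt0_pi; have := pi_gt0 R; lra.
have t0 (z : R) : 0 < z < pi / 2 -> 0 < tg z by move=> h;
    rewrite divr_gt0 ?c0 ?s0.
have dt (z : R) : 0 < z < pi / 2 -> is_derive z 1 tg (1 + tg z ^+ 2).
  move=> h; have cn0 : cos z != 0 by rewrite gt_eqF ?c0.
  apply: is_derive_ext (is_derive_mul (is_derive_sin z)
      (is_derive_inv cn0 (is_derive_cos z))) => //.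
  by rewrite /tg; field.
have x12 : x1 <= x2.
  rewrite leNgt; apply/negP => x21.
  have dB (z : R) (h : x2 <= z <= x1) :
      is_derive z 1 (fun z : R => z * tg z) (1 * tg z + z * (1 + tg z ^+ 2)).
    apply: is_derive_mul (is_derive_id z 1) (dt z _); lra.
  have h := increasing_from_derive_on x21 dB.
  have : x2 * tg x2 < x1 * tg x1; last by lra.
  apply: h => z /andP[z0 z1].
  have := t0 z ltac:(lra); have := sqr_ge0 (tg z); nra.
have dk (z : R) (h : x1 <= z <= x2) :
    is_derive z 1 (fun z : R => (tg z ^+ 2)^-1 - (z * tg z)^-1)
   (- (2 * tg z * (1 + tg z ^+ 2)) / (tg z ^+ 2) ^+ 2 -
     (- (1 * tg z + z * (1 + tg z ^+ 2)) / (z * tg z) ^+ 2)).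
  have zz : 0 < z < pi / 2 by lra.
  have tn0 : tg z != 0 by rewrite gt_eqF ?t0.
  apply: is_derive_sub (is_derive_inv _ (is_derive_sqr (dt z zz)))
    (is_derive_inv _ (is_derive_mul (is_derive_id z 1) (dt z zz))).
    by rewrite expf_neq0.
  by rewrite mulf_neq0// gt_eqF//; lra.
have h := nondecreasing_from_derive_on x12 dk.
apply: h => z /andP[z1 z2].
have zz : 0 < z < pi / 2 by lra.
have w := wilker z zz; have tz := t0 z zz; have sz := s0 z zz; have cz :=
    c0 z zz.
have z0 : 0 < z by lra.
have tE : tg z ^+ 2 = sin z ^+ 2 * (1 + tg z ^+ 2).
  have -> : sin z ^+ 2 * (1 + tg z ^+ 2) = tg z ^+ 2 *
      (cos z ^+ 2 + sin z ^+ 2).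
    by rewrite /tg; field; rewrite gt_eqF.
  by rewrite cos2Dsin2 mulr1.
have -> : - (2 * tg z * (1 + tg z ^+ 2)) / (tg z ^+ 2) ^+ 2 -
     (- (1 * tg z + z * (1 + tg z ^+ 2)) / (z * tg z) ^+ 2) =
   (tg z ^+ 2 + z * tg z * (1 + tg z ^+ 2) - 2 * z ^+ 2 * (1 + tg z ^+ 2)) /
       (z ^+ 2 * tg z ^+ 3).
  by field; rewrite !gt_eqF.
rewrite divr_ge0//; last by rewrite mulr_ge0 ?exprn_ge0 ?ltW.
have T0 : 0 <= 1 + tg z ^+ 2 by rewrite addr_ge0 ?sqr_ge0.
have := ler_wpM2r T0 w; move: tE; lra.
Qed.

Lemma curv_even_lt0 b : b != 0 -> curv_even b < 0.
Proof.
move=> b0; rewrite /curv_even pmulr_llt0 ?invr_gt0 ?subr_lt0 ?mu_even_lt//.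
by rewrite exprn_even_gt0.
Qed.

(** A concave function that is positive at 0 has a decreasing ratio to b. *)
Lemma mu_odd_ratio_decreasing b1 b2 : 0 < b1 -> b1 < b2 ->
    mu_odd b2 / b2 < mu_odd b1 / b1.
Proof.
move=> b10 b12; have b20 := lt_trans b10 b12.
have := supergradients_concave mu_odd 0 b1 b2 mu_odd_supergradients;
    rewrite b10 b12 => /(_ isT).
have := @mu_odd0_ge R; rewrite !subr0 => h0 h.
rewrite ltr_pdivlMr// mulrAC ltr_pdivrMr//; nra.
Qed.

End Curvature.

(** * Maximization over the aspect ratio *)

Section Ratio.
Context {R : realType}.
Implicit Types (b c p x y : R).

(** With b = alpha / 8, four times this number is the excess of the scaled
    eigenvalue of the square over alpha, the value reached by rectangles that
    degenerate. *)
Definition excess b : R := mu_even b + mu_odd b - 2 * b.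

Lemma excess_concave x y z : x < y < z ->
  excess x * (z - y) + excess z * (y - x) <= excess y * (z - x).
Proof.
move=> xyz; have := supergradients_concave _ _ _ _ mu_even_supergradients xyz.
have := supergradients_concave _ _ _ _ mu_odd_supergradients xyz.
rewrite /excess; nra.
Qed.

Lemma excess_continuous : continuous excess.
Proof.
move=> x; rewrite /excess; apply: cvgB.
  by apply: cvgD; apply: supergradients_continuous;
      [exact: mu_even_supergradients|exact: mu_odd_supergradients].
by apply: cvgM; [exact: cvg_cst|exact: cvg_id].
Qed.

Lemma excess0_gt0 : 0 < excess 0.
Proof. by rewrite /excess mu_even0; have := @mu_odd0_ge R; lra. Qed.

Lemma excess_root_pos : exists2 b, 0 < b & excess b = 0.
Proof.
have p0 : 0 < pi ^+ 2 :> R by rewrite exprn_gt0 ?pi_gt0.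
have e1 : excess (pi ^+ 2) < 0.
  by have [] := mu_pos_le _ p0; rewrite /excess => h1 h2; have := p0; nra.
have [||b] := @IVT R excess 0 (pi ^+ 2) 0 (ltW p0).
- exact: continuous_subspaceT excess_continuous.
- by rewrite ge_min le_max (ltW e1) (ltW excess0_gt0) orbT.
rewrite in_itv /= => /andP[b0 _] eb; exists b => //.
by rewrite lt_neqAle b0 andbT; apply/eqP => b0'; have := excess0_gt0;
    rewrite -b0' in eb; rewrite eb ltxx.
Qed.

(** The bounds mu_odd b <= 3 (1 + b) and mu_even b < b are just sharp enough to
    make the excess negative at -3/2; it is positive at -1. *)
Lemma excess_root_neg : exists2 b, b < -1 & excess b = 0.
Proof.
have e1 : excess (- (3 / 2)) < 0.
  have n0 : - (3 / 2) != 0 :> R by rewrite lt_eqF//; lra.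
  by have := mu_even_lt _ n0; have := mu_odd_le (- (3 / 2) : R);
      rewrite /excess; lra.
have e2 : 0 < excess (-1).
  have [_ /(_ ltac:(lra))] := mu_even_ge (-1 : R).
  by rewrite /excess mu_oddN1; lra.
have [|||b] := @IVT R excess (- (3 / 2)) (-1) 0; first lra.
- exact: continuous_subspaceT excess_continuous.
- by rewrite ge_min le_max (ltW e1) (ltW e2) orbT.
rewrite in_itv /= => /andP[_ b0] eb; exists b => //.
by rewrite lt_neqAle b0 andbT; apply/eqP => b0'; move: e2; rewrite -b0' eb ltxx.
Qed.

Lemma alpha_plus_spec : 0 < alpha_plus R /\ excess (alpha_plus R / 8) = 0.
Proof.
have aE (a : R) : 0 < a -> g1_inv (a / 8) ^+ 2 + g2_inv (a / 8) ^+ 2 = a / 4 <->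
    excess (a / 8) = 0.
  move=> a0; have a8 : 0 < a / 8 by rewrite divr_gt0.
  have a8' : -1 < a / 8 by lra.
  have -> : excess (a / 8) = g1_inv (a / 8) ^+ 2 + g2_inv (a / 8) ^+ 2 - 2 *
      (a / 8).
    by rewrite /excess /mu_even /mu_odd a8 a8'.
  by move: (g1_inv _ ^+ 2) (g2_inv _ ^+ 2) => u v; split; lra.
have [|a0 /aE] := @xgetPex R 0 [set a | 0 < a /\
    g1_inv (a / 8) ^+ 2 + g2_inv (a / 8) ^+ 2 = a / 4]; last by move=> /(_ a0).
have [b b0 eb] := excess_root_pos; exists (8 * b); split;
    first by rewrite mulr_gt0.
by apply/aE; rewrite ?mulr_gt0// -[RHS]eb; congr excess; lra.
Qed.

Lemma alpha_minus_spec : alpha_minus R < -8 /\ excess (alpha_minus R / 8) = 0.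
Proof.
have aE (a : R) : a < -8 -> h1_inv (`|a| / 8) ^+ 2 + h2_inv (`|a| / 8) ^+ 2 =
    `|a| / 4 <->
    excess (a / 8) = 0.
  move=> a8; rewrite ltr0_norm; last by lra.
  have h1 : a / 8 < 0 by lra.
  have h2 : a / 8 < -1 by lra.
  have -> : excess (a / 8) = - h1_inv (- (a / 8)) ^+ 2 - h2_inv (- (a / 8)) ^+ 2
      - 2 * (a / 8).
    by rewrite /excess /mu_even /mu_odd h1 h2 !ltNge (ltW h1) (ltW h2).
  rewrite mulNr; move: (h1_inv _ ^+ 2) (h2_inv _ ^+ 2) => u v; split; lra.
have [|a0 /aE] := @xgetPex R 0 [set a | a < -8 /\
    h1_inv (`|a| / 8) ^+ 2 + h2_inv (`|a| / 8) ^+ 2 = `|a| / 4]; last by move=>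
        /(_ a0).
have [b b0 eb] := excess_root_neg; exists (8 * b); split; first by lra.
by apply/aE; [lra|rewrite -[RHS]eb; congr excess; lra].
Qed.

(** A concave function that is positive at 0 is nonnegative exactly between a
    negative and a positive zero. *)
Lemma alpha_rangeP a : (alpha_minus R <= a <= alpha_plus R) =
    (0 <= excess (a / 8)).
Proof.
have [p0 ep] := alpha_plus_spec; have [m0 em] := alpha_minus_spec; have e0 :=
    excess0_gt0.
apply/idP/idP => [/andP[h1 h2]|h].
- case: (ltgtP a 0) => [a0|a0|->]; last by rewrite mul0r ltW.
  + move: h1; rewrite le_eqVlt => /predU1P[<-|h1]; first by rewrite em.
    have := excess_concave (alpha_minus R / 8) (a / 8) 0 ltac:(lra); rewrite em;
        nra.
  + move: h2; rewrite le_eqVlt => /predU1P[->|h2]; first by rewrite ep.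
    have := excess_concave 0 (a / 8) (alpha_plus R / 8) ltac:(lra); rewrite ep;
        nra.
- apply/andP; split; rewrite leNgt; apply/negP => ha.
  + have := excess_concave (a / 8) (alpha_minus R / 8) 0 ltac:(lra); rewrite em;
      nra.
  + have := excess_concave 0 (alpha_plus R / 8) (a / 8) ltac:(lra); rewrite ep;
      nra.
Qed.

(** A quarter of the scaled eigenvalue of the product function that is even
    along the side of share p of the half-perimeter and odd along the other
    side, for c = alpha / 4. *)
Definition long_level c p : R :=
  mu_even (c * p) * ((1 - p) / p) + mu_odd (c * (1 - p)) * (p / (1 - p)).

Lemma long_level_subE c p : c != 0 -> 0 < p < 1 -> long_level c p - c =
  c ^+ 2 * (p * (1 - p)) * (curv_even (c * p) + curv_odd (c * (1 - p))).
Proof.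
move=> c0 /andP[p0 p1]; rewrite /long_level /curv_even /curv_odd; field.
by rewrite c0 !gt_eqF ?subr_gt0.
Qed.

(** Write b = c p, b' = c (1 - p) and e = c / 2, the midpoint of b and b'.  If
    mu_odd b' <= b', both terms of H p are nonpositive and the first is
    negative.  Otherwise both terms are compared with those at e.  For c > 0
    the term in b increases towards e, and the term in b' increases as b'
    decreases to e because it is (mu_odd b' / b' - 1) / b' with two positive
    decreasing factors.  For c < 0 the first term may move the wrong way, at a
    rate of at most 1/2; but then b' > -3/2, and there concavity of [mu_odd]
    makes the second term move the right way at a rate of at least
    mu_odd 0 / (27/8) > 1/2. *)
Lemma curv_sum_lt c p : c != 0 -> 0 < p < 1 / 2 ->
  let H q := curv_even (c * q) + curv_odd (c * (1 - q)) in H p < 0 \/ H p < H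
      (1 / 2).
Proof.
move=> cn0 /andP[p0 p2] H; rewrite /H.
have -> : c * (1 - 1 / 2) = c * (1 / 2) by field.
set b := c * p; set b' := c * (1 - p); set e := c * (1 / 2).
have be : b + b' = 2 * e by rewrite /b /b' /e; field.
have bn0 : b != 0 by rewrite mulf_neq0// gt_eqF.
have [b'1|b'1] := leP (mu_odd b') b'.
  left; have := curv_even_lt0 b bn0.
  suff : curv_odd b' <= 0 by lra.
  by rewrite /curv_odd pmulr_lle0 ?subr_le0// invr_gt0 exprn_even_gt0//=
      mulf_neq0// gt_eqF//; lra.
right; have [c0|c0|c0] := ltgtP c 0; last by rewrite c0 eqxx in cn0.
- have b'e : b' < e by rewrite /b' /e; nra.
  have e0 : e < 0 by rewrite /e; nra.
  have b0 : b < 0 by rewrite /b; nra.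
  have b'32 : - (3 / 2) < b' by have := mu_odd_le b'; lra.
  have h1 := curv_even_lipschitz e b ltac:(lra) ltac:(lra) b0.
  have h2 := supergradients_concave _ _ _ _ mu_odd_supergradients
      (ltac:(by rewrite b'e) : b' < e < 0).
  have h3 := @mu_odd0_ge R.
  suff : (e - b') / 2 < curv_odd e - curv_odd b' by lra.
  rewrite /curv_odd.
  set n0 := mu_odd 0 in h2 h3; set ne := mu_odd e in h2 *; set nb :=
      mu_odd b' in b'1 h2 *.
  have E0 : 0 < e ^+ 2 * b' ^+ 2 by rewrite mulr_gt0// exprn_even_gt0//=
      lt_eqF//; lra.
  rewrite -(ltr_pM2r E0).
  have -> : ((ne - e) / e ^+ 2 - (nb - b') / b' ^+ 2) * (e ^+ 2 * b' ^+ 2) =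
     (ne - e) * b' ^+ 2 - (nb - b') * e ^+ 2 by field; rewrite !lt_eqF//; lra.
  have h4 : (nb - b') * - e + n0 * (e - b') <= (ne - e) * - b' by lra.
  have h5 : ((nb - b') * - e + n0 * (e - b')) * - b' <= (ne - e) * b' ^+ 2.
    have : 0 < - b' by lra.
    by move=> /ltW/ler_wpM2r/(_ _ _ h4); rewrite -mulrA mulrNN -expr2.
  have h6 : (nb - b') * e ^+ 2 <= (nb - b') * (e * b') by rewrite ler_wpM2l;
      [|lra|nra].
  have h7 : e ^+ 2 * - b' <= 27 / 8.
    have : e ^+ 2 <= 9 / 4 by nra.
    nra.
  have : (e - b') / 2 * (e ^+ 2 * b' ^+ 2) < n0 * (e - b') * - b'; last by lra.
  have -> : (e - b') / 2 * (e ^+ 2 * b' ^+ 2) = (e ^+ 2 * - b') / 2 *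
      ((e - b') * - b') by field.
  rewrite -[ltRHS]mulrA ltr_pM2r; first by lra.
  by rewrite mulr_gt0; lra.
- have b0 : 0 < b by rewrite /b mulr_gt0.
  have eb' : e < b' by rewrite /e /b'; nra.
  have e0 : 0 < e by rewrite /e; lra.
  have h1 := curv_even_nondecreasing b e b0 ltac:(lra).
  suff : curv_odd b' < curv_odd e by lra.
  have h2 := mu_odd_ratio_decreasing _ _ e0 eb'.
  have cE x : 0 < x -> curv_odd x = x^-1 * (mu_odd x / x - 1).
    by move=> x0; rewrite /curv_odd; field; rewrite gt_eqF.
  have b'0 : 0 < b' by lra.
  rewrite !cE//.
  have h3 : 1 < mu_odd b' / b' by rewrite ltr_pdivlMr// mul1r.
  have h4 : b'^-1 < e^-1 by rewrite ltf_pV2.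
  have h5 : 0 < b'^-1 by rewrite invr_gt0.
  nra.
Qed.

Lemma long_level_half c : long_level c (1 / 2) - c = excess (c / 2).
Proof.
rewrite /long_level /excess.
have -> : c * (1 / 2) = c / 2 by field.
by have -> : c * (1 - 1 / 2) = c / 2; field.
Qed.

Lemma curv_sum_half c : c != 0 ->
  c ^+ 2 * (1 / 4) * (curv_even (c * (1 / 2)) + curv_odd (c * (1 - 1 / 2))) =
      excess (c / 2).
Proof.
move=> c0; rewrite -long_level_half long_level_subE//; last by lra.
by congr (_ * _ * _); field.
Qed.

Lemma long_level_lt_half c p : 0 <= excess (c / 2) -> 0 < p < 1 / 2 ->
  long_level c p < long_level c (1 / 2).
Proof.
move=> ec p2; have [c0|c0] := eqVneq c 0.
  rewrite c0 /long_level !mul0r mu_even0 !mul0r !add0r.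
  have := @mu_odd0_ge R => h; rewrite ltr_pM2l; last by lra.
  by rewrite ltr_pdivrMr; [have -> : 1 / 2 / (1 - 1 / 2) = 1 :> R by field|];
      lra.
have c20 : 0 < c ^+ 2 by rewrite exprn_even_gt0.
have := long_level_half c; have := curv_sum_half c c0.
have := long_level_subE c p c0 ltac:(lra); have := curv_sum_lt c p c0 p2.
move=> /=; set Hp := curv_even (c * p) + _; set H2 :=
    curv_even (c * (1 / 2)) + _ => Hlt pE H2E h2.
have H20 : 0 <= H2.
  rewrite -(@pmulr_rge0 _ (c ^+ 2 * (1 / 4))) ?H2E// mulr_gt0//; lra.
have pp : 0 < p * (1 - p) < 1 / 4 by nra.
suff : c ^+ 2 * (p * (1 - p) * Hp) < c ^+ 2 * (1 / 4 * H2) \/ c ^+ 2 *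
    (p * (1 - p) * Hp) < 0.
  by move=> [] ?; lra.
have [Hp0|Hp0] := ltP Hp 0; first by right; rewrite pmulr_rlt0//; nra.
by left; rewrite ltr_pM2l//; case: Hlt; nra.
Qed.

Lemma long_level_lt_coef c p : excess (c / 2) < 0 -> 0 < p <= 1 / 2 ->
    long_level c p < c.
Proof.
move=> ec /andP[p0]; rewrite le_eqVlt => /predU1P[->|p2].
  by have := long_level_half c; lra.
have c0 : c != 0.
  by apply/eqP => c0; move: ec; rewrite c0 mul0r; have := excess0_gt0; lra.
have c20 : 0 < c ^+ 2 by rewrite exprn_even_gt0.
have := long_level_half c; have := curv_sum_half c c0.
have := long_level_subE c p c0 ltac:(lra); have :=
    curv_sum_lt c p c0 ltac:(lra).
move=> /=; set Hp := curv_even (c * p) + _; set H2 :=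
    curv_even (c * (1 / 2)) + _ => Hlt pE H2E h2.
have H20 : H2 < 0.
  rewrite -(@pmulr_rlt0 _ (c ^+ 2 * (1 / 4))) ?H2E// mulr_gt0//; lra.
have Hp0 : Hp < 0 by case: Hlt; lra.
have : c ^+ 2 * (p * (1 - p) * Hp) < 0; last by lra.
by rewrite pmulr_rlt0// pmulr_rlt0//; nra.
Qed.

(** As p tends to 0 one has mu_even (c p) / p -> c, whereas the odd level of
    the short side blows up like mu_odd 0 / p. *)
Lemma long_level_limit c : exists2 K, 0 < K & forall p, 0 < p -> p * K <= 1 ->
  [/\ p < 1 / 2, `|long_level c p - c| <= p * K & c <= long_level c (1 - p)].
Proof.
have n0 := normr_ge0 c; have c2 :
    c ^+ 2 = `|c| ^+ 2 by rewrite real_normK ?num_real.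
have [cn1 cn2] : c <= `|c| /\ - c <= `|c| by split;
    rewrite ?ler_norm// -normrN ler_norm.
pose M := 3 + 3 * `|c| + `|c| ^+ 2.
have bnd x : 0 <= x <= 1 -> `|mu_odd (c * x)| <= M.
  move=> x01; have := mu_odd_le (c * x); have [h _] := mu_even_ge (c * x).
  have h2 := mu_even_lt_odd (c * x) => h3.
  have [x0 x1] := andP x01.
  have h4 : `|c * x| <= `|c| by rewrite normrM (ger0_norm x0) ler_piMr.
  have h5 : (c * x) ^+ 2 <= `|c| ^+ 2.
    by rewrite exprMn c2 ler_piMr ?sqr_ge0// exprn_ile1.
  move: h4; rewrite !ler_norml /M => /andP[h6 h7]; apply/andP; split; nra.
exists (4 + 4 * `|c| + 2 * `|c| ^+ 2 + 2 * M) => [|p p0 pK];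
    first by rewrite /M; nra.
have M0 : 0 <= M by rewrite /M; nra.
have p2 : p < 1 / 2 by nra.
have pV : p^-1 * p = 1 by rewrite mulVf// gt_eqF.
have [g1 _] := mu_even_ge (c * p); have g2 := mu_even_le (c * p).
split => //.
- have -> : long_level c p - c = (mu_even (c * p) - c * p) / p - mu_even (c * p)
     + mu_odd (c * (1 - p)) * (p / (1 - p)).
    by rewrite /long_level; field; rewrite !gt_eqF//; lra.
  have := bnd (1 - p) ltac:(lra) => h.
  have h1 : `|mu_odd (c * (1 - p)) * (p / (1 - p))| <= M * (2 * p).
    have q : 0 <= p / (1 - p) <= 2 * p.
      by rewrite divr_ge0/= ?ler_pdivrMr; [nra|lra|lra|lra].
    rewrite normrM (ger0_norm (_ : 0 <= p / (1 - p))); last by case/andP: q.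
    by apply: ler_pM => //; case/andP: q.
  have h2 : - (`|c| ^+ 2 * p) <= (mu_even (c * p) - c * p) / p <= 0.
    rewrite ler_pdivlMr// ler_pdivrMr// -c2; apply/andP; split; nra.
  have h3 : `|mu_even (c * p)| <= `|c| * p + `|c| ^+ 2 * p.
    rewrite -c2 ler_norml; apply/andP; split; nra.
  move: h1 h3; rewrite !ler_norml => /andP[? ?] /andP[? ?]; move: h2 =>
      /andP[? ?].
  apply/andP; split; nra.
- rewrite /long_level opprB addrCA subrr addr0.
  have h1 : 1 <= mu_odd (c * p).
    have := @mu_odd0_ge R => h0.
    have [cp0|cp0] := leP 0 (c * p).
      by apply: le_trans (supergradients_nondecreasing _ _ _
          mu_odd_supergradients cp0); lra.
    have cp1 : - (1 / 4) <= c * p by nra.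
    have := supergradients_concave _ _ _ _ mu_odd_supergradients
        (ltac:(lra) : -1 < c * p < 0).
    rewrite mu_oddN1; nra.
  have q0 : 0 <= p / (1 - p) <= 1.
    by rewrite divr_ge0/= ?ler_pdivrMr; [lra|lra|lra|lra].
  have h2 : - (`|c| + `|c| ^+ 2) <= mu_even (c * (1 - p)) * (p / (1 - p)).
    have [h _] := mu_even_ge (c * (1 - p)).
    have h3 : - (`|c| + `|c| ^+ 2) <= mu_even (c * (1 - p)).
      have q1 : 0 <= (1 - p) ^+ 2 <= 1 by rewrite sqr_ge0 exprn_ile1//; lra.
      have [q2 q3] := andP q1.
      have h6 : (c * (1 - p)) ^+ 2 <= `|c| ^+ 2 by rewrite exprMn c2 ler_piMr
          ?sqr_ge0.
      have h7 : - `|c| <= c * (1 - p) by nra.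
      lra.
    have h8 : 0 <= `|c| + `|c| ^+ 2 by rewrite addr_ge0 ?sqr_ge0.
    have [q2 q3] := andP q0.
    set z := p / (1 - p) in q2 q3 *; nra.
  have h4 : p^-1 - 1 <= mu_odd (c * p) * ((1 - p) / p).
    have -> : (1 - p) / p = p^-1 - 1 by field; rewrite gt_eqF.
    by rewrite ler_peMl// subr_ge0 invf_ge1//; lra.
  have h5 : 4 + 4 * `|c| + 2 * `|c| ^+ 2 + 2 * M <= p^-1 by rewrite -div1r
      ler_pdivlMr// mulrC.
  rewrite /M in h5; nra.
Qed.

End Ratio.

(** * Robin eigenfunctions of an interval *)

Section Interval.
Context {R : realType}.
Implicit Types (a b m x y l : R) (f w g u v phi chi : R -> R).
Local Notation leb := (@lebesgue_measure R).
Local Notation int a g := (\int[leb]_(x in `[0, a]) g x).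

Lemma int_add a f g : continuous f -> continuous g ->
  int a (fun x => f x + g x) = int a f + int a g.
Proof. by move=> cf cg; apply: RintegralD => //; exact:
    continuous_integrable_itv. Qed.

Lemma int_sub a f g : continuous f -> continuous g ->
  int a (fun x => f x - g x) = int a f - int a g.
Proof. by move=> cf cg; apply: RintegralB => //; exact:
    continuous_integrable_itv. Qed.

Lemma int_scale a c f : continuous f -> int a (fun x => c * f x) = c * int a f.
Proof. by move=> cf; apply: RintegralZl => //; exact: continuous_integrable_itv.
    Qed.

Lemma continuous_mul {T : topologicalType} (f g : T -> R) : continuous f ->
    continuous g -> continuous (fun z => f z * g z).
Proof. by move=> cf cg z; apply: cvgM; [exact: cf|exact: cg]. Qed.

Lemma continuous_add {T : topologicalType} (f g : T -> R) : continuous f ->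
    continuous g -> continuous (fun z => f z + g z).
Proof. by move=> cf cg z; apply: cvgD; [exact: cf|exact: cg]. Qed.

Lemma continuous_sub f g : continuous f -> continuous g ->
    continuous (fun x => f x - g x).
Proof. by move=> cf cg x; apply: cvgB; [exact: cf|exact: cg]. Qed.

Lemma continuous_scale {T : topologicalType} c (f : T -> R) : continuous f ->
    continuous (fun z => c * f z).
Proof. by move=> cf z; apply: cvgM; [exact: cvg_cst|exact: cf]. Qed.

Lemma continuous_sqr {T : topologicalType} (f : T -> R) : continuous f ->
    continuous (fun z => f z ^+ 2).
Proof. by move=> cf; exact: (continuous_mul _ _ cf cf). Qed.

Lemma int_ge0 a f : (forall x, 0 <= f x) -> 0 <= int a f.
Proof. by move=> f0; apply: Rintegral_ge0. Qed.

Definition robin_form a beta (u u' v v' : R -> R) : R :=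
  int a (fun x => u' x * v' x) + beta * (u 0 * v 0 + u a * v a).

Record interval_mode a beta m phi phi' : Prop := IntervalMode {
  im_derive : forall x, is_derive x 1 phi (phi' x);
  im_ode : forall x, is_derive x 1 phi' (- m * phi x);
  im_left : phi' 0 = beta * phi 0;
  im_right : phi' a = - beta * phi a }.

Lemma green a beta m phi phi' w w' : 0 < a -> interval_mode a beta m phi phi' ->
  (forall x, is_derive x 1 w (w' x)) -> continuous w' ->
  robin_form a beta phi phi' w w' = m * int a (fun x => phi x * w x).
Proof.
move=> a0 [dp dp' p0 pa] dw cw'.
have cp := derive_everywhere_continuous dp; have cp' :=
    derive_everywhere_continuous dp'.
have cw := derive_everywhere_continuous dw.
have cpw := continuous_mul _ _ cp cw; have cpw' := continuous_mul _ _ cp' cw'.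
rewrite /robin_form -int_scale//.
have := FTC _ (fun x => phi' x * w x) _ a0
    (continuous_sub _ _ cpw' (continuous_scale m _ cpw)).
rewrite int_sub//; last exact: continuous_scale.
rewrite p0 pa => h; have {}h : int a (fun x => phi' x * w' x) - int a
    (fun x => m * (phi x * w x)) =
  - beta * phi a * w a - beta * phi 0 * w 0.
  apply: h => x _; apply: is_derive_ext (is_derive_mul (dp' x) (dw x)) => //;
      ring.
lra.
Qed.

Lemma robin_form_sub a beta c u u' v v' :
  continuous u' -> continuous v' ->
  robin_form a beta (fun x => u x - c * v x) (fun x => u' x - c * v' x)
                    (fun x => u x - c * v x) (fun x => u' x - c * v' x) =
  robin_form a beta u u' u u' - 2 * c * robin_form a beta v v' u u'
   + c ^+ 2 * robin_form a beta v v' v v'.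
Proof.
move=> cu cv; rewrite /robin_form.
have -> : int a (fun x => (u' x - c * v' x) * (u' x - c * v' x)) =
   int a (fun x => u' x * u' x) - 2 * c * int a (fun x => v' x * u' x) + c ^+ 2
       * int a (fun x => v' x * v' x).
  have cuu := continuous_mul _ _ cu cu; have cvu := continuous_mul _ _ cv cu;
      have cvv := continuous_mul _ _ cv cv.
  rewrite -!int_scale// -int_sub//; last exact: continuous_scale.
  rewrite -int_add//; [|by apply: continuous_sub => //; exact:
      continuous_scale|exact: continuous_scale].
  by apply: eq_Rintegral => x _; ring.
ring.
Qed.

Lemma int_sqr_sub a c u v : continuous u -> continuous v ->
  int a (fun x => (u x - c * v x) ^+ 2) =
  int a (fun x => u x ^+ 2) - 2 * c * int a (fun x => u x * v x) + c ^+ 2 * int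
      a (fun x => v x ^+ 2).
Proof.
move=> cu cv.
have cuu := continuous_sqr _ cu; have cuv := continuous_mul _ _ cu cv;
    have cvv := continuous_sqr _ cv.
rewrite -!int_scale// -int_sub//; last exact: continuous_scale.
rewrite -int_add//; [|by apply: continuous_sub => //; exact:
    continuous_scale|exact: continuous_scale].
by apply: eq_Rintegral => x _; ring.
Qed.

(** A function that vanishes at the midpoint obeys, on either half, the
    inequality of the half-interval with a Dirichlet condition there, whose
    optimal function is the odd mode. *)
Lemma midpoint_zero_inequality a beta w w' : 0 < a ->
  (forall x, is_derive x 1 w (w' x)) -> continuous w' -> w (a / 2) = 0 ->
  mu_odd (beta * (a / 2)) / (a / 2) ^+ 2 * int a (fun x => w x ^+ 2) <=
  robin_form a beta w w' w w'.
Proof.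
move=> a0 dw cw' wl.
have cw := derive_everywhere_continuous dw.
set l := a / 2 in wl *; have l0 : 0 < l by rewrite divr_gt0.
have aE : a = l + l by rewrite /l; field.
set b := beta * l; have [g [g' [[dg dg' rg] [g0 g'0] _ _ gpos]]] := odd_mode b.
set m := mu_odd b / l ^+ 2.
pose f x := g (l^-1 * x); pose f' x := l^-1 * g' (l^-1 * x).
have df x : is_derive x 1 f (f' x) by exact: is_derive_dilate (dg _).
have df' x : is_derive x 1 f' (- m * f x).
  apply: is_derive_ext (is_derive_scale l^-1
      (is_derive_dilate l^-1 (dg' (l^-1 * x)))) => //.
  by rewrite /m /f; field; rewrite gt_eqF.
have fpos x : 0 < x <= l -> 0 < f x.
  move=> /andP[x0 xl]; apply: gpos; rewrite mulr_gt0 ?invr_gt0//=.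
  by rewrite mulrC ler_pdivrMr// mul1r.
have fl : f' l / f l = - beta.
  rewrite /f /f' mulVf ?gt_eqF// rg /b; field; rewrite !gt_eqF//; apply: gpos;
      by rewrite ltr01 lexx.
have cI : continuous (fun x => w' x * w' x - m * w x ^+ 2).
  apply: continuous_sub; first exact: continuous_mul.
  by apply: continuous_scale; exact: continuous_sqr.
have [I dI] := primitive _ (-1) (a + 1) cI.
have dI' x : 0 <= x <= a -> is_derive x 1 I (w' x * w' x - m * w x ^+ 2) by
    move=> h; apply: dI; lra.
(* The two halves, s = 1 and s = -1, by reflection about the midpoint. *)
have half s : s ^+ 2 = 1 -> - beta * w (s * l + l) ^+ 2 <= s * I (s * l + l) - s
    * I l.
  move=> s1; have /pred2P s1' : (s == 1) || (s == -1) by rewrite -sqrf_eq1 s1.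
  rewrite -fl.
  have := @picone R l m f f' (fun x => w (s * x + l))
      (fun x => s * w' (s * x + l))
    (fun x => s * I (s * x + l)) l0 df df' _ fpos _ _.
  rewrite mulr0 add0r; apply.
  - by move=> x; exact: is_derive_affine (dw _).
  - by right; rewrite /f /f' /= !mulr0 g0 ?add0r wl mulr_gt0 ?invr_gt0.
  - move=> x xl; apply: is_derive_ext
      (is_derive_scale s (is_derive_affine s l (dI' (s * x + l) _))) => //.
      by rewrite mulrA -expr2 s1 mul1r exprMn s1 mul1r expr2.
    by case: s1' => ->; lra.
have h1 := half 1 (expr1n _ _); have h2 :=
    half (-1) ltac:(by rewrite sqrrN expr1n).
rewrite !mul1r -aE in h1; rewrite !mulN1r addNr in h2.
have := FTC _ I _ a0 cI dI'; rewrite int_sub; last 2 first.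
- exact: continuous_mul.
- by apply: continuous_scale; exact: continuous_sqr.
rewrite int_scale; last exact: continuous_sqr.
rewrite /robin_form; lra.
Qed.

(** With c = w(a/2) / phi(a/2) the function w - c phi vanishes at the midpoint.
    Expanding both sides of [midpoint_zero_inequality] with the help of
    [green] leaves the term (nu - m) ((c - P)^2 - P^2), P the coefficient of
    w on phi, and (c - P)^2 is dropped. *)
Lemma interval_gap a beta m phi phi' w w' : 0 < a ->
  interval_mode a beta m phi phi' -> int a (fun x => phi x ^+ 2) = 1 ->
      phi (a / 2) != 0 ->
  m <= mu_odd (beta * (a / 2)) / (a / 2) ^+ 2 ->
  (forall x, is_derive x 1 w (w' x)) -> continuous w' ->
  let nu := mu_odd (beta * (a / 2)) / (a / 2) ^+ 2 in
  nu * int a (fun x => w x ^+ 2) - (nu - m) * (int a (fun x => w x * phi x)) ^+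
      2 <=
  robin_form a beta w w' w w'.
Proof.
move=> a0 mphi n1 pl mnu dw cw' /=; set nu := mu_odd _ / _ in mnu *.
have [dp dp' _ _] := mphi.
have cp := derive_everywhere_continuous dp; have cp' :=
    derive_everywhere_continuous dp'.
have cw := derive_everywhere_continuous dw.
pose c := w (a / 2) / phi (a / 2).
have := midpoint_zero_inequality a beta (fun x => w x - c * phi x)
    (fun x => w' x - c * phi' x) a0.
rewrite robin_form_sub// int_sqr_sub// n1.
rewrite (green a beta m phi phi' w w')// (green a beta m phi phi' phi phi')//.
have -> : int a (fun x => phi x * phi x) = 1 by rewrite -n1.
have -> : int a (fun x => phi x * w x) = int a (fun x => w x * phi x).
  by apply: eq_Rintegral => x _; rewrite mulrC.
rewrite -/nu => h.
have : nu * (int a (fun x => w x ^+ 2) - 2 * c * int a (fun x => w x * phi x) +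
    c ^+ 2 * 1) <=
  robin_form a beta w w' w w' - 2 * c * (m * int a (fun x => w x * phi x)) + c
      ^+ 2 * (m * 1).
  apply: (h (fun x => is_derive_sub (dw x) (is_derive_scale c (dp x)))).
  - by apply: continuous_sub => //; exact: continuous_scale.
  - by rewrite /c divfK ?subrr.
set P := int a (fun x => w x * phi x) => h0; have := sqr_ge0 (c - P); nra.
Qed.

Lemma int_sqr_gt0 a f : 0 < a -> continuous f ->
    (forall x, a / 2 < x < a -> 0 < f x) ->
  0 < int a (fun x => f x ^+ 2).
Proof.
move=> a0 cf f0; have cff := continuous_sqr _ cf.
have [G dG] := primitive _ (-1) (a + 1) cff.
have dG' x : 0 <= x <= a -> is_derive x 1 G (f x ^+ 2) by move=> xa; apply: dG;
    lra.
rewrite (FTC _ G _ a0 cff dG').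
rewrite subr_gt0; apply: (@le_lt_trans _ _ (G (a / 2))).
  apply: (nondecreasing_from_derive_on (f' := fun x => f x ^+ 2)); first lra.
    by move=> x xa; apply: dG; lra.
  by move=> x _; exact: sqr_ge0.
apply: (increasing_from_derive_on (f' := fun x => f x ^+ 2)); first lra.
  by move=> x xa; apply: dG; lra.
by move=> x xa; rewrite exprn_gt0// f0.
Qed.

Lemma interval_mode_scale a beta m phi phi' c :
    interval_mode a beta m phi phi' ->
  interval_mode a beta m (fun x => c * phi x) (fun x => c * phi' x).
Proof.
move=> [d d' p0 pa]; split => [x|x||].
- exact: is_derive_scale.
- by apply: is_derive_ext (is_derive_scale c (d' x)) => //; ring.
- by rewrite p0; ring.
- by rewrite pa; ring.
Qed.

Lemma interval_mode_normalize a beta m phi phi' : 0 < a ->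
    interval_mode a beta m phi phi' ->
  (forall x, a / 2 < x < a -> 0 < phi x) ->
  exists c, [/\ c != 0, interval_mode a beta m (fun x => c * phi x)
      (fun x => c * phi' x) &
    int a (fun x => (c * phi x) ^+ 2) = 1].
Proof.
move=> a0 mphi p0; have cp := derive_everywhere_continuous
    (im_derive _ _ _ _ _ mphi).
have N0 := int_sqr_gt0 _ _ a0 cp p0; set N := int a (fun x => phi x ^+ 2) in N0.
exists (Num.sqrt N)^-1; split.
- by rewrite invr_neq0// gt_eqF// sqrtr_gt0.
- exact: interval_mode_scale.
- under eq_Rintegral do rewrite exprMn.
  rewrite int_scale ?exprVn ?sqr_sqrtr ?mulVf ?gt_eqF ?ltW//; exact:
      continuous_sqr.
Qed.

Lemma mode_interval_mode a beta m f f' s : 0 < a ->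
  mode m (beta * (a / 2)) f f' -> s ^+ 2 = 1 ->
  (forall x, f (- x) = s * f x) -> (forall x, f' (- x) = - s * f' x) ->
  interval_mode a beta (m / (a / 2) ^+ 2) (fun x => f ((a / 2)^-1 * x + -1))
    (fun x => (a / 2)^-1 * f' ((a / 2)^-1 * x + -1)).
Proof.
move=> a0 [df df' rf] s1 fN f'N; set l := a / 2 in rf *.
have l0 : 0 < l by rewrite divr_gt0.
have la : l^-1 * a + -1 = 1 by rewrite /l; field; rewrite gt_eqF.
split => [x|x||].
- exact: is_derive_affine (df _).
- apply: is_derive_ext (is_derive_scale l^-1
    (is_derive_affine l^-1 (-1) (df' (l^-1 * x + -1)))) => //.
  by field; rewrite gt_eqF.
- by rewrite mulr0 add0r f'N fN rf; field; rewrite gt_eqF.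
- by rewrite la rf; field; rewrite gt_eqF.
Qed.

Lemma interval_even_mode a beta : 0 < a -> exists phi phi',
  [/\ interval_mode a beta (mu_even (beta * (a / 2)) / (a / 2) ^+ 2) phi phi',
    int a (fun x => phi x ^+ 2) = 1 & phi (a / 2) != 0].
Proof.
move=> a0; have [f [f' [mf f'0 fN f'N fpos]]] := even_mode (beta * (a / 2)).
have l0 : 0 < a / 2 by rewrite divr_gt0.
have [|||x xa|c [c0 h1 h2]] := interval_mode_normalize _ _ _ _ _ a0
    (mode_interval_mode a beta _ f f' 1 a0 mf _ _ _).
- by rewrite expr1n.
- by move=> x; rewrite mul1r fN.
- by move=> x; rewrite mulN1r f'N.
- apply: fpos; rewrite lerBrDr add0r mulrC ler_pdivlMr// lerBlDr ler_pdivrMr//;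
    lra.
exists (fun x => c * f ((a / 2)^-1 * x + -1)),
    (fun x => c * ((a / 2)^-1 * f' ((a / 2)^-1 * x + -1))).
split => //=; rewrite mulVf ?(gt_eqF l0)// subrr; apply: mulf_neq0 => //.
by rewrite gt_eqF// fpos// lexx ler01.
Qed.

Lemma interval_odd_mode a beta : 0 < a -> exists chi chi',
  interval_mode a beta (mu_odd (beta * (a / 2)) / (a / 2) ^+ 2) chi chi' /\
    int a (fun x => chi x ^+ 2) = 1.
Proof.
move=> a0; have [f [f' [mf [f0 f'0] fN f'N fpos]]] := odd_mode (beta * (a / 2)).
have l0 : 0 < a / 2 by rewrite divr_gt0.
have [|||x xa|c [c0 h1 h2]] := interval_mode_normalize _ _ _ _ _ a0
    (mode_interval_mode a beta _ f f' (-1) a0 mf _ _ _).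
- by rewrite sqrrN expr1n.
- by move=> x; rewrite mulN1r fN.
- by move=> x; rewrite opprK mul1r f'N.
- apply: fpos; rewrite ltrBrDr add0r mulrC ltr_pdivlMr// lerBlDr ler_pdivrMr//;
    lra.
by exists (fun x => c * f ((a / 2)^-1 * x + -1)),
    (fun x => c * ((a / 2)^-1 * f' ((a / 2)^-1 * x + -1))).
Qed.

Lemma robin_form_sym a beta u u' v v' :
  robin_form a beta u u' v v' = robin_form a beta v v' u u'.
Proof.
rewrite /robin_form; congr (_ + _); last by rewrite [in RHS]mulrC; ring.
by apply: eq_Rintegral => x _; rewrite mulrC.
Qed.

Lemma interval_mode_orthogonal a beta m m' phi phi' chi chi' : 0 < a ->
    m != m' ->
  interval_mode a beta m phi phi' -> interval_mode a beta m' chi chi' ->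
  int a (fun x => phi x * chi x) = 0.
Proof.
move=> a0 mm' mp mc; have [dp dp' _ _] := mp; have [dc dc' _ _] := mc.
have h1 := green _ _ _ _ _ _ _ a0 mp dc (derive_everywhere_continuous dc').
have := green _ _ _ _ _ _ _ a0 mc dp (derive_everywhere_continuous dp').
rewrite robin_form_sym h1; under [in RHS]eq_Rintegral do rewrite mulrC.
move/eqP; rewrite -subr_eq0 -mulrBl mulf_eq0 subr_eq0 (negbTE mm') => /eqP //.
Qed.

End Interval.

(** * Lebesgue measure of the plane under rotations *)

Section PlaneMeasure.
Context {R : realType}.
Local Notation leb := (@lebesgue_measure R).
Local Notation leb2 := (leb \x leb)%E.
Local Notation plane := (measurableTypeR R * measurableTypeR R)%type.

Lemma lebesgue_measure_translate (t : R) (A : set (measurableTypeR R)) :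
    measurable A ->
  leb ((fun x => x + t) @^-1` A) = leb A.
Proof.
move=> mA; have mt : measurable_fun [set: measurableTypeR R]
    (fun x : measurableTypeR R => x + t : measurableTypeR R).
  exact: measurable_realfun.measurable_funD.
have -> : leb ((fun x => x + t) @^-1` A) = pushforward leb
    (fun x : measurableTypeR R => x + t : measurableTypeR R) A by [].
apply/esym; apply: lebesgue_measure_unique => // _ [[a b]] /= ab <-.
rewrite /pushforward.
have -> : (fun x => x + t) @^-1` `]a, b]%classic = `]a - t, b - t]%classic.
  by apply/seteqP; split => x /=; rewrite !in_itv /= ltrBlDr lerBrDr.
rewrite !lebesgue_measure_itv /= !lte_fin ltrD2r; case: ifPn => // _.
by rewrite -!EFinB; congr EFin; ring.
Qed.

Definition preserving (T : plane -> plane) : Prop :=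
  measurable_fun setT T /\ forall A, measurable A -> leb2 (T @^-1` A) = leb2 A.

Lemma preserving_comp T S : preserving T -> preserving S -> preserving (T \o S).
Proof.
move=> [mT hT] [mS hS]; split; first exact: measurableT_comp.
move=> A mA; rewrite comp_preimage hS ?hT// -[X in measurable X]setTI; exact:
    mT.
Qed.

(** Vertical sections are translated, which does not change their length. *)
Lemma preserving_shear2 (g : measurableTypeR R -> measurableTypeR R) :
    measurable_fun setT g ->
  preserving (fun z => (z.1, z.2 + g z.1)).
Proof.
move=> mg; have mS : measurable_fun [set: plane]
    (fun z : plane => (z.1, z.2 + g z.1) : plane).
  apply: measurable_fun_pair; first exact: measurable_fst.
  by apply: measurable_realfun.measurable_funD;
      [exact: measurable_snd|apply: measurableT_comp => //; exact:
      measurable_fst].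
split => // A mA; rewrite /product_measure1 /=.
apply: eq_integral => x _ /=.
rewrite -(lebesgue_measure_translate (g x) (xsection A x)); last exact:
    measurable_xsection.
by congr (leb _); apply/seteqP; split => y /=; rewrite /xsection /= !inE.
Qed.

Lemma leb2_swap (A : set plane) : measurable A -> leb2 A = (leb \x^ leb)%E A.
Proof. by move=> mA; apply: product_measure_unique => //= B C mB mC;
    rewrite product_measure2E. Qed.

Lemma preserving_shear1 (g : measurableTypeR R -> measurableTypeR R) :
    measurable_fun setT g ->
  preserving (fun z => (z.1 + g z.2, z.2)).
Proof.
move=> mg; have mS : measurable_fun [set: plane]
    (fun z : plane => (z.1 + g z.2, z.2) : plane).
  apply: measurable_fun_pair; last exact: measurable_snd.
  by apply: measurable_realfun.measurable_funD;
      [exact: measurable_fst|apply: measurableT_comp => //; exact: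
      measurable_snd].
split => // A mA; have mSA : measurable
    ((fun z : plane => (z.1 + g z.2, z.2) : plane) @^-1` A).
  by rewrite -[X in measurable X]setTI; exact: mS.
rewrite !leb2_swap// /product_measure2 /=.
apply: eq_integral => y _ /=.
rewrite -(lebesgue_measure_translate (g y) (ysection A y)); last exact:
    measurable_ysection.
by congr (leb _); apply/seteqP; split => x /=; rewrite /ysection /= !inE.
Qed.

Definition rotation (c s : R) (z : plane) : plane :=
    (c * z.1 - s * z.2, s * z.1 + c * z.2).

(** A rotation by an angle other than pi is a product of three shears, with
    slope [s / (1 + c)], the tangent of the half angle; the half-turn is the
    square of a quarter-turn. *)
Lemma preserving_rotation c s : c ^+ 2 + s ^+ 2 = 1 ->
    preserving (rotation c s).
Proof.
have main d e : d ^+ 2 + e ^+ 2 = 1 -> d != -1 -> preserving (rotation d e).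
  move=> de d1; have d1' : 1 + d != 0 by rewrite addrC -[X in d + X]opprK
      subr_eq0.
  pose k := e / (1 + d).
  have sh1 : preserving (fun z => (z.1 + - k * z.2, z.2)).
    by apply: (preserving_shear1 (fun y : measurableTypeR R => - k * y :
        measurableTypeR R)); exact: measurable_realfun.measurable_funM.
  have sh2 : preserving (fun z => (z.1, z.2 + e * z.1)).
    by apply: (preserving_shear2 (fun y : measurableTypeR R => e * y :
        measurableTypeR R)); exact: measurable_realfun.measurable_funM.
  have := preserving_comp _ _ sh1 (preserving_comp _ _ sh2 sh1).
  congr preserving; apply/funext => -[x y]; rewrite /rotation /=.
  have ke : k * e = 1 - d.
    by rewrite /k mulrAC -expr2 (_ : e ^+ 2 = (1 - d) * (1 + d)) ?mulfK//; move:
        de; lra.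
  have kd : k * (1 + d) = e by rewrite /k divfK.
  congr pair.
    transitivity (x - (k * e) * x - 2 * k * y + (k * e) * k * y); first by ring.
    by rewrite ke -kd; ring.
  transitivity (y + e * x - (k * e) * y); first by ring.
  by rewrite ke; ring.
move=> cs; have [c1|c1] := eqVneq c (-1); last exact: main.
have s0 : s = 0 by move: cs; rewrite c1 sqrrN expr1n => /eqP;
    rewrite -subr_eq0 addrC addKr sqrf_eq0 => /eqP.
have q : preserving (rotation 0 1).
  by apply: main; rewrite ?expr0n ?expr1n ?add0r//= eq_sym oppr_eq0 oner_eq0.
have := preserving_comp _ _ q q.
by congr preserving; apply/funext => -[x y]; rewrite /rotation /= c1 s0;
    congr pair; ring.
Qed.

Lemma preserving_translation (a b : R) :
    preserving (fun z => (z.1 + a, z.2 + b)).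
Proof.
exact: (preserving_comp (fun z => (z.1 + a, z.2)) (fun z => (z.1, z.2 + b))
  (preserving_shear1 (cst a) (measurable_cst _))
      (preserving_shear2 (cst b) (measurable_cst _))).
Qed.

(** An open set is the union of the countably many balls of rational centre and
    radius that it contains. *)
Lemma open_measurable_plane (U : set (R * R)) : open U ->
    measurable (U : set plane).
Proof.
move=> oU.
pose I := [set q : rat * rat * rat | ball (ratr q.1.1 : R, ratr q.1.2 : R)
    (ratr q.2 : R) `<=` U].
have -> : U = \bigcup_(q in I) ball (ratr q.1.1 : R, ratr q.1.2 : R) (ratr q.2).
  apply/seteqP; split => [[x y] Uxy|z [q Iq]]; last exact: Iq.
  have /nbhs_ballP[e /= e0 he] := open_nbhs_nbhs (conj oU Uxy).
  have [e1 /= ] := rat_in_itvoo (ltac:(by rewrite divr_gt0) : 0 < e / 2).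
  rewrite in_itv /= => /andP[e10 e12].
  have [x1] := rat_in_itvoo (ltac:(by rewrite ltrBlDr ltrDl) : x - ratr e1 < x).
  rewrite in_itv /= => /andP[x11 x12].
  have [y1] := rat_in_itvoo (ltac:(by rewrite ltrBlDr ltrDl) : y - ratr e1 < y).
  rewrite in_itv /= => /andP[y11 y12].
  exists ((x1, y1), e1); last first.
    by split; rewrite /ball /= ltr_norml; lra.
  move=> [a b] [/= ha hb]; apply: he; split => /=; move: ha hb;
    rewrite /ball /= !ltr_norml; lra.
rewrite bigcup_mkcond; apply: countable_bigcupT_measurable; first exact:
    countableP.
move=> q; case: ifPn => // _.
have -> : ball (ratr q.1.1 : R, ratr q.1.2 : R) (ratr q.2) =
    (ball (ratr q.1.1 : R) (ratr q.2 : R)) `*`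
        (ball (ratr q.1.2 : R) (ratr q.2 : R)).
  by [].
by apply: measurableX; exact: measurable_realfun.measurable_ball.
Qed.

Lemma continuous_measurable_plane (f : R * R -> R) : continuous f ->
  measurable_fun [set: plane] (f : plane -> measurableTypeR R).
Proof.
move=> /continuousP cf; apply: (measurability _
    (measurable_realfun.RGenOpens.measurableE R)).
move=> _ [_ [a [b ->] <-]]; rewrite setTI; apply: open_measurable_plane.
exact/cf/interval_open.
Qed.

End PlaneMeasure.

(** * Integrals over boxes *)

Section Box.
Context {R : realType}.
Local Notation leb := (@lebesgue_measure R).
Local Notation leb2 := (leb \x leb)%E.
Local Notation plane := (measurableTypeR R * measurableTypeR R)%type.
Local Notation int a g := (\int[leb]_(x in `[0, a]) g x).
Implicit Types (f g : R * R -> R) (w h : R).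

Definition box w h : set (R * R) := `]0, w[ `*` `]0, h[.

Lemma measurable_box w h : measurable (box w h : set plane).
Proof. exact: measurableX. Qed.

Lemma box_lt_pinfty w h : (leb2 (box w h : set plane) < +oo)%E.
Proof.
rewrite product_measure1E//=; apply: lte_mul_pinfty => //; last first.
  by rewrite lebesgue_measure_itv /=; case: ifP => _; rewrite ?ltry.
by rewrite lebesgue_measure_itv /=; case: ifP => _; rewrite ?ltry.
Qed.

Lemma continuous_bounded_rectangle f (a b c d : R) : continuous f ->
  exists M, forall x y, a <= x <= b -> c <= y <= d -> `|f (x, y)| <= M.
Proof.
move=> cf; have cK : compact ((`[a, b] `*` `[c, d]) : set (R * R)).
  by apply: compact_setX; exact: segment_compact.
have := continuous_compact (continuous_subspaceT cf) cK.
move=> /compact_bounded[M [_ /(_ (M + 1))]]; rewrite ltrDl ltr01 => /(_ isT) hM.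
exists (M + 1) => x y xab ycd; apply: hM; exists (x, y) => //.
Qed.

Lemma box_integrable f w h : continuous f ->
    leb2.-integrable (box w h : set plane) (EFin \o f).
Proof.
move=> cf; apply: measurable_bounded_integrable.
- exact: measurable_box.
- exact: box_lt_pinfty.
- by apply: measurable_funTS; exact: continuous_measurable_plane.
- have [M hM] := continuous_bounded_rectangle f 0 w 0 h cf.
  exists M; split; first exact: num_real.
  move=> M' MM' [x y] [/=]; rewrite !in_itv /= => /andP[x0 xw] /andP[y0 yh].
  by apply: le_trans (ltW MM'); apply: hM; rewrite !ltW.
Qed.

Lemma continuous_pair {T : topologicalType} (u v : T -> R) : continuous u ->
    continuous v ->
  continuous (fun x => (u x, v x) : R * R).
Proof.
move=> cu cv x.
exact: (@cvg_pair _ _ _ (nbhs x) (nbhs (u x)) (nbhs (v x)) _ _ _ u v (cu x)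
    (cv x)).
Qed.

Lemma continuous_slice1 f y : continuous f -> continuous (fun x => f (x, y)).
Proof.
move=> cf x; apply: (@continuous_comp _ _ _ (fun x : R => (x, y) : R * R) f);
    last exact: cf.
by apply: continuous_pair => t; [exact: cvg_id|exact: cvg_cst].
Qed.

Lemma continuous_slice2 f x : continuous f -> continuous (fun y => f (x, y)).
Proof.
move=> cf y; apply: (@continuous_comp _ _ _ (fun y : R => (x, y) : R * R) f);
    last exact: cf.
by apply: continuous_pair => t; [exact: cvg_cst|exact: cvg_id].
Qed.

Lemma int_open a (g : R -> R) : continuous g ->
  int a g = \int[leb]_(x in `]0, a[) g x.
Proof.
move=> cg; have ig b : leb.-integrable [set` Interval (BRight 0) (BSide b a)]
    (EFin \o g).
  apply: (@integrableS _ _ _ leb `[0, a]) => //; last exact: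
      continuous_integrable_itv.
  by apply: subset_itv; rewrite ?bnd_simp; case: b.
by rewrite -[LHS]Rintegral_itv_obnd_cbnd// -[LHS]Rintegral_itv_bndo_bndc.
Qed.

Lemma EFin_int a (g : R -> R) : continuous g ->
  (\int[leb]_(x in `]0%R, a[) (g x)%:E)%E = (int a g)%:E.
Proof.
move=> cg; rewrite int_open// /Rintegral fineK//.
apply: integrable_fin_num => //; apply: (@integrableS _ _ _ leb `[0, a]) => //.
  by apply: subset_itv; rewrite ?bnd_simp.
exact: continuous_integrable_itv.
Qed.

Lemma continuous_int2 f h : continuous f ->
    continuous (fun x => int h (fun y => f (x, y))).
Proof.
move=> cf x; have [M hM] := continuous_bounded_rectangle f (x - 1) (x + 1) 0 h
    cf.
have xx : x \in `]x - 1, x + 1[%classic by rewrite inE /= in_itv /=; lra.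
have := @continuity_under_integral R _ _ leb (fun x y => f (x, y)) `[0, h] _
    (x - 1) (x + 1).
move=> /(_ (measurable_itv _)) hc; apply: hc xx => //.
- by move=> t _; apply: continuous_integrable_itv; exact: continuous_slice2.
- by apply: aeW => y _ t _; exact: continuous_slice1.
- exact: (continuous_integrable_itv (g := cst M) _ _ (@cst_continuous _ _ M)).
- move=> t; rewrite /= in_itv /= => /andP[t1 t2]; apply: aeW => y;
    rewrite /= in_itv /= => yh.
  by apply: hM => //; rewrite !ltW.
Qed.

Lemma continuous_swap f : continuous f ->
    continuous (fun z : R * R => f (z.2, z.1)).
Proof.
move=> cf z; apply: (@continuous_comp _ _ _
    (fun z : R * R => (z.2, z.1) : R * R) f); last exact: cf.
by apply: continuous_pair => t; [exact: cvg_snd|exact: cvg_fst].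
Qed.

Lemma continuous_int1 f w : continuous f ->
    continuous (fun y => int w (fun x => f (x, y))).
Proof. by move=> cf; exact: (continuous_int2 (fun z => f (z.2, z.1)) w
    (continuous_swap _ cf)). Qed.

Lemma box_fubini12 f w h : continuous f ->
  \int[leb2]_(z in box w h) f z = int w (fun x => int h (fun y => f (x, y))).
Proof.
move=> cf; rewrite [LHS]/Rintegral integral_mkcond.
rewrite -integral12_prod_meas1; last first.
  by apply/(integrable_mkcond _ (measurable_box w h)); exact: box_integrable.
rewrite -[RHS]/(fine (EFin _)) -EFin_int; last exact: continuous_int2.
rewrite [in RHS]integral_mkcond; congr fine; apply: eq_integral => x _.
rewrite /fubini_F !patchE; case: ifPn => xw.
  rewrite -EFin_int; last exact: continuous_slice2.
  rewrite [in RHS]integral_mkcond; apply: eq_integral => y _.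
  rewrite !patchE; have -> : ((x, y) \in box w h) = (y \in `]0, h[%classic) =>
      //.
  by apply/idP/idP; rewrite !inE; [case|split => //; rewrite inE in xw].
under eq_integral => y _.
  rewrite patchE ifF; last first.
    by apply/negbTE; apply: contra xw; rewrite !inE; case.
  over.
by rewrite integral0.
Qed.

Lemma box_fubini21 f w h : continuous f ->
  \int[leb2]_(z in box w h) f z = int h (fun y => int w (fun x => f (x, y))).
Proof.
move=> cf; rewrite [LHS]/Rintegral integral_mkcond.
rewrite -integral21_prod_meas1; last first.
  by apply/(integrable_mkcond _ (measurable_box w h)); exact: box_integrable.
rewrite -[RHS]/(fine (EFin _)) -EFin_int; last exact: continuous_int1.
rewrite [in RHS]integral_mkcond; congr fine; apply: eq_integral => y _.
rewrite /fubini_G !patchE; case: ifPn => yh.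
  rewrite -EFin_int; last exact: continuous_slice1.
  rewrite [in RHS]integral_mkcond; apply: eq_integral => x _.
  rewrite !patchE; have -> : ((x, y) \in box w h) = (x \in `]0, w[%classic) =>
      //.
  by apply/idP/idP; rewrite !inE; [case|split => //; rewrite inE in yh].
under eq_integral => x _.
  rewrite patchE ifF; last first.
    by apply/negbTE; apply: contra yh; rewrite !inE; case.
  over.
by rewrite integral0.
Qed.

End Box.

(** * The spectral gap of a box *)

Section BoxGap.
Context {R : realType}.
Local Notation leb := (@lebesgue_measure R).
Local Notation leb2 := (leb \x leb)%E.
Local Notation int a g := (\int[leb]_(x in `[0, a]) g x).
Implicit Types (a w h beta : R).

Lemma le_int a (f g : R -> R) : continuous f -> continuous g ->
    (forall x, f x <= g x) ->
  int a f <= int a g.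
Proof.
move=> cf cg fg; apply: le_Rintegral => //; exact: continuous_integrable_itv.
Qed.

Lemma bessel a (phi u : R -> R) : continuous phi -> continuous u ->
    int a (fun x => phi x ^+ 2) = 1 ->
  (int a (fun x => u x * phi x)) ^+ 2 <= int a (fun x => u x ^+ 2).
Proof.
move=> cp cu n1; set c := int a (fun x => u x * phi x).
have := @int_ge0 R a (fun x => (u x - c * phi x) ^+ 2) (fun x => sqr_ge0 _).
rewrite int_sqr_sub// n1 -/c; lra.
Qed.

Lemma continuous_fst_comp (f : R -> R) : continuous f ->
    continuous (fun z : R * R => f z.1).
Proof.
by move=> cf z; apply: (@continuous_comp _ _ _ (@fst R R) f);
    [exact: cvg_fst|exact: cf].
Qed.

Lemma continuous_snd_comp (f : R -> R) : continuous f ->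
    continuous (fun z : R * R => f z.2).
Proof.
by move=> cf z; apply: (@continuous_comp _ _ _ (@snd R R) f);
    [exact: cvg_snd|exact: cf].
Qed.

(** With P and Q the projections onto [phi] in the first variable and onto
    [psi] in the second, this is the nonnegativity of (1 - P)(1 - Q). *)
Lemma bessel_product w h (phi psi : R -> R) (W : R * R -> R) :
  continuous phi -> continuous psi -> continuous W ->
  int w (fun x => phi x ^+ 2) = 1 -> int h (fun y => psi y ^+ 2) = 1 ->
  int h (fun y => (int w (fun x => W (x, y) * phi x)) ^+ 2) +
  int w (fun x => (int h (fun y => W (x, y) * psi y)) ^+ 2) <=
  \int[leb2]_(z in box w h) (W z ^+ 2) +
  (\int[leb2]_(z in box w h) (W z * (phi z.1 * psi z.2))) ^+ 2.
Proof.
move=> cphi cpsi cW n1 n2.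
pose P y := int w (fun x => W (x, y) * phi x).
pose Q x := int h (fun y => W (x, y) * psi y).
have cphi2 := continuous_fst_comp _ cphi; have cpsi2 :=
    continuous_snd_comp _ cpsi.
have cWphi := continuous_mul _ _ cW cphi2; have cWpsi :=
    continuous_mul _ _ cW cpsi2.
have cP : continuous P := continuous_int1 _ w cWphi.
have cQ : continuous Q := continuous_int2 _ h cWpsi.
have cQ2 := continuous_fst_comp _ cQ.
have cW2 : continuous (fun z => W z ^+ 2) by exact: continuous_mul.
have cWQ := continuous_mul _ _ cW cQ2.
have cK : continuous (fun z : R * R => W z * (phi z.1 * psi z.2)).
  by apply: continuous_mul => //; exact: continuous_mul.
set kappa := \int[leb2]_(z in box w h) (W z * (phi z.1 * psi z.2)).
have kP : int h (fun y => P y * psi y) = kappa.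
  rewrite /kappa box_fubini21//; apply: eq_Rintegral => y _ /=.
  rewrite mulrC -int_scale; last exact: (continuous_slice1 _ y cWphi).
  by apply: eq_Rintegral => x _; ring.
have kQ : int w (fun x => Q x * phi x) = kappa.
  rewrite /kappa box_fubini12//; apply: eq_Rintegral => x _ /=.
  rewrite mulrC -int_scale; last exact: (continuous_slice2 _ x cWpsi).
  by apply: eq_Rintegral => y _; ring.
(* One-dimensional Bessel inequality for W (_, y) - psi y * Q, slice by
   slice. *)
pose S y := int w (fun x => W (x, y) * Q x).
have cS : continuous S := continuous_int1 _ w cWQ.
have SQ : int h (fun y => S y * psi y) = int w (fun x => Q x ^+ 2).
  transitivity (int h (fun y => int w (fun x => W (x, y) * psi y * Q x))).
    apply: eq_Rintegral => y _; rewrite mulrC -int_scale; last exact: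
        (continuous_slice1 _ y cWQ).
    by apply: eq_Rintegral => x _; ring.
  have cWpQ := continuous_mul _ _ cWpsi cQ2.
  rewrite -(box_fubini21 _ _ _ cWpQ) box_fubini12//; apply: eq_Rintegral =>
      x _ /=.
  transitivity (Q x * int h (fun y => W (x, y) * psi y));
      last by rewrite -/(Q x) expr2.
  rewrite -int_scale; last exact: (continuous_slice2 _ x cWpsi).
  by apply: eq_Rintegral => y _; ring.
pose N y := int w (fun x => W (x, y) ^+ 2).
have cN : continuous N := continuous_int1 _ w cW2.
have slice y : (P y - kappa * psi y) ^+ 2 <=
    N y - 2 * (S y * psi y) + int w (fun x => Q x ^+ 2) * psi y ^+ 2.
  have cWy := continuous_slice1 _ y cW.
  have := bessel w phi (fun x => W (x, y) - psi y * Q x) cphi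
    (continuous_sub _ _ cWy (continuous_scale _ _ cQ)) n1.
  rewrite int_sqr_sub//.
  have -> : int w (fun x => (W (x, y) - psi y * Q x) * phi x) = P y - kappa *
      psi y.
    rewrite -kQ /P [in RHS]mulrC -int_scale; last exact: continuous_mul.
    rewrite -int_sub; first by apply: eq_Rintegral => x _; ring.
      exact: continuous_mul.
    by apply: continuous_scale; exact: continuous_mul.
  move=> h1; apply: (le_trans h1); rewrite -/(N y) -/(S y).
  by move: (N y) (S y) (psi y) (int w (fun x => Q x ^+ 2)) => r1 r2 r3 r4; lra.
have cL : continuous (fun y => (P y - kappa * psi y) ^+ 2).
  by apply: continuous_sqr; apply: continuous_sub => //; exact:
      continuous_scale.
have cSp : continuous (fun y => S y * psi y) by exact: continuous_mul.
have cpp : continuous (fun y => psi y ^+ 2) by exact: continuous_sqr.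
have cNS : continuous (fun y => N y - 2 * (S y * psi y)).
  by apply: continuous_sub => //; exact: continuous_scale.
have cR : continuous (fun y => N y - 2 * (S y * psi y) + int w
    (fun x => Q x ^+ 2) * psi y ^+ 2).
  by apply: continuous_add => //; exact: continuous_scale.
have := le_int h _ _ cL cR slice.
rewrite int_sqr_sub// kP n2 int_add//; last exact: continuous_scale.
rewrite int_sub//; last exact: continuous_scale.
rewrite !int_scale// SQ n2 (box_fubini21 (fun z => W z ^+ 2))//.
rewrite -/(int h N).
move: (int h N) (int h (fun y => P y ^+ 2)) (int w (fun x => Q x ^+ 2)) =>
    r1 r2 r3; lra.
Qed.

(** The interval inequality is integrated along the two families of lines, and
    the projections that appear are combined by [bessel_product]. *)
Lemma box_gap w h beta mu1 mu2 phi phi' psi psi' (W Ws Wt : R * R -> R) :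
  0 < w -> 0 < h ->
  interval_mode w beta mu1 phi phi' -> int w (fun x => phi x ^+ 2) = 1 ->
      phi (w / 2) != 0 ->
  interval_mode h beta mu2 psi psi' -> int h (fun y => psi y ^+ 2) = 1 ->
      psi (h / 2) != 0 ->
  let nu1 := mu_odd (beta * (w / 2)) / (w / 2) ^+ 2 in
  let nu2 := mu_odd (beta * (h / 2)) / (h / 2) ^+ 2 in
  forall d, 0 <= d -> mu1 + d <= nu1 -> mu2 + d <= nu2 ->
  continuous W -> continuous Ws -> continuous Wt ->
  (forall x y : R, is_derive x 1 (fun x : R => W (x, y)) (Ws (x, y))) ->
  (forall x y : R, is_derive y 1 (fun y : R => W (x, y)) (Wt (x, y))) ->
  (mu1 + mu2 + d) * \int[leb2]_(z in box w h) (W z ^+ 2) -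
  d * (\int[leb2]_(z in box w h) (W z * (phi z.1 * psi z.2))) ^+ 2 <=
  \int[leb2]_(z in box w h) (Ws z ^+ 2 + Wt z ^+ 2) +
  beta * (int h (fun y => W (0, y) ^+ 2 + W (w, y) ^+ 2) +
          int w (fun x => W (x, 0) ^+ 2 + W (x, h) ^+ 2)).
Proof.
move=> w0 h0 mphi n1 p1 mpsi n2 p2 nu1 nu2 d d0 dn1 dn2 cW cWs cWt dWs dWt.
have cphi := derive_everywhere_continuous (im_derive _ _ _ _ _ mphi).
have cpsi := derive_everywhere_continuous (im_derive _ _ _ _ _ mpsi).
have sq (T : topologicalType) (f : T -> R) : continuous f ->
    continuous (fun z => f z ^+ 2).
  by move=> cf; exact: continuous_mul.
have gap (a m : R) (f f' u u' : R -> R) (nu : R) : 0 < a ->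
    interval_mode a beta m f f' -> int a (fun x => f x ^+ 2) = 1 ->
    f (a / 2) != 0 -> nu = mu_odd (beta * (a / 2)) / (a / 2) ^+ 2 ->
        m + d <= nu ->
    (forall x : R, is_derive x 1 u (u' x)) -> continuous u' ->
    (m + d) * int a (fun x => u x ^+ 2) - d * (int a (fun x => u x * f x)) ^+ 2
        <=
    int a (fun x => u' x ^+ 2) + beta * (u 0 ^+ 2 + u a ^+ 2).
  move=> a0 mf nf fa nuE mdn du cu'.
  have mn : m <= nu by lra.
  have cf := derive_everywhere_continuous (im_derive _ _ _ _ _ mf).
  have cu := derive_everywhere_continuous du.
  have B := bessel a f u cf cu nf.
  rewrite nuE in mn mdn; have /= :=
      interval_gap a beta m f f' u u' a0 mf nf fa mn du cu'.
  rewrite /robin_form -!expr2 -nuE in mdn *; move: mdn B.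
  have -> : int a (fun x => u' x * u' x) = int a (fun x => u' x ^+ 2) by [].
  set N := int a (fun x => u x ^+ 2); set P := int a (fun x => u x * f x) =>
      mdn B; nra.
pose P y := int w (fun x => W (x, y) * phi x).
pose Q x := int h (fun y => W (x, y) * psi y).
have cphi2 := continuous_fst_comp _ cphi; have cpsi2 :=
    continuous_snd_comp _ cpsi.
have cP : continuous P := continuous_int1 _ w (continuous_mul _ _ cW cphi2).
have cQ : continuous Q := continuous_int2 _ h (continuous_mul _ _ cW cpsi2).
have BP := bessel_product w h phi psi W cphi cpsi cW n1 n2.
have cW2 := sq _ _ cW; have cWs2 := sq _ _ cWs; have cWt2 := sq _ _ cWt.
have e1 : (mu1 + d) * \int[leb2]_(z in box w h) (W z ^+ 2) - d * int h
    (fun y => P y ^+ 2) <=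
    \int[leb2]_(z in box w h) (Ws z ^+ 2) + beta * int h
        (fun y => W (0, y) ^+ 2 + W (w, y) ^+ 2).
  rewrite !box_fubini21//.
  have c1 := continuous_int1 _ w cW2; have c2 := continuous_int1 _ w cWs2.
  have c3 : continuous (fun y => W (0, y) ^+ 2 + W (w, y) ^+ 2).
    by apply: continuous_add; apply: sq; exact: continuous_slice2.
  rewrite -!int_scale//; last exact: sq.
  rewrite -int_sub//; [|exact: continuous_scale|by apply: continuous_scale;
      exact: sq].
  rewrite -int_add//; last exact: continuous_scale.
  apply: le_int => [||y].
  - by apply: continuous_sub; apply: continuous_scale => //; exact: sq.
  - by apply: continuous_add => //; exact: continuous_scale.
  - by apply: (gap w mu1 phi phi' (fun x => W (x, y)) (fun x => Ws (x, y)) nu1)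
      => //; exact: continuous_slice1.
have e2 : (mu2 + d) * \int[leb2]_(z in box w h) (W z ^+ 2) - d * int w
    (fun x => Q x ^+ 2) <=
    \int[leb2]_(z in box w h) (Wt z ^+ 2) + beta * int w
        (fun x => W (x, 0) ^+ 2 + W (x, h) ^+ 2).
  rewrite !box_fubini12//.
  have c1 := continuous_int2 _ h cW2; have c2 := continuous_int2 _ h cWt2.
  have c3 : continuous (fun x => W (x, 0) ^+ 2 + W (x, h) ^+ 2).
    by apply: continuous_add; apply: sq; exact: continuous_slice1.
  rewrite -!int_scale//; last exact: sq.
  rewrite -int_sub//; [|exact: continuous_scale|by apply: continuous_scale;
      exact: sq].
  rewrite -int_add//; last exact: continuous_scale.
  apply: le_int => [||x].
  - by apply: continuous_sub; apply: continuous_scale => //; exact: sq.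
  - by apply: continuous_add => //; exact: continuous_scale.
  - by apply: (gap h mu2 psi psi' (fun y => W (x, y)) (fun y => Wt (x, y)) nu2)
      => //; exact: continuous_slice2.
rewrite RintegralD; [|exact: measurable_box|exact: box_integrable|exact:
    box_integrable].
move: e1 e2 BP; rewrite -/(int h (fun y => P y ^+ 2))
    -/(int w (fun x => Q x ^+ 2)).
set M := \int[leb2]_(z in box w h) (W z ^+ 2); set K :=
    \int[leb2]_(z in box w h) (W z * (phi z.1 * psi z.2)).
set PP := int h (fun y => P y ^+ 2); set QQ := int w (fun x => Q x ^+ 2) =>
    e1 e2 BP.
have : d * (PP + QQ) <= d * (M + K ^+ 2) by rewrite ler_wpM2l.
lra.
Qed.

End BoxGap.

(** * Rectangles in the plane *)

Section Frame.
Context {R : realType}.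
Local Notation leb := (@lebesgue_measure R).
Local Notation leb2 := (leb \x leb)%E.
Local Notation plane := (measurableTypeR R * measurableTypeR R)%type.
Local Notation int a g := (\int[leb]_(x in `[0, a]) g x).
Variable Q : rectangle R.
Implicit Types (f g v : R * R -> R).
Let c := cos (angle Q).
Let s := sin (angle Q).
Let cs : c ^+ 2 + s ^+ 2 = 1. Proof. exact: cos2Dsin2. Qed.

Definition to_plane (z : R * R) : R * R := frame Q z.1 z.2.

Definition of_plane (z : R * R) : R * R :=
  (cos (angle Q) * (z.1 - (corner Q).1) + sin (angle Q) * (z.2 - (corner Q).2),
   - sin (angle Q) * (z.1 - (corner Q).1) + cos (angle Q) *
       (z.2 - (corner Q).2)).

Lemma to_planeK : cancel to_plane of_plane.
Proof.
move=> [x y]; rewrite /to_plane /of_plane /frame /= -/c -/s; congr pair.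
  by rewrite -[RHS]mul1r -cs; ring.
by rewrite -[RHS]mul1r -cs; ring.
Qed.

Lemma of_planeK : cancel of_plane to_plane.
Proof.
move=> [x y]; rewrite /to_plane /of_plane /frame /= -/c -/s; congr pair.
  transitivity ((corner Q).1 + (c ^+ 2 + s ^+ 2) * (x - (corner Q).1));
      first by ring.
  by rewrite cs; ring.
transitivity ((corner Q).2 + (c ^+ 2 + s ^+ 2) * (y - (corner Q).2));
    first by ring.
by rewrite cs; ring.
Qed.

Lemma preserving_to_plane : preserving (to_plane : plane -> plane).
Proof.
have := preserving_comp _ _ (preserving_translation (corner Q).1 (corner Q).2)
    (preserving_rotation c s cs).
congr preserving; apply/funext => -[x y];
    rewrite /rotation /to_plane /frame /= -/c -/s.
by congr pair; ring.
Qed.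

Lemma preserving_of_plane : preserving (of_plane : plane -> plane).
Proof.
have cs' : c ^+ 2 + (- s) ^+ 2 = 1 by rewrite sqrrN.
have := preserving_comp _ _ (preserving_rotation c (- s) cs')
    (preserving_translation (- (corner Q).1) (- (corner Q).2)).
congr preserving; apply/funext => -[x y];
    rewrite /rotation /of_plane /= -/c -/s.
by congr pair; ring.
Qed.

Lemma domainE : domain Q = of_plane @^-1` box (width Q) (height Q).
Proof.
apply/seteqP; split => z.
  by move=> [[x y] xy <-]; rewrite /= -[frame _ _ _]/(to_plane (x, y))
      to_planeK.
move=> /= zb; exists (of_plane z) => //; exact: of_planeK.
Qed.

Lemma preimage_domain : to_plane @^-1` domain Q = box (width Q) (height Q).
Proof. by rewrite domainE -comp_preimage; apply/seteqP; split => z /=;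
    rewrite to_planeK. Qed.

Lemma measurable_domain : measurable (domain Q : set plane).
Proof.
rewrite domainE -[X in measurable X]setTI; case: preserving_of_plane => + _;
    apply => //.
exact: measurable_box.
Qed.

Lemma domain_measure : leb2 (domain Q : set plane) = leb2
    (box (width Q) (height Q) : set plane).
Proof.
case: preserving_to_plane => _ <-; first by rewrite preimage_domain.
exact: measurable_domain.
Qed.

Lemma continuous_to_plane : continuous to_plane.
Proof.
have h a b d : continuous (fun z : R * R => a + z.1 * b + z.2 * d).
  by move=> z; apply: cvgD; [apply: cvgD; [exact: cvg_cst|]|]; apply: cvgM;
    [exact: cvg_fst|exact: cvg_cst|exact: cvg_snd|exact: cvg_cst].
have -> : to_plane = fun z : R * R =>
    ((corner Q).1 + z.1 * c + z.2 * - s, (corner Q).2 + z.1 * s + z.2 * c).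
  by apply/funext => z; rewrite /to_plane /frame -/c -/s; congr pair; ring.
by apply: continuous_pair; exact: h.
Qed.

Lemma continuous_comp_to_plane f : continuous f -> continuous (f \o to_plane).
Proof.
by move=> cf z; apply: continuous_comp; [exact: continuous_to_plane|exact: cf].
Qed.

Lemma domain_integrable f : continuous f ->
    leb2.-integrable (domain Q : set plane) (EFin \o f).
Proof.
move=> cf; apply: measurable_bounded_integrable.
- exact: measurable_domain.
- by move: (box_lt_pinfty (width Q) (height Q)); rewrite -domain_measure.
- by apply: measurable_funTS; exact: continuous_measurable_plane.
- have [M hM] := continuous_bounded_rectangle (f \o to_plane) 0 (width Q) 0
    (height Q) (continuous_comp_to_plane _ cf).
  exists M; split; first exact: num_real.
  move=> M' MM' z [[x y] [/=]]; rewrite !in_itv /= =>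
      /andP[x0 xw] /andP[y0 yh] <-.
  by apply: le_trans (ltW MM'); apply: hM; rewrite !ltW.
Qed.

Lemma domain_integral f : continuous f ->
  \int[leb2]_(z in domain Q) f z = \int[leb2]_(z in box (width Q) (height Q)) f
      (to_plane z).
Proof.
move=> cf; rewrite /Rintegral; congr fine.
have [mT hT] := preserving_to_plane.
transitivity (\int[pushforward leb2 (to_plane : plane -> plane)]_(z in domain Q)
    (f z)%:E)%E.
  by apply: eq_measure_integral => A mA _; exact/esym/hT.
rewrite integral_pushforward //.
- by rewrite preimage_domain.
- by apply/measurable_realfun.measurable_EFinP; exact:
    continuous_measurable_plane.
- by rewrite preimage_domain; apply: (box_integrable (f \o to_plane)); exact:
    continuous_comp_to_plane.
- exact: measurable_domain.
Qed.

Lemma boundary_integralE f : boundary_integral Q f =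
  int (width Q) (fun x => f (to_plane (x, 0))) + int (width Q)
      (fun x => f (to_plane (x, height Q))) +
  (int (height Q) (fun y => f (to_plane (0, y))) + int (height Q)
      (fun y => f (to_plane (width Q, y)))).
Proof.
transitivity (\sum_(i : bool * bool)
    (fun i j => \int[leb]_(x in `[0, side_length Q (i, j)]) f
        (side_param Q (i, j) x)) i.1 i.2).
  by apply: eq_bigr => -[].
rewrite -(pair_bigA _ (fun i j =>
    \int[leb]_(x in `[0, side_length Q (i, j)]) f (side_param Q (i, j) x))).
rewrite !big_bool /side_length /side_param /=.
by rewrite addrC; congr (_ + _); rewrite addrC.
Qed.

End Frame.

Section C1functions.
Context {R : realType}.
Implicit Types (v f g : R * R -> R).

Lemma derive_line v (p d : R * R) (t : R) : differentiable v (p + t *: d) ->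
  is_derive t 1 (fun r : R => v (p + r *: d)) ('D_d v (p + t *: d)).
Proof.
move=> dv; have dvd : derivable v (p + t *: d) d by exact: diff_derivable.
have E : (fun h : R => h^-1 *: (((fun r : R => v (p + r *: d)) \o shift t)
    (h *: (1 : R)) - v (p + t *: d))) =
  (fun h : R => h^-1 *: ((v \o shift (p + t *: d)) (h *: d) - v (p + t *: d))).
  apply/funext => h /=; congr (_ *: (v _ - _)).
  have -> : h *: (1 : R) = h by exact: mulr1.
  by rewrite scalerDl addrCA.
by split; rewrite /derivable /derive E.
Qed.

Lemma derive_direction v (x : R * R) a b : differentiable v x ->
  'D_((a, b) : R * R) v x = a * partial1 v x + b * partial2 v x.
Proof.
move=> dv; rewrite /partial1 /partial2 !deriveE//.
have -> : ((a, b) : R * R) = a *: ((1, 0) : R * R) + b *: ((0, 1) : R * R).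
  apply: injective_projections => /=.
    by transitivity (a * 1 + b * 0 : R); [rewrite mulr1 mulr0 addr0|].
  by transitivity (a * 0 + b * 1 : R); [rewrite mulr1 mulr0 add0r|].
by rewrite linearD !linearZ.
Qed.

End C1functions.

(** * Functions of class C1 on a rectangle *)

Section C1.
Context {R : realType}.
Local Notation leb := (@lebesgue_measure R).
Local Notation leb2 := (leb \x leb)%E.
Local Notation plane := (measurableTypeR R * measurableTypeR R)%type.
Local Notation int a g := (\int[leb]_(x in `[0, a]) g x).
Implicit Types (u v f g : R * R -> R) (Q : rectangle R).

Lemma C1_continuous {v} : is_C1 v -> continuous v.
Proof. by move=> [dv _ _] x; exact: differentiable_continuous. Qed.

Lemma C1_mul u v : is_C1 u -> is_C1 v ->
  [/\ is_C1 (fun z => u z * v z),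
      (forall z, partial1 (fun z => u z * v z) z = u z * partial1 v z + partial1
          u z * v z) &
      (forall z, partial2 (fun z => u z * v z) z = u z * partial2 v z + partial2
          u z * v z)].
Proof.
move=> cu cv; have [du c1u c2u] := cu; have [dv c1v c2v] := cv.
have cuc := C1_continuous cu; have cvc := C1_continuous cv.
have D d z : 'D_d (fun z => u z * v z) z = u z * 'D_d v z + 'D_d u z * v z.
  have := @deriveM _ _ u v z d (diff_derivable (du z)) (diff_derivable (dv z)).
  by rewrite /GRing.scale /= (mulrC (v z)) => <-.
split; [split|exact: D|exact: D].
- by move=> z; exact: differentiableM.
- rewrite (_ : partial1 _ = fun z => u z * partial1 v z + partial1 u z * v z);
    last by apply/funext => z; exact: D.
  exact: (continuous_add _ _ (continuous_mul _ _ cuc c1v)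
      (continuous_mul _ _ c1u cvc)).
- rewrite (_ : partial2 _ = fun z => u z * partial2 v z + partial2 u z * v z);
    last by apply/funext => z; exact: D.
  exact: (continuous_add _ _ (continuous_mul _ _ cuc c2v)
      (continuous_mul _ _ c2u cvc)).
Qed.

Lemma C1_ridge (phi phi' : R -> R) (a b e : R) :
    (forall x : R, is_derive x 1 phi (phi' x)) -> continuous phi' ->
  is_C1 (fun z : R * R => phi (a * z.1 + b * z.2 + e)).
Proof.
move=> dphi cphi'; set f := fun z : R * R => phi (a * z.1 + b * z.2 + e).
have dl z : differentiable (fun z : R * R => a * z.1 + b * z.2 + e) z.
  have d1 : differentiable (@fst R R) z by apply: linear_differentiable => t;
      exact: cvg_fst.
  have d2 : differentiable (@snd R R) z by apply: linear_differentiable => t;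
      exact: cvg_snd.
  apply: differentiableD; last exact: differentiable_cst.
  apply: differentiableD; apply: differentiableM => //; exact:
      differentiable_cst.
have df z : differentiable f z.
  apply: (@differentiable_comp _ _ _ _ (fun z : R * R => a * z.1 + b * z.2 + e)
      phi) => //.
  by apply/derivable1_diffP; case: (dphi (a * z.1 + b * z.2 + e)).
have D d1 d2 z : 'D_((d1, d2) : R * R) f z = (a * d1 + b * d2) * phi'
    (a * z.1 + b * z.2 + e).
  have h0 : differentiable f (z + 0 *: ((d1, d2) : R * R)) by exact: df.
  have := derive_line f z (d1, d2) 0 h0; rewrite scale0r addr0 => h1.
  have h2 : is_derive (0 : R) 1 (fun r : R => f (z + r *: ((d1, d2) : R * R)))
      ((a * d1 + b * d2) * phi' (a * z.1 + b * z.2 + e)).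
    have h3 : is_derive ((a * d1 + b * d2) * 0 + (a * z.1 + b * z.2 + e)) 1 phi
        (phi' (a * z.1 + b * z.2 + e)).
      by rewrite mulr0 add0r; exact: dphi.
    apply: is_derive_ext (is_derive_affine (a * d1 + b * d2)
        (a * z.1 + b * z.2 + e) h3) => // r.
    by rewrite /f; congr phi; rewrite /= /GRing.scale /=; ring.
  by rewrite -(@derive_val _ _ _ _ _ _ _ h1) (@derive_val _ _ _ _ _ _ _ h2).
have cl : continuous (fun z : R * R => phi' (a * z.1 + b * z.2 + e)).
  move=> z; apply: (@continuous_comp _ _ _
      (fun z : R * R => a * z.1 + b * z.2 + e) phi'); last exact: cphi'.
  exact: differentiable_continuous.
split => //.
- rewrite (_ : partial1 _ = fun z =>
    (a * 1 + b * 0) * phi' (a * z.1 + b * z.2 + e)); last by apply/funext => z;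
    exact: D.
  by apply: continuous_mul => //; exact: cst_continuous.
- rewrite (_ : partial2 _ = fun z =>
    (a * 0 + b * 1) * phi' (a * z.1 + b * z.2 + e)); last by apply/funext => z;
    exact: D.
  by apply: continuous_mul => //; exact: cst_continuous.
Qed.

(** The function that reads [phi x * psi y] in the frame of the rectangle. *)
Definition product_fun Q (phi psi : R -> R) (z : R * R) : R :=
  phi (of_plane Q z).1 * psi (of_plane Q z).2.

Lemma C1_product_fun Q (phi phi' psi psi' : R -> R) :
  (forall x : R, is_derive x 1 phi (phi' x)) -> continuous phi' ->
  (forall x : R, is_derive x 1 psi (psi' x)) -> continuous psi' ->
  is_C1 (product_fun Q phi psi).
Proof.
move=> dphi cphi dpsi cpsi; rewrite /product_fun /of_plane /=.
set c := cos _; set s := sin _; set X := (corner Q).1; set Y := (corner Q).2.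
have [h _ _] := C1_mul _ _ (C1_ridge phi phi' c s (- c * X - s * Y) dphi cphi)
  (C1_ridge psi psi' (- s) c (s * X - c * Y) dpsi cpsi).
congr is_C1: h; apply/funext => z /=; congr (phi _ * psi _); ring.
Qed.

Lemma slice1_is_derive Q v (x y : R) : is_C1 v ->
    is_derive x 1 (fun x : R => v (to_plane Q (x, y)))
  (cos (angle Q) * partial1 v (to_plane Q (x, y)) + sin (angle Q) * partial2 v
      (to_plane Q (x, y))).
Proof.
move=> [dv _ _].
have E r : to_plane Q (0, y) + r *:
    ((cos (angle Q), sin (angle Q)) : R * R) = to_plane Q (r, y).
  by apply: injective_projections; rewrite /= /frame /GRing.scale /=; ring.
have := derive_line v (to_plane Q (0, y)) (cos (angle Q), sin (angle Q)) x
    (dv _).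
by rewrite E derive_direction//; apply: is_derive_ext => // r; rewrite E.
Qed.

Lemma slice2_is_derive Q v (x y : R) : is_C1 v ->
    is_derive y 1 (fun y : R => v (to_plane Q (x, y)))
  (- sin (angle Q) * partial1 v (to_plane Q (x, y)) + cos (angle Q) * partial2 v
      (to_plane Q (x, y))).
Proof.
move=> [dv _ _].
have E r : to_plane Q (x, 0) + r *:
    ((- sin (angle Q), cos (angle Q)) : R * R) = to_plane Q (x, r).
  by apply: injective_projections; rewrite /= /frame /GRing.scale /=; ring.
have := derive_line v (to_plane Q (x, 0)) (- sin (angle Q), cos (angle Q)) y
    (dv _).
by rewrite E derive_direction//; apply: is_derive_ext => // r; rewrite E.
Qed.

End C1.

Section C1H1.
Context {R : realType}.
Local Notation leb := (@lebesgue_measure R).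
Local Notation leb2 := (leb \x leb)%E.
Local Notation plane := (measurableTypeR R * measurableTypeR R)%type.
Local Notation int a g := (\int[leb]_(x in `[0, a]) g x).
Implicit Types (u v f g : R * R -> R) (Q : rectangle R).

(** The derivatives along the two sides of the rectangle. *)
Definition dframe1 Q v (z : R * R) : R :=
  cos (angle Q) * partial1 v (to_plane Q z) + sin (angle Q) * partial2 v
      (to_plane Q z).
Definition dframe2 Q v (z : R * R) : R :=
  - sin (angle Q) * partial1 v (to_plane Q z) + cos (angle Q) * partial2 v
      (to_plane Q z).

Lemma dframe_continuous Q v : is_C1 v ->
  [/\ continuous (v \o to_plane Q),
      continuous (dframe1 Q v) & continuous (dframe2 Q v)].
Proof.
move=> cv; have [_ c1 c2] := cv.
have c1' := continuous_comp_to_plane Q _ c1; have c2' :=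
    continuous_comp_to_plane Q _ c2.
split; first exact: continuous_comp_to_plane (C1_continuous cv).
  exact: (continuous_add _ _ (continuous_scale _ _ c1')
      (continuous_scale _ _ c2')).
exact: (continuous_add _ _ (continuous_scale _ _ c1')
    (continuous_scale _ _ c2')).
Qed.

Lemma dframe_partial Q v z :
  partial1 v (to_plane Q z) = cos (angle Q) * dframe1 Q v z - sin (angle Q) *
      dframe2 Q v z /\
  partial2 v (to_plane Q z) = sin (angle Q) * dframe1 Q v z + cos (angle Q) *
      dframe2 Q v z.
Proof.
have cs := cos2Dsin2 (angle Q); rewrite /dframe1 /dframe2.
by split; rewrite -[LHS]mul1r -cs; ring.
Qed.

Lemma dframe_gradient Q v z :
  partial1 v (to_plane Q z) ^+ 2 + partial2 v (to_plane Q z) ^+ 2 = dframe1 Q v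
      z ^+ 2 + dframe2 Q v z ^+ 2.
Proof.
have cs := cos2Dsin2 (angle Q); rewrite /dframe1 /dframe2.
by rewrite -[LHS]mul1r -cs; ring.
Qed.

Lemma box_scale2 w h a b f g : continuous f -> continuous g ->
  \int[leb2]_(z in box w h) (a * f z + b * g z) =
  a * \int[leb2]_(z in box w h) f z + b * \int[leb2]_(z in box w h) g z.
Proof.
move=> cf cg.
have cs (k : R) (t : R * R -> R) : continuous t ->
    continuous (fun z => k * t z).
  by move=> ct; apply: continuous_mul => //; exact: cst_continuous.
rewrite RintegralD ?RintegralZl//;
  do ?[exact: measurable_box | by apply: box_integrable;
      first [exact: cs|done]].
Qed.

(** In the coordinates of the frame both partial derivatives are combinations
    of derivatives along the sides, whose integrals along lines vanish. *)
Lemma integral_partial_eq0 Q g : is_C1 g ->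
  (forall y, g (to_plane Q (0, y)) = 0 /\ g (to_plane Q (width Q, y)) = 0) ->
  (forall x, g (to_plane Q (x, 0)) = 0 /\ g (to_plane Q (x, height Q)) = 0) ->
  \int[leb2]_(z in domain Q) partial1 g z = 0 /\ \int[leb2]_(z in domain Q)
      partial2 g z = 0.
Proof.
move=> cg g1 g2; have [cW c1 c2] := dframe_continuous Q g cg; have [_ p1 p2] :=
    cg.
have w0 := width_gt0 Q; have h0 := height_gt0 Q.
have int0 a : int a (fun=> 0) = 0 by rewrite Rintegral_cst// mul0r.
have i1 : \int[leb2]_(z in box (width Q) (height Q)) dframe1 Q g z = 0.
  rewrite box_fubini21// -[RHS](int0 (height Q)); apply: eq_Rintegral => y _.
  rewrite (FTC _ (fun x => g (to_plane Q (x, y))) _ w0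
      (continuous_slice1 _ y c1)
    (fun x _ => slice1_is_derive Q g x y cg)).
  by have [-> ->] := g1 y; rewrite subrr.
have i2 : \int[leb2]_(z in box (width Q) (height Q)) dframe2 Q g z = 0.
  rewrite box_fubini12// -[RHS](int0 (width Q)); apply: eq_Rintegral => x _.
  rewrite (FTC _ (fun y => g (to_plane Q (x, y))) _ h0
      (continuous_slice2 _ x c2)
    (fun y _ => slice2_is_derive Q g x y cg)).
  by have [-> ->] := g2 x; rewrite subrr.
split; rewrite domain_integral//.
- transitivity (\int[leb2]_(z in box (width Q) (height Q))
      (cos (angle Q) * dframe1 Q g z + (- sin (angle Q)) * dframe2 Q g z)).
    by apply: eq_Rintegral => z _; rewrite (dframe_partial Q g z).1 mulNr.
  by rewrite box_scale2// i1 i2 !mulr0 addr0.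
- transitivity (\int[leb2]_(z in box (width Q) (height Q))
      (sin (angle Q) * dframe1 Q g z + cos (angle Q) * dframe2 Q g z)).
    by apply: eq_Rintegral => z _; rewrite (dframe_partial Q g z).2.
  by rewrite box_scale2// i1 i2 !mulr0 addr0.
Qed.

(** The product of u with a test function is of class C1 and vanishes on the
    sides, so the integrals of its derivatives vanish. *)
Lemma C1_weak_partial Q u : is_C1 u ->
  weak_partial (@partial1 R) Q u (partial1 u) /\ weak_partial (@partial2 R) Q u
      (partial2 u).
Proof.
move=> cu.
have bdry phi (K : set (R * R)) x y : K `<=` domain Q ->
    (forall x, ~ K x -> phi x = 0) ->
    ~ (box (width Q) (height Q)) (x, y) ->
        u (to_plane Q (x, y)) * phi (to_plane Q (x, y)) = 0.
  move=> KQ K0 xy; rewrite K0 ?mulr0// => /KQ h; apply: xy.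
  by rewrite -preimage_domain.
have ibp phi : test_function Q phi ->
   \int[leb2]_(z in domain Q) partial1 (fun z => u z * phi z) z = 0 /\
   \int[leb2]_(z in domain Q) partial2 (fun z => u z * phi z) z = 0.
  move=> [cphi [K [_ KQ K0]]]; have [cg _ _] := C1_mul u phi cu cphi.
  apply: (integral_partial_eq0 Q _ cg) => [y|x]; split; apply: (bdry phi K) =>
      // -[] /=;
    rewrite !in_itv /= ?ltxx ?andbF//.
have sum0 (p q : R * R -> R) : continuous p -> continuous q ->
    \int[leb2]_(z in domain Q) (p z + q z) = 0 ->
    \int[leb2]_(z in domain Q) p z = - \int[leb2]_(z in domain Q) q z.
  move=> cp cq; rewrite RintegralD;
      [|exact: measurable_domain|exact: domain_integrable|exact:
      domain_integrable].
  by move/eqP; rewrite addr_eq0 => /eqP.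
have [_ c1u c2u] := cu; have cuc := C1_continuous cu.
split => phi tphi; have [i1 i2] := ibp phi tphi; have [cphi _] := tphi;
  have [_ c1p c2p] := cphi; have cpc := C1_continuous cphi; have [_ e1 e2] :=
      C1_mul u phi cu cphi.
- apply: (sum0 _ _ (continuous_mul _ _ cuc c1p) (continuous_mul _ _ c1u cpc)).
  by rewrite -[RHS]i1; apply: eq_Rintegral => z _; rewrite e1.
- apply: (sum0 _ _ (continuous_mul _ _ cuc c2p) (continuous_mul _ _ c2u cpc)).
  by rewrite -[RHS]i2; apply: eq_Rintegral => z _; rewrite e2.
Qed.

Definition h1fun_of v : h1fun R :=
  {| fct := v; dx1 := partial1 v; dx2 := partial2 v; tr := v |}.

Lemma continuous_in_L2 Q v : continuous v -> in_L2 Q v.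
Proof.
move=> cv; split; first by apply: measurable_funTS; exact:
    continuous_measurable_plane.
by apply: (domain_integrable Q (fun z => v z ^+ 2)); exact: continuous_mul.
Qed.

Lemma side_paramE Q i s : side_param Q i s =
  to_plane Q (if i.1 then (if i.2 then width Q else 0, s) else
      (s, if i.2 then height Q else 0)).
Proof. by rewrite /side_param /to_plane; case: i => [] [] []. Qed.

Lemma continuous_side_param Q i : continuous (side_param Q i).
Proof.
have -> : side_param Q i = fun s =>
    to_plane Q (if i.1 then (if i.2 then width Q else 0, s) else
    (s, if i.2 then height Q else 0)).
  by apply/funext => s; exact: side_paramE.
move=> s; apply: (@continuous_comp _ _ _
    (fun s : R => (if i.1 then (if i.2 then width Q else 0, s)
  else (s, if i.2 then height Q else 0)) : R * R) (to_plane Q)); last exact: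
      continuous_to_plane.
by case: i.1; apply: continuous_pair => t; (exact: cvg_cst || exact: cvg_id).
Qed.

Lemma continuous_side Q i v : continuous v -> continuous (v \o side_param Q i).
Proof. by move=> cv s; apply: continuous_comp;
    [exact: continuous_side_param|exact: cv]. Qed.

Lemma C1_in_H1 Q v : is_C1 v -> in_H1 Q (h1fun_of v).
Proof.
move=> cv; have [_ c1 c2] := cv; have cvc := C1_continuous cv; have [w1 w2] :=
    C1_weak_partial Q v cv.
split => //=.
- by split; exact: continuous_in_L2.
- move=> i; split.
    by apply: measurable_funTS; apply:
        measurable_realfun.continuous_measurable_fun; exact: continuous_side.
  apply: (@continuous_integrable_itv R (fun s => v (side_param Q i s) ^+ 2)).
  by apply: continuous_sqr; exact: continuous_side.
- exists (fun=> v) => /=.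
  have d0 (u : R * R -> R) : L2_dist2 Q u u = 0%E.
    by rewrite /L2_dist2; under eq_integral do rewrite subrr expr0n /=; exact:
        integral0.
  have b0 (u : R * R -> R) : L2_boundary_dist2 Q u u = 0%E.
    rewrite /L2_boundary_dist2 big1// => i _.
    by under eq_integral do rewrite subrr expr0n /=; exact: integral0.
  by split => //; rewrite ?d0 ?b0; exact: cvg_cst.
Qed.

End C1H1.

(** * Square-integrable functions *)

Section SquareIntegrable.
Context {d} {T : measurableType d} {R : realType}
    {mu : {measure set T -> \bar R}} {D : set T}.
Hypothesis mD : measurable D.
Implicit Types (f g u : T -> R) (v : nat -> T -> R).

Definition sq_integrable f : Prop :=
  measurable_fun D f /\ mu.-integrable D (fun x => (f x ^+ 2)%:E).

Lemma sq_integrable_mul f g : sq_integrable f -> sq_integrable g ->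
  mu.-integrable D (fun x => (f x * g x)%:E).
Proof.
move=> [mf intf] [mg intg].
apply: (@le_integrable _ _ _ mu D mD _
    (fun x => (f x ^+ 2)%:E + (g x ^+ 2)%:E)%E).
- by apply/measurable_realfun.measurable_EFinP; exact:
    measurable_realfun.measurable_funM.
- move=> x _; rewrite -EFinD !abse_EFin lee_fin
    (ger0_norm (_ : 0 <= f x ^+ 2 + g x ^+ 2)); last first.
    by rewrite addr_ge0 ?sqr_ge0.
  rewrite normrM -(real_normK (num_real (f x))) -(real_normK (num_real (g x))).
  have := sqr_ge0 (`|f x| - `|g x|); have := sqr_ge0 (`|f x| + `|g x|); nra.
- exact: integrableD.
Qed.

Lemma sq_integrable_lin a b f g : sq_integrable f -> sq_integrable g ->
  sq_integrable (fun x => a * f x + b * g x).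
Proof.
move=> sf sg; have [mf intf] := sf; have [mg intg] := sg; split.
  by apply: measurable_realfun.measurable_funD; apply:
      measurable_realfun.measurable_funM => //; exact: measurable_cst.
have -> : (fun x => ((a * f x + b * g x) ^+ 2)%:E) =
  (fun x => (a ^+ 2)%:E * (f x ^+ 2)%:E +
      ((2 * a * b)%:E * (f x * g x)%:E + (b ^+ 2)%:E * (g x ^+ 2)%:E))%E.
  by apply/funext => x; rewrite -!EFinM -!EFinD; congr EFin; ring.
apply: integrableD => //; first exact: integrableZl.
apply: integrableD => //; apply: integrableZl => //; exact: sq_integrable_mul.
Qed.

Lemma real_integrableZ r f : mu.-integrable D (fun x => (f x)%:E) ->
  mu.-integrable D (EFin \o (fun x => r * f x)).
Proof.
move=> fi; rewrite (_ : EFin \o _ = fun x => (r%:E * (f x)%:E)%E)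
    ?integrableZl//.
Qed.

Lemma integrable_add_real f g : mu.-integrable D (fun x => (f x)%:E) ->
  mu.-integrable D (fun x => (g x)%:E) ->
      mu.-integrable D (EFin \o (fun x => f x + g x)).
Proof. by move=> fi gi; exact: (integrableD mD fi gi). Qed.

Lemma int_sq_lin a b f g : sq_integrable f -> sq_integrable g ->
  \int[mu]_(x in D) ((a * f x + b * g x) ^+ 2) =
  a ^+ 2 * \int[mu]_(x in D) (f x ^+ 2) + 2 * a * b * \int[mu]_(x in D)
      (f x * g x)
  + b ^+ 2 * \int[mu]_(x in D) (g x ^+ 2).
Proof.
move=> sf sg; have [mf intf] := sf; have [mg intg] := sg; have ifg :=
    sq_integrable_mul _ _ sf sg.
have i1 := real_integrableZ (a ^+ 2) _ intf; have i2 :=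
    real_integrableZ (2 * a * b) _ ifg.
have i3 := real_integrableZ (b ^+ 2) _ intg; have i12 :=
    integrable_add_real _ _ i1 i2.
rewrite -!RintegralZl// -(RintegralD mD i1 i2) -(RintegralD mD i12 i3).
by apply: eq_Rintegral => x _; ring.
Qed.

Lemma int_mul_lin a b f g u : sq_integrable f -> sq_integrable g ->
    sq_integrable u ->
  \int[mu]_(x in D) ((a * f x + b * g x) * u x) =
  a * \int[mu]_(x in D) (f x * u x) + b * \int[mu]_(x in D) (g x * u x).
Proof.
move=> sf sg su; have ifu := sq_integrable_mul _ _ sf su; have igu :=
    sq_integrable_mul _ _ sg su.
rewrite -!RintegralZl// -!RintegralD//; do ?[exact: real_integrableZ].
by apply: eq_Rintegral => x _; ring.
Qed.

Lemma int_sq_ge0 f : 0 <= \int[mu]_(x in D) (f x ^+ 2).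
Proof. by apply: Rintegral_ge0 => x _; exact: sqr_ge0. Qed.

Definition L2_limit v f := \int[mu]_(x in D) ((v n x - f x) ^+ 2) @[n --> \oo]
    --> (0 : R).

(** Expand g = f + (g - f) and bound the cross term by Young's inequality. *)
Lemma young_sub f g t : sq_integrable f -> sq_integrable g -> 0 < t ->
  let e := \int[mu]_(x in D) ((g x - f x) ^+ 2) in
  `|\int[mu]_(x in D) (g x ^+ 2) - \int[mu]_(x in D) (f x ^+ 2)| <=
  t * \int[mu]_(x in D) (f x ^+ 2) + (1 + t^-1) * e.
Proof.
move=> sf sg t0 /=.
have sgf := sq_integrable_lin 1 (-1) _ _ sg sf.
set h := fun x => 1 * g x + -1 * f x in sgf.
have -> : \int[mu]_(x in D) ((g x - f x) ^+ 2) = \int[mu]_(x in D) (h x ^+ 2).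
  by apply: eq_Rintegral => x _; rewrite /h; ring.
have -> : \int[mu]_(x in D) (g x ^+ 2) = \int[mu]_(x in D)
    ((1 * f x + 1 * h x) ^+ 2).
  by apply: eq_Rintegral => x _; rewrite /h; ring.
rewrite int_sq_lin//.
have s0 : 0 < Num.sqrt t by rewrite sqrtr_gt0.
have ss : Num.sqrt t * Num.sqrt t = t by rewrite -expr2 sqr_sqrtr ?ltW.
have c2 : 2 * Num.sqrt t * (Num.sqrt t)^-1 = 2 by rewrite mulfK// gt_eqF.
have pos : 0 <= t * \int[mu]_(x in D) (f x ^+ 2) + 2 * \int[mu]_(x in D)
    (f x * h x) + t^-1 * \int[mu]_(x in D) (h x ^+ 2).
  have := int_sq_ge0 (fun x => Num.sqrt t * f x + (Num.sqrt t)^-1 * h x).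
  by rewrite int_sq_lin// c2 exprVn expr2 ss.
have neg : 0 <= t * \int[mu]_(x in D) (f x ^+ 2) - 2 * \int[mu]_(x in D)
    (f x * h x) + t^-1 * \int[mu]_(x in D) (h x ^+ 2).
  have := int_sq_ge0 (fun x => Num.sqrt t * f x + - (Num.sqrt t)^-1 * h x).
  by rewrite int_sq_lin// sqrrN mulrN c2 exprVn expr2 ss mulNr.
have h0 := int_sq_ge0 h.
by rewrite ler_norml; apply/andP; split; lra.
Qed.

Lemma L2_limit_sq v f : (forall n, sq_integrable (v n)) -> sq_integrable f ->
    L2_limit v f ->
  \int[mu]_(x in D) (v n x ^+ 2) @[n --> \oo] --> \int[mu]_(x in D) (f x ^+ 2).
Proof.
move=> sv sf vf; apply/cvgrPdist_le => e e0.
set N := \int[mu]_(x in D) (f x ^+ 2); have N0 : 0 <= N := int_sq_ge0 f.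
pose t := e / (2 * (N + 1)).
have t0 : 0 < t by rewrite divr_gt0// mulr_gt0//; lra.
have tN : t * N <= e / 2.
  have : t * (N + 1) = e / 2 by rewrite /t; field; rewrite gt_eqF//; lra.
  nra.
have k0 : 0 < 1 + t^-1 by rewrite addr_gt0 ?invr_gt0.
move/cvgrPdist_le : vf => /(_ (e / 2 / (1 + t^-1))); rewrite !divr_gt0// =>
    /(_ isT).
apply: filterS => n; rewrite sub0r normrN ger0_norm; last exact:
    (int_sq_ge0 (fun x => v n x - f x)).
rewrite ler_pdivlMr// mulrC => h; rewrite distrC.
by have /= := young_sub f (v n) t sf (sv n) t0; rewrite -/N; lra.
Qed.

Lemma L2_limit_mul v f u : (forall n, sq_integrable (v n)) -> sq_integrable f ->
    sq_integrable u -> L2_limit v f ->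
  \int[mu]_(x in D) (v n x * u x) @[n --> \oo] -->
      \int[mu]_(x in D) (f x * u x).
Proof.
(* polarization: 4 f u = (f + u)^2 - (f - u)^2 *)
move=> sv sf su vf.
have pol (g : T -> R) : sq_integrable g -> \int[mu]_(x in D) (g x * u x) =
    4^-1 * (\int[mu]_(x in D) ((1 * g x + 1 * u x) ^+ 2) - \int[mu]_(x in D)
        ((1 * g x + -1 * u x) ^+ 2)).
  by move=> sg; rewrite !int_sq_lin//; field.
rewrite pol// (_ : (fun n => \int[mu]_(x in D) (v n x * u x)) = fun n => 4^-1 *
  (\int[mu]_(x in D) ((1 * v n x + 1 * u x) ^+ 2) - \int[mu]_(x in D)
      ((1 * v n x + -1 * u x) ^+ 2))); last first.
  by apply/funext => n; exact: pol.
have lim k : \int[mu]_(x in D) ((1 * v n x + k * u x) ^+ 2) @[n --> \oo] -->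
    \int[mu]_(x in D) ((1 * f x + k * u x) ^+ 2).
  apply: (L2_limit_sq (fun n x => 1 * v n x + k * u x)) => [n||].
  - exact: sq_integrable_lin.
  - exact: sq_integrable_lin.
  - rewrite /L2_limit.
    have -> : (fun n => \int[mu]_(x in D)
        ((1 * v n x + k * u x - (1 * f x + k * u x)) ^+ 2)) =
        (fun n => \int[mu]_(x in D) ((v n x - f x) ^+ 2)).
      by apply/funext => n; apply: eq_Rintegral => x _; ring.
    exact: vf.
by apply: cvgMl_tmp; apply: cvgB; exact: lim.
Qed.

Lemma L2_limit_lin a b v w f g : (forall n, sq_integrable (v n)) ->
    (forall n, sq_integrable (w n)) ->
  sq_integrable f -> sq_integrable g -> L2_limit v f -> L2_limit w g ->
  L2_limit (fun n x => a * v n x + b * w n x) (fun x => a * f x + b * g x).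
Proof.
move=> sv sw sf sg vf wg; rewrite /L2_limit.
apply: (@squeeze_cvgr _ _ _ _ (fun=> 0)
    (fun n => 2 * a ^+ 2 * \int[mu]_(x in D) ((v n x - f x) ^+ 2)
    + 2 * b ^+ 2 * \int[mu]_(x in D) ((w n x - g x) ^+ 2))).
- apply: nearW => n; apply/andP; split; first by apply: Rintegral_ge0 => x _;
    exact: sqr_ge0.
  have s1 := sq_integrable_lin 1 (-1) _ _ (sv n) sf; have s2 :=
      sq_integrable_lin 1 (-1) _ _ (sw n) sg.
  set p := fun x => 1 * v n x + -1 * f x in s1; set q := fun x =>
      1 * w n x + -1 * g x in s2.
  have -> : \int[mu]_(x in D) ((v n x - f x) ^+ 2) = \int[mu]_(x in D)
      (p x ^+ 2).
    by apply: eq_Rintegral => x _; rewrite /p; ring.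
  have -> : \int[mu]_(x in D) ((w n x - g x) ^+ 2) = \int[mu]_(x in D)
      (q x ^+ 2).
    by apply: eq_Rintegral => x _; rewrite /q; ring.
  have -> : \int[mu]_(x in D) ((a * v n x + b * w n x - (a * f x + b * g x)) ^+
      2) =
      \int[mu]_(x in D) ((a * p x + b * q x) ^+ 2).
    by apply: eq_Rintegral => x _; rewrite /p /q; ring.
  have := int_sq_ge0 (fun x => a * p x + - b * q x); rewrite !int_sq_lin//; lra.
- exact: cvg_cst.
- rewrite -[X in _ --> X](_ : 2 * a ^+ 2 * 0 + 2 * b ^+ 2 * 0 = 0);
    last by rewrite !mulr0 addr0.
  by apply: cvgD; apply: cvgM; (exact: cvg_cst || done).
Qed.

Lemma sq_integrable_ae_eq0 f : sq_integrable f ->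
    \int[mu]_(x in D) (f x ^+ 2) = 0 ->
  {ae mu, forall x, D x -> f x = 0}.
Proof.
move=> [mf intf] f0.
have mf2 := measurable_int mu intf.
have : (\int[mu]_(x in D) `|(f x ^+ 2)%:E|)%E = 0%E.
  under eq_integral => x _ do rewrite abse_EFin ger0_norm ?sqr_ge0//.
  by rewrite -(fineK (integrable_fin_num mD intf))
      -[fine _]/(\int[mu]_(x in D) (f x ^+ 2)) f0.
move/(ae_eq_integral_abs mu mD mf2); apply: filterS => x /= h Dx.
by have [] := h Dx; move/eqP; rewrite sqrf_eq0 => /eqP.
Qed.

End SquareIntegrable.
Arguments sq_integrable {d T R} mu D f.
Arguments L2_limit {d T R} mu D v f.

(** * Approximation in H1 *)

Section H1limits.
Context {R : realType}.
Local Notation leb := (@lebesgue_measure R).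
Local Notation leb2 := (leb \x leb)%E.
Local Notation plane := (measurableTypeR R * measurableTypeR R)%type.
Local Notation int a g := (\int[leb]_(x in `[0, a]) g x).
Implicit Types (Q : rectangle R) (f g : h1fun R) (v w : nat -> R * R -> R).

Lemma cvg_finite_sum (I : finType) (F : I -> nat -> R) (l : I -> R) :
  (forall i, F i n @[n --> \oo] --> l i) -> \sum_i F i n @[n --> \oo] -->
      \sum_i l i.
Proof.
move=> Fl; rewrite (_ : (fun n => \sum_i F i n) = \sum_i F i);
    last by apply/funext => n; rewrite fct_sumE.
apply: (big_ind2 (fun (u : nat -> R) a => u n @[n --> \oo] --> a)) =>
    [|u a w b|i _]; [exact: cvg_cst|exact: cvgD|exact: Fl].
Qed.

Definition side_itv Q i : set (measurableTypeR R) := `[0, side_length Q i].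

Definition h1_square_integrable Q f : Prop :=
  [/\ in_L2 Q (fct f), in_L2 Q (dx1 f),
      in_L2 Q (dx2 f) & in_L2_boundary Q (tr f)].

(** The C1 functions that witness the trace of f, with the four convergences
    expressed by real integrals. *)
Record approximates Q f v : Prop := Approximates {
  ap_C1 : forall n, is_C1 (v n);
  ap_fct : L2_limit leb2 (domain Q) v (fct f);
  ap_dx1 : L2_limit leb2 (domain Q) (fun n => partial1 (v n)) (dx1 f);
  ap_dx2 : L2_limit leb2 (domain Q) (fun n => partial2 (v n)) (dx2 f);
  ap_tr : forall i, L2_limit leb (side_itv Q i) (fun n => v n \o side_param Q i)
      (tr f \o side_param Q i) }.

Lemma H1_approximable Q f : in_H1 Q f -> h1_square_integrable Q f /\ exists v,
    approximates Q f v.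
Proof.
move=> [[s0 s1 s2] _ _ sb [v [cv l0 l1 l2 lb]]]; split => //; exists v.
have cv0 (D : set plane) (p : nat -> R * R -> R) (q : R * R -> R) :
    (\int[leb2]_(x in D) ((p n x - q x) ^+ 2)%:E)%E @[n --> \oo] --> 0%E ->
        L2_limit leb2 D p q.
  by move=> /fine_cvg.
split => //; [exact: cv0|exact: cv0|exact: cv0|] => i.
suff : (\int[leb]_(s in side_itv Q i)
    ((v n (side_param Q i s) - tr f (side_param Q i s)) ^+ 2)%:E)%E
    @[n --> \oo] --> 0%E by move=> /fine_cvg.
apply: squeeze_cvge lb; last exact: cvg_cst.
apply: nearW => n; apply/andP; split; first by apply: integral_ge0 => s _;
    rewrite lee_fin sqr_ge0.
rewrite /L2_boundary_dist2 (bigD1 i)//= leeDl//.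
by apply: sume_ge0 => j _; apply: integral_ge0 => s _; rewrite lee_fin sqr_ge0.
Qed.

Definition lin2 (a b : R) f g : h1fun R :=
  {| fct := fun x => a * fct f x + b * fct g x;
     dx1 := fun x => a * dx1 f x + b * dx1 g x;
     dx2 := fun x => a * dx2 f x + b * dx2 g x;
     tr := fun x => a * tr f x + b * tr g x |}.

Lemma lincomb2E (c : 'rV[R]_2) (b : 'I_2 -> h1fun R) :
  lincomb c b = lin2 (c 0 ord0) (c 0 ord_max) (b ord0) (b ord_max).
Proof.
rewrite /lincomb /lin2.
have e (F : 'I_2 -> R) : \sum_(i < 2) F i = F ord0 + F ord_max.
  by rewrite big_ord_recl big_ord1; congr (_ + F _); exact: val_inj.
by congr H1fun; apply/funext => x; rewrite e.
Qed.

Lemma C1_lin a b (u w : R * R -> R) : is_C1 u -> is_C1 w ->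
  [/\ is_C1 (fun z => a * u z + b * w z),
      partial1 (fun z => a * u z + b * w z) =
          (fun z => a * partial1 u z + b * partial1 w z) &
      partial2 (fun z => a * u z + b * w z) =
          (fun z => a * partial2 u z + b * partial2 w z)].
Proof.
move=> [du c1u c2u] [dw c1w c2w].
have D d z : 'D_d (fun z => a * u z + b * w z) z = a * 'D_d u z + b * 'D_d w z.
  have du' := diff_derivable (v := d) (du z); have dw' :=
      diff_derivable (v := d) (dw z).
  have dau : derivable (a *: u) z d by exact: derivableZ.
  have dbw : derivable (b *: w) z d by exact: derivableZ.
  by have := deriveD dau dbw; rewrite !deriveZ.
have cc (p q : R * R -> R) : continuous p -> continuous q ->
    continuous (fun z => a * p z + b * q z).
  by move=> cp cq; exact: (continuous_add _ _ (continuous_scale a _ cp)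
      (continuous_scale b _ cq)).
have e1 : partial1 (fun z => a * u z + b * w z) =
    (fun z => a * partial1 u z + b * partial1 w z) by apply/funext => z; exact:
    D.
have e2 : partial2 (fun z => a * u z + b * w z) =
    (fun z => a * partial2 u z + b * partial2 w z) by apply/funext => z; exact:
    D.
split => //; split; [|by rewrite e1; exact: (cc _ _ c1u c1w)|by rewrite e2;
    exact: (cc _ _ c2u c2w)].
move=> z; apply: differentiableD; apply: differentiableM => //; exact:
    differentiable_cst.
Qed.

Lemma continuous_sq_integrable Q (u : R * R -> R) : continuous u ->
    sq_integrable leb2 (domain Q : set plane) u.
Proof. exact: continuous_in_L2. Qed.

Lemma side_sq_integrable Q i (u : R * R -> R) : continuous u ->
    sq_integrable leb (side_itv Q i) (u \o side_param Q i).
Proof.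
move=> cu; split.
  by apply: measurable_funTS; apply:
      measurable_realfun.continuous_measurable_fun; exact: continuous_side.
apply: (@continuous_integrable_itv R (fun s => u (side_param Q i s) ^+ 2)).
by apply: continuous_sqr; exact: continuous_side.
Qed.

Lemma measurable_side_itv Q i : measurable (side_itv Q i).
Proof. exact: measurable_itv. Qed.

Lemma h1_square_integrable_lin Q a b f g : h1_square_integrable Q f ->
    h1_square_integrable Q g ->
  h1_square_integrable Q (lin2 a b f g).
Proof.
move=> [f0 f1 f2 fb] [g0 g1 g2 gb]; have mD := @measurable_domain R Q.
split; try exact: (sq_integrable_lin mD).
by move=> i; exact: (sq_integrable_lin (measurable_side_itv Q i) a b _ _ (fb i)
    (gb i)).
Qed.

Lemma approximates_lin Q a b f g v w : h1_square_integrable Q f ->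
    h1_square_integrable Q g ->
  approximates Q f v -> approximates Q g w ->
  approximates Q (lin2 a b f g) (fun n z => a * v n z + b * w n z).
Proof.
move=> [f0 f1 f2 fb] [g0 g1 g2 gb] [cv v0 v1 v2 vb] [cw w0 w1 w2 wb].
have mD := @measurable_domain R Q.
have cc n := C1_continuous (cv n); have dd n := C1_continuous (cw n).
split.
- by move=> n; have [] := C1_lin a b _ _ (cv n) (cw n).
- by apply: L2_limit_lin => // n; exact: continuous_sq_integrable.
- have -> : (fun n => partial1 (fun z => a * v n z + b * w n z)) =
      (fun n z => a * partial1 (v n) z + b * partial1 (w n) z).
    by apply/funext => n; have [] := C1_lin a b _ _ (cv n) (cw n).
  have p1 n : continuous (partial1 (v n)) by have [] := cv n.
  have q1 n : continuous (partial1 (w n)) by have [] := cw n.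
  exact: (L2_limit_lin mD a b _ _ _ _
      (fun n => continuous_sq_integrable Q _ (p1 n))
    (fun n => continuous_sq_integrable Q _ (q1 n)) f1 g1 v1 w1).
- have -> : (fun n => partial2 (fun z => a * v n z + b * w n z)) =
      (fun n z => a * partial2 (v n) z + b * partial2 (w n) z).
    by apply/funext => n; have [] := C1_lin a b _ _ (cv n) (cw n).
  have p2 n : continuous (partial2 (v n)) by have [] := cv n.
  have q2 n : continuous (partial2 (w n)) by have [] := cw n.
  exact: (L2_limit_lin mD a b _ _ _ _
      (fun n => continuous_sq_integrable Q _ (p2 n))
    (fun n => continuous_sq_integrable Q _ (q2 n)) f2 g2 v2 w2).
- move=> i; have mI := measurable_side_itv Q i.
  have fbi : sq_integrable leb (side_itv Q i) (tr f \o side_param Q i) := fb i.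
  have gbi : sq_integrable leb (side_itv Q i) (tr g \o side_param Q i) := gb i.
  have vi n := side_sq_integrable Q i _ (cc n); have wi n :=
      side_sq_integrable Q i _ (dd n).
  exact: (L2_limit_lin mI a b _ _ _ _ vi wi fbi gbi (vb i) (wb i)).
Qed.

Definition energy Q (beta : R) f : R :=
  \int[leb2]_(x in domain Q) (dx1 f x ^+ 2 + dx2 f x ^+ 2)
   + beta * boundary_integral Q (fun x => tr f x ^+ 2).

Definition mass Q f : R := \int[leb2]_(x in domain Q) (fct f x ^+ 2).

Lemma energy_limit Q beta f v : h1_square_integrable Q f ->
    approximates Q f v ->
  energy Q beta (h1fun_of (v n)) @[n --> \oo] --> energy Q beta f.
Proof.
move=> [f0 f1 f2 fb] [cv v0 v1 v2 vb]; have mD := @measurable_domain R Q.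
have split_sum (p q : R * R -> R) :
    sq_integrable leb2 (domain Q : set plane) p ->
    sq_integrable leb2 (domain Q : set plane) q ->
    \int[leb2]_(x in domain Q) (p x ^+ 2 + q x ^+ 2) =
    \int[leb2]_(x in domain Q) (p x ^+ 2) + \int[leb2]_(x in domain Q)
        (q x ^+ 2).
  by move=> [_ ip] [_ iq]; rewrite RintegralD.
have s1 n : sq_integrable leb2 (domain Q : set plane) (partial1 (v n)) by apply:
    continuous_sq_integrable; have [] := cv n.
have s2 n : sq_integrable leb2 (domain Q : set plane) (partial2 (v n)) by apply:
    continuous_sq_integrable; have [] := cv n.
have -> : (fun n => energy Q beta (h1fun_of (v n))) = (fun n =>
    \int[leb2]_(x in domain Q) (partial1 (v n) x ^+ 2) +
        \int[leb2]_(x in domain Q) (partial2 (v n) x ^+ 2) +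
    beta * \sum_i \int[leb]_(s in side_itv Q i)
        ((v n \o side_param Q i) s ^+ 2)).
  by apply/funext => n; rewrite /energy /= (split_sum _ _ (s1 n) (s2 n)).
rewrite /energy split_sum//.
apply: cvgD.
  exact: (cvgD (L2_limit_sq mD _ _ s1 f1 v1) (L2_limit_sq mD _ _ s2 f2 v2)).
apply: cvgM; first exact: cvg_cst.
rewrite /boundary_integral.
apply: (cvg_finite_sum _ (fun i n =>
    \int[leb]_(s in side_itv Q i) ((v n \o side_param Q i) s ^+ 2))) => i.
have fbi : sq_integrable leb (side_itv Q i) (tr f \o side_param Q i) := fb i.
have vi n := side_sq_integrable Q i _ (C1_continuous (cv n)).
exact: (L2_limit_sq (measurable_side_itv Q i) _ _ vi fbi (vb i)).
Qed.

End H1limits.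

(** * The second Robin eigenvalue of a rectangle *)

Section Eigenvalue.
Context {R : realType}.
Local Notation leb := (@lebesgue_measure R).
Local Notation leb2 := (leb \x leb)%E.
Local Notation plane := (measurableTypeR R * measurableTypeR R)%type.
Local Notation int a g := (\int[leb]_(x in `[0, a]) g x).
Implicit Types (Q : rectangle R) (f g : h1fun R) (a beta : R).

Definition even_level beta a : R := mu_even (beta * (a / 2)) / (a / 2) ^+ 2.
Definition odd_level beta a : R := mu_odd (beta * (a / 2)) / (a / 2) ^+ 2.

(** Among the products of modes, the second level belongs to a function that is
    odd along exactly one of the sides. *)
Definition second_level Q beta : R :=
  Num.min (odd_level beta (width Q) + even_level beta (height Q))
          (even_level beta (width Q) + odd_level beta (height Q)).

Lemma even_level_lt_odd beta a : 0 < a -> even_level beta a < odd_level beta a.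
Proof.
move=> a0; rewrite /even_level /odd_level ltr_pM2r ?mu_even_lt_odd//.
by rewrite invr_gt0 exprn_gt0// divr_gt0.
Qed.

Lemma energy_C1 Q beta (v : R * R -> R) : is_C1 v ->
    energy Q beta (h1fun_of v) =
  \int[leb2]_(z in box (width Q) (height Q))
      (dframe1 Q v z ^+ 2 + dframe2 Q v z ^+ 2) +
  beta * (int (height Q) (fun y =>
      v (to_plane Q (0, y)) ^+ 2 + v (to_plane Q (width Q, y)) ^+ 2) +
          int (width Q) (fun x => v (to_plane Q (x, 0)) ^+ 2 + v
              (to_plane Q (x, height Q)) ^+ 2)).
Proof.
move=> cv; have [_ c1 c2] := cv; have cvc := C1_continuous cv.
have sq (t : R * R -> R) : continuous t ->
    continuous (fun z => t z ^+ 2) by move=> ct; exact: continuous_mul.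
rewrite /energy /=; congr (_ + _ * _).
  rewrite domain_integral; last by apply: continuous_add; exact: sq.
  by apply: eq_Rintegral => z _; exact: dframe_gradient.
have cW := continuous_comp_to_plane Q _ cvc; have cW2 := sq _ cW.
rewrite boundary_integralE !int_add; first by rewrite addrC.
- exact: (continuous_slice1 _ 0 cW2).
- exact: (continuous_slice1 _ (height Q) cW2).
- exact: (continuous_slice2 _ 0 cW2).
- exact: (continuous_slice2 _ (width Q) cW2).
Qed.

Lemma C1_gap Q beta phi phi' psi psi' d (v : R * R -> R) :
  let mu1 := even_level beta (width Q) in let mu2 :=
      even_level beta (height Q) in
  interval_mode (width Q) beta mu1 phi phi' ->
      int (width Q) (fun x => phi x ^+ 2) = 1 -> phi (width Q / 2) != 0 ->
  interval_mode (height Q) beta mu2 psi psi' ->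
      int (height Q) (fun y => psi y ^+ 2) = 1 -> psi (height Q / 2) != 0 ->
  0 <= d -> mu1 + d <= odd_level beta (width Q) ->
      mu2 + d <= odd_level beta (height Q) -> is_C1 v ->
  (mu1 + mu2 + d) * \int[leb2]_(z in domain Q) (v z ^+ 2) -
  d * (\int[leb2]_(z in domain Q) (v z * product_fun Q phi psi z)) ^+ 2 <=
      energy Q beta (h1fun_of v).
Proof.
move=> mu1 mu2 mphi n1 p1 mpsi n2 p2 d0 d1 d2 cv.
have [cW c1 c2] := dframe_continuous Q v cv; have cvc := C1_continuous cv.
have cu : continuous (product_fun Q phi psi).
  apply: C1_continuous; apply: (C1_product_fun Q phi phi' psi psi');
      [exact: im_derive mphi| |exact: im_derive mpsi|].
  - exact: derive_everywhere_continuous (im_ode _ _ _ _ _ mphi).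
  - exact: derive_everywhere_continuous (im_ode _ _ _ _ _ mpsi).
rewrite energy_C1// domain_integral; last exact: continuous_mul.
rewrite (domain_integral Q (fun z => v z * product_fun Q phi psi z));
    last exact: continuous_mul.
have := box_gap (width Q) (height Q) beta mu1 mu2 phi phi' psi psi'
    (v \o to_plane Q) (dframe1 Q v) (dframe2 Q v)
  (width_gt0 Q) (height_gt0 Q) mphi n1 p1 mpsi n2 p2 d d0 d1 d2 cW c1 c2
  (fun x y => slice1_is_derive Q v x y cv)
      (fun x y => slice2_is_derive Q v x y cv).
have -> : \int[leb2]_(z in box (width Q) (height Q))
    (v (to_plane Q z) * product_fun Q phi psi (to_plane Q z)) =
    \int[leb2]_(z in box (width Q) (height Q))
        ((v \o to_plane Q) z * (phi z.1 * psi z.2)).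
  by apply: eq_Rintegral => z _; rewrite /product_fun to_planeK.
by [].
Qed.

(** Every term is continuous along the C1 functions that approximate f. *)
Lemma H1_gap Q beta (u1 : R * R -> R) (lam d : R) f v : continuous u1 ->
  (forall w : R * R -> R, is_C1 w ->
      lam * \int[leb2]_(z in domain Q) (w z ^+ 2) -
    d * (\int[leb2]_(z in domain Q) (w z * u1 z)) ^+ 2 <= energy Q beta
        (h1fun_of w)) ->
  h1_square_integrable Q f -> approximates Q f v ->
  lam * mass Q f - d * (\int[leb2]_(z in domain Q) (fct f z * u1 z)) ^+ 2 <=
      energy Q beta f.
Proof.
move=> cu gap sf av; have el := energy_limit Q beta f v sf av.
have [f0 _ _ _] := sf; have [cv v0 _ _ _] := av; have mD :=
    @measurable_domain R Q.
have sv n := continuous_sq_integrable Q _ (C1_continuous (cv n)).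
have su := continuous_sq_integrable Q _ cu.
have m1 := L2_limit_sq mD _ _ sv f0 v0.
have m2 := L2_limit_mul mD _ _ _ sv f0 su v0.
have lim : lam * \int[leb2]_(z in domain Q) (v n z ^+ 2) -
    d * (\int[leb2]_(z in domain Q) (v n z * u1 z)) ^+ 2 @[n --> \oo] -->
    lam * mass Q f - d * (\int[leb2]_(z in domain Q) (fct f z * u1 z)) ^+ 2.
  by apply: cvgB; apply: cvgM; (exact: cvg_cst || exact: m1 || exact:
      (cvgM m2 m2)).
apply: (ler_cvg_to lim el); apply: nearW => n; exact: gap.
Qed.

Lemma mass_gt0 Q (b : 'I_2 -> h1fun R) (c : 'rV[R]_2) : H1_basis Q b ->
    c != 0 ->
  h1_square_integrable Q (lincomb c b) -> 0 < mass Q (lincomb c b).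
Proof.
move=> [_ ind] c0 [s0 _ _ _]; rewrite lt_neqAle eq_sym; apply/andP; split;
    last exact: int_sq_ge0.
apply/eqP => m0; move/eqP: c0; apply; apply: ind.
exact: (sq_integrable_ae_eq0 (@measurable_domain R Q) _ s0 m0).
Qed.

(** In a space of dimension two, one linear condition leaves a nonzero function
    orthogonal to the first eigenfunction; there the gap inequality gives the
    second level. *)
Lemma second_level_lbound Q beta (b : 'I_2 -> h1fun R) m : H1_basis Q b ->
  is_max_rayleigh Q beta b m -> second_level Q beta <= m.
Proof.
move=> Hb [_ mub]; have [inH1 _] := Hb.
have [phi [phi' [mphi n1 p1]]] := interval_even_mode _ beta (width_gt0 Q).
have [psi [psi' [mpsi n2 p2]]] := interval_even_mode _ beta (height_gt0 Q).
have lt1 := even_level_lt_odd beta _ (width_gt0 Q); have lt2 :=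
    even_level_lt_odd beta _ (height_gt0 Q).
pose d := Num.min (odd_level beta (width Q) - even_level beta (width Q))
                  (odd_level beta (height Q) - even_level beta (height Q)).
have d0 : 0 <= d by rewrite le_min !subr_ge0 !ltW.
have d1 : even_level beta (width Q) + d <= odd_level beta (width Q).
  by rewrite -lerBrDl ge_min lexx.
have d2 : even_level beta (height Q) + d <= odd_level beta (height Q).
  by rewrite -lerBrDl ge_min lexx orbT.
have lamE : even_level beta (width Q) + even_level beta (height Q) + d =
    second_level Q beta.
  rewrite /second_level /d; set e1 := even_level _ _; set o1 := odd_level _ _.
  set e2 := even_level _ (height Q); set o2 := odd_level _ (height Q).
  by rewrite /Num.min; case: ltP => h1; case: ltP => h2; lra.
pose u1 := product_fun Q phi psi.
have cu : continuous u1.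
  apply: C1_continuous; apply: (C1_product_fun Q phi phi' psi psi');
      [exact: im_derive mphi| |exact: im_derive mpsi|].
  - exact: derive_everywhere_continuous (im_ode _ _ _ _ _ mphi).
  - exact: derive_everywhere_continuous (im_ode _ _ _ _ _ mpsi).
pose y i := \int[leb2]_(z in domain Q) (fct (b i) z * u1 z).
have [c [c0 cy]] : exists c : 'rV[R]_2,
    c != 0 /\ c 0 ord0 * y ord0 + c 0 ord_max * y ord_max = 0.
  have [y0|y0] := eqVneq (y ord_max) 0.
    exists (\row_j (j == ord_max)%:R); rewrite !mxE /= y0 mulr0 mul0r addr0;
        split => //.
    by apply/eqP => /rowP/(_ ord_max); rewrite !mxE eqxx => /eqP;
        rewrite oner_eq0.
  exists (\row_j (if j == ord0 then y ord_max else - y ord0)); rewrite !mxE /=;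
      split; last by ring.
  by apply/eqP => /rowP/(_ ord0); rewrite !mxE eqxx => /eqP;
      rewrite (negbTE y0).
have [s0 [v0 a0]] := H1_approximable _ _ (inH1 ord0).
have [s1 [v1 a1]] := H1_approximable _ _ (inH1 ord_max).
have sf := h1_square_integrable_lin _ (c 0 ord0) (c 0 ord_max) _ _ s0 s1.
have af := approximates_lin _ (c 0 ord0) (c 0 ord_max) _ _ _ _ s0 s1 a0 a1.
have mf : 0 < mass Q (lincomb c b) by apply: mass_gt0 => //; rewrite lincomb2E.
rewrite -lincomb2E in sf af.
have gap := H1_gap Q beta u1 (second_level Q beta) d (lincomb c b) _ cu
  (fun w cw => ltac:(rewrite -lamE; exact:
      (C1_gap Q beta phi phi' psi psi' d w mphi n1 p1 mpsi n2 p2 d0 d1 d2 cw)))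
  sf af.
have orth : \int[leb2]_(z in domain Q) (fct (lincomb c b) z * u1 z) = 0.
  have [t0 _ _ _] := s0; have [t1 _ _ _] := s1.
  rewrite lincomb2E (int_mul_lin (@measurable_domain R Q))//.
  exact: continuous_sq_integrable.
rewrite orth expr0n /= mulr0 subr0 in gap.
apply: le_trans (mub (rayleigh Q beta (lincomb c b)) _); last by exists c.
by rewrite /rayleigh ler_pdivlMr.
Qed.

End Eigenvalue.

Section Attained.
Context {R : realType}.
Local Notation leb := (@lebesgue_measure R).
Local Notation leb2 := (leb \x leb)%E.
Local Notation plane := (measurableTypeR R * measurableTypeR R)%type.
Local Notation int a g := (\int[leb]_(x in `[0, a]) g x).
Implicit Types (Q : rectangle R) (a beta : R).

Lemma ae_eq0_int_sq {d} {T : measurableType d} {mu : {measure set T -> \bar R}}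
    {D : set T} (f : T -> R) :
  measurable D -> sq_integrable mu D f -> {ae mu, forall x, D x -> f x = 0} ->
  \int[mu]_(x in D) (f x ^+ 2) = 0.
Proof.
move=> mD [mf intf] f0; have mf2 := measurable_int mu intf.
have : ae_eq mu D (fun x => (f x ^+ 2)%:E) (cst 0%E).
  by apply: filterS f0 => x h Dx; rewrite h// expr0n.
move/(ae_eq_integral_abs mu mD mf2) => h;
    rewrite /Rintegral -[RHS]/(fine 0%E) -h; congr fine.
by apply: eq_integral => x _; rewrite abse_EFin ger0_norm ?sqr_ge0.
Qed.

Lemma box_product (f g : R -> R) w h : continuous f -> continuous g ->
  \int[leb2]_(z in box w h) (f z.1 * g z.2) = int w f * int h g.
Proof.
move=> cf cg; have cfg := continuous_mul _ _ (continuous_fst_comp _ cf)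
    (continuous_snd_comp _ cg).
rewrite box_fubini12// mulrC -int_scale//; apply: eq_Rintegral => x _ /=.
by rewrite int_scale// mulrC.
Qed.

Section Product.
Variables (Q : rectangle R) (Z Z' P P' : R -> R).
Hypotheses (dZ : forall x : R, is_derive x 1 Z (Z' x)) (cZ' : continuous Z').
Hypotheses (dP : forall x : R, is_derive x 1 P (P' x)) (cP' : continuous P').
Let u := product_fun Q Z P.
Let w := width Q.
Let h := height Q.
Let cu : is_C1 u. Proof. exact: C1_product_fun dZ cZ' dP cP'. Qed.
Let cZ : continuous Z := derive_everywhere_continuous dZ.
Let cP : continuous P := derive_everywhere_continuous dP.

Let uE z : u (to_plane Q z) = Z z.1 * P z.2.
Proof. by rewrite /u /product_fun to_planeK. Qed.

Let du1 z : dframe1 Q u z = Z' z.1 * P z.2.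
Proof.
case: z => x y; have h1 := slice1_is_derive Q u x y cu.
have h2 : is_derive x 1 (fun x => u (to_plane Q (x, y))) (Z' x * P y).
  apply: is_derive_ext (is_derive_scale (P y) (dZ x)) => [t|];
      last by rewrite mulrC.
  by rewrite uE mulrC.
by rewrite -(@derive_val _ _ _ _ _ _ _ h2) (@derive_val _ _ _ _ _ _ _ h1).
Qed.

Let du2 z : dframe2 Q u z = Z z.1 * P' z.2.
Proof.
case: z => x y; have h1 := slice2_is_derive Q u x y cu.
have h2 : is_derive y 1 (fun y => u (to_plane Q (x, y))) (Z x * P' y).
  by apply: is_derive_ext (is_derive_scale (Z x) (dP y)) => // t; rewrite uE.
by rewrite -(@derive_val _ _ _ _ _ _ _ h2) (@derive_val _ _ _ _ _ _ _ h1).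
Qed.

Lemma mass_product : mass Q (h1fun_of u) = int w (fun x => Z x ^+ 2) * int h
    (fun y => P y ^+ 2).
Proof.
have cuc := C1_continuous cu.
rewrite /mass /= domain_integral; last exact: continuous_mul.
rewrite -box_product; [|exact: continuous_sqr|exact: continuous_sqr].
by apply: eq_Rintegral => z _; rewrite uE exprMn.
Qed.

Lemma energy_product beta : energy Q beta (h1fun_of u) =
  robin_form w beta Z Z' Z Z' * int h (fun y => P y ^+ 2) +
  int w (fun x => Z x ^+ 2) * robin_form h beta P P' P P'.
Proof.
have cZ2 := continuous_sqr _ cZ; have cP2 := continuous_sqr _ cP.
have cZ'2 := continuous_sqr _ cZ'; have cP'2 := continuous_sqr _ cP'.
rewrite energy_C1//.
have -> : \int[leb2]_(z in box (width Q) (height Q))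
    (dframe1 Q u z ^+ 2 + dframe2 Q u z ^+ 2) =
    int w (fun x => Z' x ^+ 2) * int h (fun y => P y ^+ 2) + int w
        (fun x => Z x ^+ 2) * int h (fun y => P' y ^+ 2).
  transitivity (\int[leb2]_(z in box w h)
      ((fun x => Z' x ^+ 2) z.1 * (fun y => P y ^+ 2) z.2 +
      (fun x => Z x ^+ 2) z.1 * (fun y => P' y ^+ 2) z.2)).
    by apply: eq_Rintegral => z _; rewrite du1 du2 !exprMn.
  rewrite RintegralD; [|exact: measurable_box| |].
  - congr (_ + _); [exact: (box_product (fun x => Z' x ^+ 2)
      (fun y => P y ^+ 2))|exact: (box_product (fun x => Z x ^+ 2)
      (fun y => P' y ^+ 2))].
  - by apply: box_integrable; apply: continuous_mul;
      [exact: (continuous_fst_comp _ cZ'2)|exact: (continuous_snd_comp _ cP2)].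
  - by apply: box_integrable; apply: continuous_mul;
      [exact: (continuous_fst_comp _ cZ2)|exact: (continuous_snd_comp _ cP'2)].
have -> : int (height Q) (fun y =>
    u (to_plane Q (0, y)) ^+ 2 + u (to_plane Q (width Q, y)) ^+ 2) =
    (Z 0 ^+ 2 + Z w ^+ 2) * int h (fun y => P y ^+ 2).
  rewrite -int_scale//; apply: eq_Rintegral => y _; rewrite !uE /= !exprMn;
      ring.
have -> : int (width Q) (fun x =>
    u (to_plane Q (x, 0)) ^+ 2 + u (to_plane Q (x, height Q)) ^+ 2) =
    (P 0 ^+ 2 + P h ^+ 2) * int w (fun x => Z x ^+ 2).
  rewrite -int_scale//; apply: eq_Rintegral => x _; rewrite !uE /= !exprMn;
      ring.
rewrite /robin_form.
have -> : int w (fun x => Z' x * Z' x) = int w (fun x => Z' x ^+ 2) by [].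
have -> : int h (fun x => P' x * P' x) = int h (fun x => P' x ^+ 2) by [].
ring.
Qed.

End Product.

(** Distinct modes are orthogonal both in L2 and for the Robin form. *)
Lemma robin_form_modes a beta m f f' m' g g' (p q : R) : 0 < a ->
  interval_mode a beta m f f' -> interval_mode a beta m' g g' ->
  int a (fun x => f x ^+ 2) = 1 -> int a (fun x => g x ^+ 2) = 1 ->
      int a (fun x => f x * g x) = 0 ->
  robin_form a beta (fun x => p * f x + q * g x) (fun x => p * f' x + q * g' x)
    (fun x => p * f x + q * g x) (fun x => p * f' x + q * g' x) = p ^+ 2 * m + q
        ^+ 2 * m' /\
  int a (fun x => (p * f x + q * g x) ^+ 2) = p ^+ 2 + q ^+ 2.
Proof.
move=> a0 mf mg nf ng o.
have [df df' _ _] := mf; have [dg dg' _ _] := mg.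
have cf := derive_everywhere_continuous df; have cf' :=
    derive_everywhere_continuous df'.
have cg := derive_everywhere_continuous dg; have cg' :=
    derive_everywhere_continuous dg'.
have mpf := interval_mode_scale _ _ _ _ _ p mf; have [dpf dpf' _ _] := mpf.
have cpf' := derive_everywhere_continuous dpf'; have cpf :=
    derive_everywhere_continuous dpf.
have o' : int a (fun x => g x * (p * f x)) = 0.
  transitivity (p * int a (fun x => f x * g x)); last by rewrite o mulr0.
  rewrite -int_scale; last exact: continuous_mul.
  by apply: eq_Rintegral => x _; ring.
have o'' : int a (fun x => p * f x * g x) = 0.
  by apply: etrans o'; apply: eq_Rintegral => x _; ring.
have nf' : int a (fun x => (p * f x) ^+ 2) = p ^+ 2.
  transitivity (p ^+ 2 * int a (fun x => f x ^+ 2)); last by rewrite nf mulr1.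
  rewrite -int_scale; last exact: continuous_sqr.
  by apply: eq_Rintegral => x _; ring.
have e1 : (fun x => p * f x + q * g x) = (fun x => p * f x - (- q) * g x).
  by apply/funext => x; ring.
have e2 : (fun x => p * f' x + q * g' x) = (fun x => p * f' x - (- q) * g' x).
  by apply/funext => x; ring.
split.
- rewrite e1 e2 (robin_form_sub a beta (- q) (fun x => p * f x)
    (fun x => p * f' x) g g')//.
  rewrite (green _ _ _ _ _ _ _ a0 mpf dpf cpf')
      (green _ _ _ _ _ _ _ a0 mg dpf cpf') (green _ _ _ _ _ _ _ a0 mg dg cg').
  have t1 : int a (fun x => p * f x * (p * f x)) = p ^+ 2 := nf'.
  have t2 : int a (fun x => g x * g x) = 1 := ng.
  by rewrite o' t1 t2; ring.
- have -> : (fun x => (p * f x + q * g x) ^+ 2) =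
    (fun x => (p * f x - (- q) * g x) ^+ 2).
    by apply/funext => x; ring.
  by rewrite int_sqr_sub// nf' ng o''; ring.
Qed.

(** A basis that diagonalizes both forms: the Rayleigh quotient is a weighted
    mean of A and B. *)
Lemma H1_basis_max Q beta (b : 'I_2 -> h1fun R) A B :
    (forall i, in_H1 Q (b i)) -> A <= B ->
  (forall c : 'rV[R]_2, energy Q beta (lincomb c b) = c 0 ord0 ^+ 2 * A + c 0
      ord_max ^+ 2 * B) ->
  (forall c : 'rV[R]_2, mass Q (lincomb c b) = c 0 ord0 ^+ 2 + c 0 ord_max ^+ 2)
      ->
  H1_basis Q b /\ is_max_rayleigh Q beta b B.
Proof.
move=> inH1 AB eE mE.
have c_eq0 (c : 'rV[R]_2) : c 0 ord0 ^+ 2 + c 0 ord_max ^+ 2 = 0 -> c = 0.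
  move/eqP; rewrite paddr_eq0 ?sqr_ge0// !sqrf_eq0 => /andP[/eqP c0 /eqP c1].
  by apply/rowP => j; rewrite mxE; case: (unliftP ord0 j) => [k ->|-> //];
      rewrite (ord1 k) -[RHS]c1; congr (c 0 _); exact: val_inj.
split; first split => //.
  move=> c c0; apply: c_eq0; rewrite -mE; apply: ae_eq0_int_sq c0; first exact:
      measurable_domain.
  have [s0 _] := H1_approximable _ _ (inH1 ord0); have [s1 _] :=
      H1_approximable _ _ (inH1 ord_max).
  by have [] := h1_square_integrable_lin Q (c 0 ord0) (c 0 ord_max) _ _ s0 s1;
      rewrite lincomb2E.
have rE (c : 'rV[R]_2) : rayleigh Q beta (lincomb c b) =
    (c 0 ord0 ^+ 2 * A + c 0 ord_max ^+ 2 * B) /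
        (c 0 ord0 ^+ 2 + c 0 ord_max ^+ 2).
  by rewrite -eE -mE.
split.
- exists (\row_j (j == ord_max)%:R).
    by apply/eqP => /rowP/(_ ord_max); rewrite !mxE eqxx => /eqP;
        rewrite oner_eq0.
  by rewrite rE !mxE /= expr0n expr1n /= mul0r !add0r mul1r divr1.
- move=> _ [c c0 <-]; rewrite rE.
  have s0 : 0 < c 0 ord0 ^+ 2 + c 0 ord_max ^+ 2.
    rewrite lt_neqAle eq_sym addr_ge0 ?sqr_ge0// andbT; apply/eqP => /c_eq0;
        exact/eqP.
  rewrite ler_pdivrMr//; have := sqr_ge0 (c 0 ord0); nra.
Qed.

Lemma lincomb_C1 Q (c : 'rV[R]_2) (b : 'I_2 -> R * R -> R) :
    (forall i, is_C1 (b i)) ->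
  lincomb c (fun i => h1fun_of (b i)) = h1fun_of
      (fun z => c 0 ord0 * b ord0 z + c 0 ord_max * b ord_max z).
Proof.
move=> cb; rewrite lincomb2E /lin2 /h1fun_of /=.
by have [_ -> ->] := C1_lin (c 0 ord0) (c 0 ord_max) _ _ (cb ord0) (cb ord_max).
Qed.

(** The first eigenfunction and one for the second level share a factor, so
    every function in their span is again a product. *)
Lemma second_level_attained Q beta : exists b : 'I_2 -> h1fun R,
  H1_basis Q b /\ is_max_rayleigh Q beta b (second_level Q beta).
Proof.
have w0 := width_gt0 Q; have h0 := height_gt0 Q.
have [phi [phi' [mphi n1 p1]]] := interval_even_mode _ beta w0.
have [psi [psi' [mpsi n2 p2]]] := interval_even_mode _ beta h0.
have [chi [chi' [mchi n3]]] := interval_odd_mode _ beta w0.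
have [eta [eta' [meta n4]]] := interval_odd_mode _ beta h0.
have lt1 := even_level_lt_odd beta _ w0; have lt2 :=
    even_level_lt_odd beta _ h0.
have o1 := interval_mode_orthogonal _ _ _ _ _ _ _ _ w0 (negbT (lt_eqF lt1)) mphi
    mchi.
have o2 := interval_mode_orthogonal _ _ _ _ _ _ _ _ h0 (negbT (lt_eqF lt2)) mpsi
    meta.
have [dphi dphi' _ _] := mphi; have cphi' := derive_everywhere_continuous dphi'.
have [dpsi dpsi' _ _] := mpsi; have cpsi' := derive_everywhere_continuous dpsi'.
have [dchi dchi' _ _] := mchi; have cchi' := derive_everywhere_continuous dchi'.
have [deta deta' _ _] := meta; have ceta' := derive_everywhere_continuous deta'.
have dlin (p q : R) (f f' g g' : R -> R) :
    (forall x : R, is_derive x 1 f (f' x)) ->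
    (forall x : R, is_derive x 1 g (g' x)) ->
    forall x : R, is_derive x 1 (fun x => p * f x + q * g x)
        (p * f' x + q * g' x).
  by move=> df dg x; exact: is_derive_add (is_derive_scale p (df x))
      (is_derive_scale q (dg x)).
have clin (p q : R) (f g : R -> R) : continuous f -> continuous g ->
    continuous (fun x => p * f x + q * g x).
  by move=> cf cg; apply: continuous_add; exact: continuous_scale.
have gpsi := green _ _ _ _ _ _ _ h0 mpsi dpsi cpsi'.
have gphi := green _ _ _ _ _ _ _ w0 mphi dphi cphi'.
have n1' : int (width Q) (fun x => phi x * phi x) = 1 by rewrite -n1.
have n2' : int (height Q) (fun x => psi x * psi x) = 1 by rewrite -n2.
rewrite n1' mulr1 in gphi; rewrite n2' mulr1 in gpsi.
pose e1 := even_level beta (width Q); pose e2 := even_level beta (height Q).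
rewrite /second_level; case: leP => _.
- exists (fun i => h1fun_of (product_fun Q (if i == ord0 then phi else chi)
    psi)).
  have cb i : is_C1 (product_fun Q (if i == ord0 then phi else chi) psi).
    by case: (i == ord0); [exact: (C1_product_fun Q phi phi' psi psi')|exact:
        (C1_product_fun Q chi chi' psi psi')].
  have lE (c : 'rV[R]_2) : lincomb c
      (fun i : 'I_2 => h1fun_of (product_fun Q (if i == ord0 then phi else chi)
      psi)) =
     h1fun_of (product_fun Q (fun x => c 0 ord0 * phi x + c 0 ord_max * chi x)
         psi).
    rewrite (lincomb_C1 Q c (fun i =>
        product_fun Q (if i == ord0 then phi else chi) psi))//=.
    by congr h1fun_of; apply/funext => z; rewrite /product_fun mulrDl !mulrA.
  have dl c := dlin (c 0 (ord0 : 'I_2)) (c 0 ord_max) phi phi' chi chi' dphi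
      dchi.
  apply: (H1_basis_max Q beta _ (e1 + e2)) => [i||c|c].
  + exact: C1_in_H1.
  + by rewrite lerD2r ltW.
  + have [r n] := robin_form_modes _ _ _ _ _ _ _ _ (c 0 ord0) (c 0 ord_max) w0
      mphi mchi n1 n3 o1.
    rewrite lE (energy_product Q _ (fun x =>
        c 0 ord0 * phi' x + c 0 ord_max * chi' x) _ psi')//; last exact: clin.
    by rewrite r n n2 gpsi /e1 /e2 /even_level /odd_level; ring.
  + have [r n] := robin_form_modes _ _ _ _ _ _ _ _ (c 0 ord0) (c 0 ord_max) w0
      mphi mchi n1 n3 o1.
    rewrite lE (mass_product Q _ (fun x =>
        c 0 ord0 * phi' x + c 0 ord_max * chi' x) _ psi')//; last exact: clin.
    by rewrite n n2 mulr1.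
- exists (fun i => h1fun_of (product_fun Q phi
    (if i == ord0 then psi else eta))).
  have cb i : is_C1 (product_fun Q phi (if i == ord0 then psi else eta)).
    by case: (i == ord0); [exact: (C1_product_fun Q phi phi' psi psi')|exact:
        (C1_product_fun Q phi phi' eta eta')].
  have lE (c : 'rV[R]_2) : lincomb c
      (fun i : 'I_2 => h1fun_of (product_fun Q phi
      (if i == ord0 then psi else eta))) =
     h1fun_of (product_fun Q phi (fun x =>
         c 0 ord0 * psi x + c 0 ord_max * eta x)).
    rewrite (lincomb_C1 Q c (fun i =>
        product_fun Q phi (if i == ord0 then psi else eta)))//=.
    by congr h1fun_of; apply/funext => z;
        rewrite /product_fun mulrDr !mulrA ![phi _ * _]mulrC.
  have dl c := dlin (c 0 (ord0 : 'I_2)) (c 0 ord_max) psi psi' eta eta' dpsi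
      deta.
  apply: (H1_basis_max Q beta _ (e1 + e2)) => [i||c|c].
  + exact: C1_in_H1.
  + by rewrite lerD2l ltW.
  + have [r n] := robin_form_modes _ _ _ _ _ _ _ _ (c 0 ord0) (c 0 ord_max) h0
      mpsi meta n2 n4 o2.
    rewrite lE (energy_product Q _ phi' _
        (fun x => c 0 ord0 * psi' x + c 0 ord_max * eta' x))//; last exact:
        clin.
    by rewrite r n n1 gphi /e1 /e2 /even_level /odd_level; ring.
  + have [r n] := robin_form_modes _ _ _ _ _ _ _ _ (c 0 ord0) (c 0 ord_max) h0
      mpsi meta n2 n4 o2.
    rewrite lE (mass_product Q _ phi' _
        (fun x => c 0 ord0 * psi' x + c 0 ord_max * eta' x))//; last exact:
        clin.
    by rewrite n n1 mul1r.
Qed.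

Lemma robin_eigenvalue2 Q beta :
    robin_eigenvalue 2 Q beta = second_level Q beta.
Proof.
have [b Hb] := second_level_attained Q beta.
have P : is_robin_eigenvalue 2 Q beta (second_level Q beta).
  split; first by exists b.
  by move=> m [b' [Hb' mb']]; exact: second_level_lbound Hb' mb'.
have [[b' [Hb' mb']] lb] := xgetPex 0 (ex_intro _ _ P).
apply/eqP; rewrite eq_le; apply/andP; split; first by apply: lb; exists b.
exact: second_level_lbound Hb' mb'.
Qed.

End Attained.

(** * Rectangles of given perimeter *)

Section Scaling.
Context {R : realType}.
Implicit Types (Q S : rectangle R) (alpha c p : R).

Definition width_share Q : R := width Q / (width Q + height Q).

Lemma width_share_bounds Q : 0 < width_share Q < 1.
Proof.
have w0 := width_gt0 Q; have h0 := height_gt0 Q.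
by rewrite /width_share divr_gt0 ?addr_gt0//= ltr_pdivrMr ?addr_gt0// mul1r
    ltrDl.
Qed.

Definition best_level c p : R :=
    Num.min (long_level c p) (long_level c (1 - p)).

Lemma scaled_eigenvalueE alpha Q :
  robin_eigenvalue 2 Q (alpha / perimeter Q) * area Q = 4 * best_level
      (alpha / 4) (width_share Q).
Proof.
have w0 := width_gt0 Q; have h0 := height_gt0 Q; have wh0 := addr_gt0 w0 h0.
rewrite robin_eigenvalue2 /second_level /best_level /area.
have A0 : 0 < width Q * height Q by rewrite mulr_gt0.
have wE : alpha / perimeter Q * (width Q / 2) = alpha / 4 * width_share Q.
  by rewrite /perimeter /width_share; field; rewrite gt_eqF.
have hE : alpha / perimeter Q * (height Q / 2) = alpha / 4 *
    (1 - width_share Q).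
  by rewrite /perimeter /width_share; field; rewrite gt_eqF.
have pE : (1 - width_share Q) / width_share Q = height Q / width Q.
  by rewrite /width_share; field; rewrite !gt_eqF.
have pE' : width_share Q / (1 - width_share Q) = width Q / height Q.
  have -> : 1 - width_share Q = height Q / (width Q + height Q) by rewrite
      /width_share; field; rewrite gt_eqF.
  by rewrite /width_share; field; rewrite !gt_eqF.
rewrite [LHS]mulrC !minr_pMr ?ltW//.
rewrite /even_level /odd_level wE hE /long_level subKr pE pE' minC.
by congr Num.min; field; rewrite !gt_eqF.
Qed.

Lemma is_square_width_share Q : is_square Q <-> width_share Q = 1 / 2.
Proof.
have w0 := width_gt0 Q; have h0 := height_gt0 Q;
    rewrite /is_square /width_share; split => [->|e].
  by field; rewrite ?gt_eqF ?addr_gt0.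
have : width Q = 1 / 2 * (width Q + height Q) by rewrite -e divfK// gt_eqF//
    addr_gt0.
lra.
Qed.

Lemma best_level_half c : best_level c (1 / 2) = long_level c (1 / 2).
Proof. by rewrite /best_level (_ : 1 - 1 / 2 = 1 / 2) ?minxx//; field. Qed.

Lemma best_level_lt_half c p : 0 <= excess (c / 2) -> 0 < p < 1 -> p != 1 / 2 ->
  best_level c p < best_level c (1 / 2).
Proof.
move=> ec /andP[p0 p1] p2; rewrite best_level_half /best_level gt_min.
case: (ltgtP p (1 / 2)) p2 => // h _; apply/orP.
  by left; apply: long_level_lt_half => //; rewrite p0.
by right; apply: long_level_lt_half => //; lra.
Qed.

Lemma best_level_lt_coef c p : excess (c / 2) < 0 -> 0 < p < 1 ->
    best_level c p < c.
Proof.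
move=> ec /andP[p0 p1]; rewrite /best_level gt_min; apply/orP.
have [h|h] := leP p (1 / 2); first by left; apply: long_level_lt_coef => //;
    rewrite p0.
by right; apply: long_level_lt_coef => //; lra.
Qed.

Lemma best_level_limit c : exists2 K, 0 < K & forall p, 0 < p < 1 ->
  Num.min p (1 - p) * K <= 1 -> `|best_level c p - c| <= Num.min p (1 - p) * K.
Proof.
have [K K0 hK] := long_level_limit c; exists K => // p /andP[p0 p1].
wlog p2 : p p0 p1 / p <= 1 / 2 => [hw|].
  have [|h] := leP p (1 / 2); first exact: hw.
  have hb : best_level c (1 - p) = best_level c p by rewrite /best_level subKr
      minC.
  by have := hw (1 - p); rewrite subKr hb (minC (1 - p)) => h'; apply: h'; lra.
have -> : Num.min p (1 - p) = p by apply/min_idPl; lra.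
move=> pK; have [_ h1 h2] := hK p p0 pK.
rewrite /best_level; move: h1; rewrite !ler_norml => /andP[h1 h3].
have pK0 : 0 < p * K by rewrite mulr_gt0.
by rewrite /Num.min; case: ltP => h4; apply/andP; split; lra.
Qed.

Lemma min_width_share_le Q : Num.min (width_share Q) (1 - width_share Q) *
    aspect_ratio Q <= 1.
Proof.
have w0 := width_gt0 Q; have h0 := height_gt0 Q; have wh0 := addr_gt0 w0 h0.
have sE : 1 - width_share Q = height Q / (width Q + height Q) by rewrite
    /width_share; field; rewrite gt_eqF.
rewrite sE /width_share /aspect_ratio -minr_pMl ?invr_ge0 ?(ltW wh0)//.
set m := Num.min _ _; set M := Num.max _ _.
have m0 : 0 < m by rewrite lt_min w0.
have -> : m / (width Q + height Q) * (M / m) = M / (width Q + height Q) by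
    field; rewrite !gt_eqF.
by rewrite ler_pdivrMr// mul1r ge_max !lerDl !lerDr !ltW.
Qed.

End Scaling.

Theorem theorem3p6 (R : realType) :
  let F (alpha : R) (Q : rectangle R) : R :=
    robin_eigenvalue 2 Q (alpha / perimeter Q) * area Q in
  [/\ alpha_minus R < 0 < alpha_plus R,
      (forall alpha : R, alpha_minus R <= alpha <= alpha_plus R ->
         forall S : rectangle R,
           is_square S <-> (forall Q : rectangle R, F alpha Q <= F alpha S))
    & (forall alpha : R, ~~ (alpha_minus R <= alpha <= alpha_plus R) ->
         (forall Q : rectangle R, F alpha Q < alpha) /\
         (forall eps : R, 0 < eps ->
            exists M : R, forall Q : rectangle R,
              M <= aspect_ratio Q -> `|F alpha Q - alpha| < eps))].
Proof.
move=> F; have FE alpha Q : F alpha Q = 4 * best_level (alpha / 4)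
    (width_share Q) := scaled_eigenvalueE alpha Q.
have a8 (alpha : R) : alpha / 4 / 2 = alpha / 8 by field.
split.
- have [p0 _] := @alpha_plus_spec R; have [m0 _] := @alpha_minus_spec R.
  by rewrite p0 andbT; lra.
- move=> alpha; rewrite alpha_rangeP -a8 => ea S.
  rewrite is_square_width_share; split => [sS Q|maxS].
    rewrite !FE sS ler_pM2l//.
    have [->//|q] := eqVneq (width_share Q) (1 / 2).
    by apply/ltW/best_level_lt_half => //; exact: width_share_bounds.
  apply/eqP; apply: contraT => s2.
  pose U := @Rectangle R (0, 0) 0 1 1 ltr01 ltr01.
  have sU : width_share U = 1 / 2 by apply/is_square_width_share.
  have := maxS U; rewrite !FE sU ler_pM2l// leNgt best_level_lt_half//.
  exact: width_share_bounds.
- move=> alpha; rewrite alpha_rangeP -ltNge -a8 => ea; split => [Q|eps eps0].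
    by rewrite FE; have := best_level_lt_coef _ _ ea (width_share_bounds Q);
        lra.
  have [K K0 hK] := best_level_limit (alpha / 4).
  exists (K * (1 + 8 / eps)) => Q MQ.
  have e8 : 0 < 8 / eps by rewrite divr_gt0.
  have sb := width_share_bounds Q; set m :=
      Num.min (width_share Q) (1 - width_share Q).
  have m0 : 0 < m by rewrite lt_min; lra.
  have mM : m * (K * (1 + 8 / eps)) <= 1 by apply:
      le_trans (min_width_share_le Q); rewrite ler_pM2l.
  have mK0 : 0 < m * K by rewrite mulr_gt0.
  have mK1 : m * K <= 1 by nra.
  have mKe : m * K * 8 <= eps.
    have : m * K * (8 / eps) <= 1 by nra.
    by rewrite mulrA ler_pdivrMr// mul1r.
  have := hK _ sb mK1; rewrite FE -/m => h.
  have -> : 4 * best_level (alpha / 4) (width_share Q) - alpha = 4 *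
      (best_level (alpha / 4) (width_share Q) - alpha / 4) by field.
  rewrite normrM ger0_norm//; lra.
Qed.
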